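(* Let $T>0$, let $g_0,g_1:[0,T]\to\mathbb{R}$ be continuous with $g_1(t)<g_0(t)$ for $0\le t\le T$, and let $(W_t)$ be a standard Brownian motion. Let $(\mu_{0,n})$ (resp. $(\mu_{1,n})$) be a sequence of Schwartz distributions on $\mathbb{R}$ with compact supports contained in $[g_0(T),+\infty)$ (resp. $(-\infty,g_1(T)]$) such that: (i) for $0\le t<T$ and $w=g_0(t)$ or $w=g_1(t)$, $\sum_{i=0}^1 U_i(w,t;\mu_{i,n})\to1$ as $n\to\infty$; and (ii) for some constant $c'$, $|U_i(w,t;\mu_{i,n})|\le c'$ for all $n$, all $i\in\{0,1\}$, all $0\le t<T$ and all $g_1(t)\le w\le g_0(t)$. Then, for $g_1(0)\le u\le g_0(0)$, $$P(\tau(u)<T)=\lim_{n\to\infty}\sum_{i=0}^1U_i(u,0;\mu_{i,n}).$$ Furthermore, for $0<t\le T$, $$P(\sigma\le t)=\lim_{n\to\infty}\sum_{i=0}^1(-1)^i\left(N\left(\frac{g_i(t)}{\sqrt t}\right)-\int N_2\left(\frac{g_i(t)}{\sqrt t},-\frac{v}{\sqrt T};-\sqrt{\frac tT}\right)d\mu_{0,n}(v)-\int N_2\left(\frac{g_i(t)}{\sqrt t},\frac{v}{\sqrt T};\sqrt{\frac tT}\right)d\mu_{1,n}(v)\right).$$ Finally, if $g_i$ is $C^1$ on an open subset $I$ of $[0,T]$, for $i\in\{0,1\}$, and the sequence $U(g_i(t),t;\mu_{0,n}'-\mu_{1,n}')$ is uniformly bounded and converges to a continuous function of $t$ as $t\in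 I$ and $n\to\infty$, then, for $t\in I$, $$\frac{d}{dt}P(\sigma\le t)=\sum_{i=0}^1\frac{(-1)^i}{2\sqrt t}N'\left(\frac{g_i(t)}{\sqrt t}\right)\lim_{n\to\infty}U(g_i(t),t;\mu_{0,n}'-\mu_{1,n}').$$
   Context: $N(x)=(2\pi)^{-1/2}\int_{-\infty}^x e^{-s^2/2}\,ds$ is the standard normal distribution function and $N'$ its derivative. $N_2(x,y;\rho)=\int_{-\infty}^x\int_{-\infty}^y\frac{1}{2\pi\sqrt{1-\rho^2}}\exp\left(-\frac{u^2+v^2-2\rho uv}{2(1-\rho^2)}\right)du\,dv$ denotes the cumulative bivariate normal probability distribution function. $(W_t)$ starts at $W_0=0$. For real $u$, $\tau(u)=\inf\{t\in[0,T):u+W_t=g_0(t)\text{ or }u+W_t=g_1(t)\}$, with $\tau(u)=T$ if no such $t$ exists. $\sigma=\sup\{t\in(0,T]:W_t\ge g_0(t)\text{ or }W_t\le g_1(t)\}$, with $\sigma=0$ if the set is empty. For a compactly supported Schwartz distribution $\mu$ on $\mathbb{R}$, $\int\phi(v)\,d\mu(v)$ denotes the pairing of $\mu$ with a function $\phi$, and $\mu'$ is the distributional derivative of $\mu$. For $u\in\mathbb{R}$, $U(u,t;\mu)=\int N\left(\frac{u-v}{\sqrt{T-t}}\right)d\mu(v)$ if $0\le t<T$, and $U(u,t;\mu)=0$ otherwise. For $u\in\mathbb{R}$ and $0\le t<T$, $U_0(u,t;\mu)=U(u,t;\mu)$ and $U_1(u,t;\mu)=\int N\left(\frac{v-u}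{\sqrt{T-t}}\right)d\mu(v)$.
   Formalization: The second formula is proved for 0<t<T only: at t=T the correlations are −1 and 1, so N_2 is undefined, and with the degenerate law the right side is below 1 while P(σ≤T)=1. The set I is taken open in the real line, so it lies inside (0,T). *)

(* Defs.v *)
From HB Require Import structures.
From mathcomp Require Import all_boot all_order all_algebra.
From mathcomp Require Import all_classical all_reals all_analysis.

Set Implicit Arguments.
Unset Strict Implicit.
Unset Printing Implicit Defensive.

Import Order.TTheory GRing.Theory Num.Theory.
Import numFieldNormedType.Exports.

Local Open Scope classical_set_scope.
Local Open Scope ring_scope.

Section normal_cdf.
Context {R : realType}.
Implicit Types x y rho : R.

Definition normal_cdf x : R :=
  (Num.sqrt (2 * pi))^-1 *
  \int[lebesgue_measure]_(s in `]-oo, x]) expR (- (s ^+ 2) / 2).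

(* Only meaningful for `|rho| < 1. *)
Definition binormal_cdf x y rho : R :=
  \int[lebesgue_measure]_(u in `]-oo, x])
    \int[lebesgue_measure]_(v in `]-oo, y])
      ((2 * pi * Num.sqrt (1 - rho ^+ 2))^-1 *
       expR (- ((u ^+ 2 + v ^+ 2 - 2 * rho * u * v)
                / (2 * (1 - rho ^+ 2))))).

End normal_cdf.

Section distributions.
Context {R : realType}.

Definition smooth (phi : R -> R) : Prop :=
  forall (n : nat) (x : R), derivable (derive1n n phi) x 1.

Definition fun_support (phi : R -> R) : set R := closure [set x | phi x != 0].

Definition test_function (phi : R -> R) : Prop :=
  smooth phi /\ compact (fun_support phi).

(* A distribution is represented by a functional on all functions R -> R, of
   which only the values on test functions are constrained or ever used. *)
Definition functional : Type := (R -> R) -> R.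

Implicit Types mu nu : functional.

Definition schwartz_distribution mu : Prop :=
  (forall (a : R) (phi psi : R -> R),
     test_function phi -> test_function psi ->
     mu (fun x => a * phi x + psi x) = a * mu phi + mu psi) /\
  (forall K : set R, compact K ->
     exists (k : nat) (C : R), forall phi : R -> R,
       test_function phi -> fun_support phi `<=` K ->
       `|mu phi| <= C * \sum_(j < k.+1) sup (range (fun x => `|derive1n j phi x|))).

Definition vanishes_on mu (V : set R) : Prop :=
  forall phi : R -> R,
    test_function phi -> fun_support phi `<=` V -> mu phi = 0.

Definition dist_support mu : set R :=
  ~` \bigcup_(V in [set V : set R | open V /\ vanishes_on mu V]) V.

Definition cutoff mu (chi : R -> R) : Prop :=
  test_function chi /\
  (forall v, dist_support mu v -> \forall x \near v, chi x = 1).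

(* The pairing of a compactly supported distribution mu with a smooth function
   phi is mu (chi * phi), where chi is any cutoff for mu: the value does not
   depend on the choice of chi. *)
Definition pairing mu (phi : R -> R) : R :=
  mu (fun v => xget (cst 0) (cutoff mu : set (R -> R)) v * phi v).

Definition dist_deriv mu : functional := fun phi => - mu (derive1 phi).

Definition dist_sub mu nu : functional := fun phi => mu phi - nu phi.

End distributions.

Section heat_potentials.
Context {R : realType}.
Implicit Types (T u t : R) (mu : @functional R).

Definition U T u t mu : R :=
  if 0 <= t < T then
    pairing mu (fun v => normal_cdf ((u - v) / Num.sqrt (T - t)))
  else 0.

Definition U_ T (i : 'I_2) u t mu : R :=
  if i == ord0 then U T u t mu
  else pairing mu (fun v => normal_cdf ((v - u) / Num.sqrt (T - t))).

End heat_potentials.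

Section brownian_motion.
Context {R : realType} {d : measure_display} {Omega : measurableType d}.
Variable P : probability Omega R.

Definition mutually_independent n (X : 'I_n -> Omega -> R) : Prop :=
  forall A : 'I_n -> set R, (forall k, measurable (A k)) ->
    P (\bigcap_(k in [set: 'I_n]) (X k @^-1` A k)) =
    (\prod_(k < n) P (X k @^-1` A k))%E.

(* Only the times t >= 0 are relevant. *)
Definition standard_brownian_motion (W : R -> {RV P >-> R}) : Prop :=
  [/\ forall w, W 0 w = 0,
      forall w, {within `[0, +oo[, continuous (fun t => W t w)},
      forall s t, 0 <= s < t -> forall A : set R, measurable A ->
        P ((fun w => W t w - W s w) @^-1` A)
        = normal_prob 0 (Num.sqrt (t - s)) A
    & forall (n : nat) (t : nat -> R),
        0 <= t 0%N -> {homo t : j k / (j <= k)%N >-> j <= k} ->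
        mutually_independent
          (fun (k : 'I_n) w => W (t k.+1) w - W (t k) w)].

Variables (T : R) (g : 'I_2 -> R -> R) (W : R -> {RV P >-> R}).

Definition tau (u : R) (w : Omega) : R :=
  let A := [set t | 0 <= t < T /\
              (u + W t w = g ord0 t \/ u + W t w = g ord_max t)] in
  if A == set0 then T else inf A.

Definition sigma (w : Omega) : R :=
  let A := [set t | 0 < t <= T /\
              (g ord0 t <= W t w \/ W t w <= g ord_max t)] in
  if A == set0 then 0 else sup A.

End brownian_motion.

(* Main.v *)
Require Import Defs.
From HB Require Import structures.
From mathcomp Require Import all_boot all_order all_algebra.
From mathcomp Require Import all_classical all_reals all_analysis.
From mathcomp Require Import measurable_realfun ring lra.
Import Order.TTheory GRing.Theory Num.Theory.
Import numFieldNormedType.Exports.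
Local Open Scope classical_set_scope.
Local Open Scope ring_scope.

(** Let f_n(x,t) be the sum of the two heat potentials U_i(x,t;mu_{i,n}). It
solves the backward heat equation before time T, so that f_n(u+W_t,t) is a
martingale; it is bounded between the barriers, it tends to 0 at time T between
them because the two distributions live on the far sides of the barriers, and
on the barriers it tends to 1 with n. Stopping the martingale at the first
exit from the strip and letting n grow therefore turns f_n(u,0) into the
probability that an exit occurs before T ([exit_probability_limit]).

The last exit is read off in the same way. The event sigma <= t says that the
path is inside the strip during ]t,T]. Starting the stopping argument at time t
instead of 0 shows that the integral of 1 - f_n(x,t) against the law of W_t,
over the x between the barriers, converges to the probability of this event
([last_exit_limit]). Exchanging this integral with the pairing
([pairing_smear]) leaves an integral of a normal distribution function against
a normal density, that is, a bivariate normal distribution function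
([Rintegral_kern_ray]).

For the density, q_n = (1 - f_n) p with p the density of W_t has a time
derivative which is the space derivative of a flux, because f_n solves the
backward and p the forward heat equation. So the time derivative of the
integral of q_n over the strip only involves the barriers
([is_derive_strip_mass]). There 1 - f_n tends to 0 and the space derivative of
f_n is the potential of mu_0' - mu_1' ([U_gradient]); what remains in the limit
is half of this gradient times p, and bounded convergence of the derivatives
suffices to differentiate the limit ([is_derive_bounded_limit]).

The general tools are these. A compactly supported distribution is
bounded by finitely many derivatives near its support ([pairing_bound]), which
gives differentiation and Fubini under a pairing. The Markov property is needed
only on the events that the path has stayed inside up to some time; these are
limits of cylinders over dyadic times ([inside_markov]). The stopping theorem
comes from a telescoping sum over an equidistant grid, whose mesh tends to 0
([telescope_stopped]). The convolution identity that makes f_n a martingale is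
itself deduced from the independent increments ([normal_cdf_convolution]). *)

(** * Smooth functions on the line *)

Section smooth_calculus.
Context {R : realType}.
Implicit Types (f g : R -> R) (x y a b : R).

Lemma is_derive_derive1 {f x a} : is_derive x (1 : R) f a -> (derive1 f) x = a.
Proof. by move=> H; rewrite derive1E; apply: derive_val. Qed.

Lemma derivable_is_derive1 {f x} : derivable f x 1 -> is_derive x (1 : R) f ((derive1 f) x).
Proof. by move=> H; rewrite derive1E; exact: derivableP. Qed.

Lemma is_derive_add f g x a b :
  is_derive x (1 : R) f a -> is_derive x (1 : R) g b ->
  is_derive x (1 : R) (fun y => f y + g y) (a + b).
Proof. by move=> Hf Hg; exact: is_deriveD. Qed.

Lemma is_derive_mul f g x a b :
  is_derive x (1 : R) f a -> is_derive x (1 : R) g b ->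
  is_derive x (1 : R) (fun y => f y * g y) (a * g x + f x * b).
Proof.
move=> Hf Hg; rewrite (_ : (fun y => _) = f * g) //; apply: is_derive_eq.
by rewrite /GRing.scale /= addrC mulrC.
Qed.

Lemma is_derive_comp f g x a b :
  is_derive (g x) (1 : R) f a -> is_derive x (1 : R) g b ->
  is_derive x (1 : R) (fun y => f (g y)) (a * b).
Proof. by move=> Hf Hg; rewrite (_ : (fun y => _) = f \o g) //; exact: is_derive1_comp. Qed.

Lemma is_derive_scale c f x a :
  is_derive x (1 : R) f a -> is_derive x (1 : R) (fun y => c * f y) (c * a).
Proof.
move=> Hf; have := is_derive_mul (fun=> c) f x 0 a (is_derive_cst _ _ _) Hf.
by rewrite mul0r add0r.
Qed.

Lemma is_derive_affine a b x : is_derive x (1 : R) (fun y => a * y + b) a.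
Proof.
have Ha := is_derive_scale a id x 1 (is_derive_id _ _).
have := is_derive_add _ _ _ _ _ Ha (is_derive_cst b x 1).
by rewrite mulr1 addr0.
Qed.

Lemma is_derive_continuous f x a : is_derive x (1 : R) f a -> {for x, continuous f}.
Proof.
by move=> [+ _] => /derivable1_diffP /differentiable_continuous.
Qed.

(** Finitely many derivatives, so that closure under the ring operations and
composition can be shown by induction on their number. *)
Definition n_derivable (n : nat) f : Prop :=
  forall m x, (m < n)%N -> derivable ((derive1n m f)) x 1.

Lemma n_derivableS n f : n_derivable n.+1 f <->
  exists2 f', (forall x, is_derive x (1 : R) f (f' x)) & n_derivable n f'.
Proof.
split=> [H|[f' Hf Hf'] [|m] x mn].
- exists (derive1 f).
    by move=> x; apply: derivable_is_derive1; exact: (H 0%N).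
  by move=> m x mn; rewrite -derive1Sn; exact: H.
- by case: (Hf x).
- have -> : (derive1n (m.+1) f) = (derive1n m f').
    rewrite derive1Sn; congr (derive1n _ _).
    by apply/funext => y; exact: is_derive_derive1 (Hf y).
  exact: Hf'.
Qed.

Lemma smooth_n_derivable f : smooth f <-> forall n, n_derivable n f.
Proof.
split=> [H n m x _|H n x]; first exact: H.
by apply: (H n.+1).
Qed.

Lemma n_derivableW n f : n_derivable n.+1 f -> n_derivable n f.
Proof. by move=> H m x mn; apply: H; rewrite ltnS ltnW. Qed.

Lemma n_derivable_cst n c : n_derivable n (fun=> c : R).
Proof.
elim: n c => [|n IH] c; first by move=> m x.
apply/n_derivableS; exists (fun=> 0) => //.
by move=> x; exact: is_derive_cst.
Qed.

Lemma n_derivable_add n f g :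
  n_derivable n f -> n_derivable n g -> n_derivable n (fun x => f x + g x).
Proof.
elim: n f g => [f g _ _ m x //|n IH f g].
move=> /n_derivableS[f' Hf Hf'] /n_derivableS[g' Hg Hg'].
apply/n_derivableS; exists (fun x => f' x + g' x); last exact: IH.
by move=> x; exact: is_derive_add.
Qed.

Lemma n_derivable_mul n f g :
  n_derivable n f -> n_derivable n g -> n_derivable n (fun x => f x * g x).
Proof.
elim: n f g => [f g _ _ m x //|n IH f g] Df Dg.
move: (Df) (Dg) => /n_derivableS[f' Hf Hf'] /n_derivableS[g' Hg Hg'].
apply/n_derivableS; exists (fun x => f' x * g x + f x * g' x).
  by move=> x; exact: is_derive_mul.
apply: n_derivable_add; [apply: (IH f' g Hf')|apply: (IH f g' _ Hg')].
  exact: n_derivableW Dg.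
exact: n_derivableW Df.
Qed.

Lemma n_derivable_comp n f g :
  n_derivable n f -> n_derivable n g -> n_derivable n (fun x => f (g x)).
Proof.
elim: n f g => [f g _ _ m x //|n IH f g] Df Dg.
move: (Df) (Dg) => /n_derivableS[f' Hf Hf'] /n_derivableS[g' Hg Hg'].
apply/n_derivableS; exists (fun x => f' (g x) * g' x).
  by move=> x; exact: is_derive_comp.
apply: n_derivable_mul; last exact: Hg'.
exact: (IH f' g Hf' (n_derivableW _ _ Dg)).
Qed.

Lemma n_derivable_inv n f :
  (forall x, f x != 0) -> n_derivable n f -> n_derivable n (fun x => (f x)^-1).
Proof.
move=> f0; elim: n => [_ m x //|n IH] Df.
move: (Df) => /n_derivableS[f' Hf Hf'].
have IHf := IH (n_derivableW _ _ Df).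
apply/n_derivableS; exists (fun x => (-1) * (f' x * ((f x)^-1 * (f x)^-1))).
  move=> x; have H := @is_deriveV R f x (f' x) 1 (f0 x) (Hf x).
  by apply: is_derive_eq; rewrite /GRing.scale /= -exprVn expr2; ring.
apply: (n_derivable_mul _ (fun=> -1)); first exact: n_derivable_cst.
apply: (n_derivable_mul _ f' _ Hf'); exact: (n_derivable_mul _ _ _ IHf IHf).
Qed.

Lemma smooth_cst (c : R) : smooth (fun=> c : R).
Proof. by apply/smooth_n_derivable => n; exact: n_derivable_cst. Qed.

Lemma smooth_add f g : smooth f -> smooth g -> smooth (fun x => f x + g x).
Proof.
move=> /smooth_n_derivable Df /smooth_n_derivable Dg.
by apply/smooth_n_derivable => n; exact: n_derivable_add.
Qed.

Lemma smooth_mul f g : smooth f -> smooth g -> smooth (fun x => f x * g x).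
Proof.
move=> /smooth_n_derivable Df /smooth_n_derivable Dg.
by apply/smooth_n_derivable => n; exact: n_derivable_mul.
Qed.

Lemma smooth_comp f g : smooth f -> smooth g -> smooth (fun x => f (g x)).
Proof.
move=> /smooth_n_derivable Df /smooth_n_derivable Dg.
by apply/smooth_n_derivable => n; exact: n_derivable_comp.
Qed.

Lemma smooth_inv f : (forall x, f x != 0) -> smooth f -> smooth (fun x => (f x)^-1).
Proof.
move=> f0 /smooth_n_derivable Df.
by apply/smooth_n_derivable => n; exact: n_derivable_inv.
Qed.

Lemma smooth_scale c f : smooth f -> smooth (fun x => c * f x).
Proof. exact: (smooth_mul (fun=> c) f (smooth_cst c)). Qed.

Lemma smoothI f f' : (forall x, is_derive x (1 : R) f (f' x)) -> smooth f' -> smooth f.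
Proof.
move=> Hf /smooth_n_derivable Df; apply/smooth_n_derivable => n.
by apply: n_derivableW; apply/n_derivableS; exists f'.
Qed.

Lemma smooth_affine a b : smooth (fun x => a * x + b).
Proof.
apply: (smoothI _ (fun=> a)); last exact: smooth_cst.
by move=> x; exact: is_derive_affine.
Qed.

Lemma smooth_derive1n n f : smooth f -> smooth (derive1n n f).
Proof.
move=> Hf m x; have := Hf (m + n)%N x.
by rewrite /derive1n iterD.
Qed.

Lemma smooth_derive1 f : smooth f -> smooth (derive1 f).
Proof. exact: (smooth_derive1n 1). Qed.

Lemma smooth_is_derive f n x : smooth f ->
  is_derive x (1 : R) ((derive1n n f)) ((derive1n (n.+1) f) x).
Proof. by move=> /(_ n x); exact: derivable_is_derive1. Qed.

Lemma smooth_is_derive1 f x : smooth f -> is_derive x (1 : R) f ((derive1 f) x).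
Proof. exact: (smooth_is_derive f 0). Qed.

Lemma smooth_continuous f : smooth f -> continuous f.
Proof. by move=> Hf x; apply: is_derive_continuous; exact: smooth_is_derive1. Qed.

Lemma smooth_continuous_derive1n n f : smooth f -> continuous (derive1n n f).
Proof. by move=> Hf; apply: smooth_continuous; exact: smooth_derive1n. Qed.

Lemma derive1_ext f f' : (forall x, is_derive x (1 : R) f (f' x)) -> (derive1 f) = f'.
Proof. by move=> H; apply/funext => x; exact: is_derive_derive1. Qed.

Lemma derive1n_add n f g : smooth f -> smooth g ->
  derive1n n (fun x => f x + g x) = (fun x => (derive1n n f) x + (derive1n n g) x).
Proof.
elim: n f g => [//|n IH] f g Hf Hg.
have E : derive1 (fun x => f x + g x) = (fun x => (derive1 f) x + (derive1 g) x).
  by apply: derive1_ext => x; apply: is_derive_add; exact: smooth_is_derive1.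
have sf := smooth_derive1 f Hf; have sg := smooth_derive1 g Hg.
by rewrite derive1Sn E (IH _ _ sf sg) -!derive1Sn.
Qed.

Lemma derive1n_scale n c f : smooth f ->
  derive1n n (fun x => c * f x) = (fun x => c * (derive1n n f) x).
Proof.
elim: n f => [//|n IH] f Hf.
have E : derive1 (fun x => c * f x) = (fun x => c * (derive1 f) x).
  by apply: derive1_ext => x; apply: is_derive_scale; exact: smooth_is_derive1.
by rewrite derive1Sn E (IH _ (smooth_derive1 f Hf)) -!derive1Sn.
Qed.

Lemma is_derive_comp_affine a b f x c : is_derive (a * x + b) (1 : R) f c ->
  is_derive x (1 : R) (fun y => f (a * y + b)) (a * c).
Proof.
move=> H; have := is_derive_comp f (fun y => a * y + b) _ _ _ H (is_derive_affine a b x).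
by rewrite mulrC.
Qed.

Lemma smooth_comp_affine a b f : smooth f -> smooth (fun x => f (a * x + b)).
Proof. by move=> Hf; exact: (smooth_comp f _ Hf (smooth_affine a b)). Qed.

Lemma derive1n_comp_affine n a b f : smooth f ->
  derive1n n (fun x => f (a * x + b)) = (fun x => a ^+ n * (derive1n n f) (a * x + b)).
Proof.
elim: n f => [f _|n IH f Hf]; first by apply/funext => x; rewrite mul1r.
have E : derive1 (fun x => f (a * x + b)) = (fun x => a * derive1 f (a * x + b)).
  by apply: derive1_ext => x; apply: is_derive_comp_affine; exact: smooth_is_derive1.
rewrite derive1Sn E derive1n_scale; last exact: (smooth_comp_affine _ _ _ (smooth_derive1 _ Hf)).
rewrite IH; last exact: smooth_derive1.
by apply/funext => x; rewrite derive1Sn mulrA exprS.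
Qed.

Lemma derive1n_cst n (c : R) : derive1n n.+1 (fun=> c : R) = (fun=> 0).
Proof.
elim: n => [|n IH].
  by apply: derive1_ext => x; exact: is_derive_cst.
by rewrite derive1nS IH; apply: derive1_ext => x; exact: is_derive_cst.
Qed.

(** * Bounds on the derivatives up to a given order *)

Definition jet_bound (k : nat) (v M : R) f : Prop :=
  forall j, (j <= k)%N -> `|(derive1n j f) v| <= M.

Lemma jet_bound_ge0 k v M f : jet_bound k v M f -> 0 <= M.
Proof. by move=> /(_ 0%N isT); apply: le_trans. Qed.

Lemma jet_boundS k v M f :
  jet_bound k.+1 v M f <-> `|f v| <= M /\ jet_bound k v M (derive1 f).
Proof.
split=> [H|[H0 H1] [//|j jk]]; last by rewrite derive1Sn; exact: H1.
split; first exact: (H 0%N).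
by move=> j jk; rewrite -derive1Sn; exact: H.
Qed.

Lemma jet_boundW k v M f : jet_bound k.+1 v M f -> jet_bound k v M f.
Proof. by move=> H j jk; apply: H; exact: leqW. Qed.

Lemma jet_bound_add k v M M' f g : smooth f -> smooth g ->
  jet_bound k v M f -> jet_bound k v M' g ->
  jet_bound k v (M + M') (fun x => f x + g x).
Proof.
move=> sf sg Hf Hg j jk; rewrite derive1n_add//.
by apply: le_trans (ler_normD _ _) _; apply: lerD; [exact: Hf|exact: Hg].
Qed.

(** A crude Leibniz rule: each differentiation doubles the number of terms. *)
Lemma jet_bound_mul k v M M' f g : smooth f -> smooth g ->
  jet_bound k v M f -> jet_bound k v M' g ->
  jet_bound k v (2 ^+ k * (M * M')) (fun x => f x * g x).
Proof.
elim: k f g => [|k IH] f g sf sg Hf Hg.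
  move=> [|//] _; rewrite expr0 mul1r /= normrM.
  by apply: ler_pM => //; [exact: (Hf 0%N)|exact: (Hg 0%N)].
have M0 := jet_bound_ge0 _ _ _ _ Hf; have M'0 := jet_bound_ge0 _ _ _ _ Hg.
apply/jet_boundS; split.
  apply: (@le_trans _ _ (M * M')).
    by rewrite normrM; apply: ler_pM => //; [exact: (Hf 0%N)|exact: (Hg 0%N)].
  by apply: ler_peMl; [exact: mulr_ge0|apply: exprn_ege1; lra].
move: (Hf) (Hg) => /jet_boundS[_ Hf'] /jet_boundS[_ Hg'].
have -> : derive1 (fun x => f x * g x) = (fun x => derive1 f x * g x + f x * derive1 g x).
  by apply: derive1_ext => x; apply: is_derive_mul; exact: smooth_is_derive1.
have sf' := smooth_derive1 _ sf; have sg' := smooth_derive1 _ sg.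
rewrite exprS (_ : 2 * _ * _ = 2 ^+ k * (M * M') + 2 ^+ k * (M * M')); last by ring.
apply: jet_bound_add; [exact: smooth_mul|exact: smooth_mul| |].
  by apply: IH => //; exact: jet_boundW.
by apply: IH => //; exact: jet_boundW.
Qed.

(** * Mean value estimates *)

Lemma lipschitz_is_derive f f' M a b : a <= b ->
  (forall x, a <= x <= b -> is_derive x (1 : R) f (f' x)) ->
  (forall x, a <= x <= b -> `|f' x| <= M) -> `|f b - f a| <= M * (b - a).
Proof.
move=> ab Hf HM.
have [||c cab ->] := @MVT_segment R f f' a b ab.
- by move=> x; rewrite in_itv/= => /andP[ax xb]; apply: Hf; rewrite !ltW.
- apply: derivable_within_continuous => x; rewrite in_itv/= => xab.
  by have [] := Hf x xab.
- rewrite normrM (ger0_norm (_ : 0 <= b - a)) ?subr_ge0//.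
  by apply: ler_wpM2r; [rewrite subr_ge0|apply: HM; move: cab; rewrite in_itv].
Qed.

Lemma lipschitz_line f f' M x y : (forall z, is_derive z (1 : R) f (f' z)) ->
  (forall z, `|f' z| <= M) -> `|f y - f x| <= M * `|y - x|.
Proof.
move=> Hf HM; have [xy|yx] := leP x y.
  rewrite (ger0_norm (_ : 0 <= y - x)) ?subr_ge0//.
  by apply: (lipschitz_is_derive f f') => // z _.
rewrite distrC (distrC y) (ger0_norm (_ : 0 <= x - y)) ?subr_ge0; last exact: ltW.
by apply: (lipschitz_is_derive f f') => //; exact: ltW.
Qed.

(** The constant M, instead of M / 2, is what the mean value inequality applied
to the remainder gives. *)
Lemma taylor1_is_derive f f' M x y (A := Num.min x y) (B := Num.max x y) :
  (forall z, A <= z <= B -> is_derive z (1 : R) f (f' z)) ->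
  (forall z, A <= z <= B -> `|f' z - f' x| <= M * `|z - x|) ->
  `|f y - f x - (y - x) * f' x| <= M * `|y - x| ^+ 2.
Proof.
move=> Hf HM.
have AB : A <= B by rewrite /A /B minEle maxEle; case: ifP => // /negbT; rewrite -ltNge => /ltW.
have xAB : A <= x <= B by rewrite /A /B ge_min le_max !lexx.
have yAB : A <= y <= B by rewrite /A /B ge_min le_max !lexx !orbT.
have [->|xy] := eqVneq x y; first by rewrite !subrr mul0r subrr !normr0 expr0n /= mulr0.
have M0 : 0 <= M.
  have := HM y yAB; have : 0 < `|y - x| by rewrite normr_gt0 subr_eq0 eq_sym.
  by move=> p /(le_trans (normr_ge0 _)); rewrite pmulr_lge0.
pose G z := f z + (- f' x) * z.
have HG z : A <= z <= B -> is_derive z (1 : R) G (f' z + (- f' x)).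
  move=> zAB; apply: is_derive_add; first exact: Hf.
  by have := is_derive_affine (- f' x) 0 z; under eq_fun do rewrite addr0.
have HGM z : A <= z <= B -> `|f' z + - f' x| <= M * `|y - x|.
  move=> /[dup] zAB /HM /le_trans; apply; apply: ler_wpM2l => //.
  move: zAB; rewrite /A /B minEle maxEle; case: (leP x y) => xy' /andP[z1 z2].
    by rewrite !ger0_norm; lra.
  by rewrite !ler0_norm; lra.
have -> : f y - f x - (y - x) * f' x = G y - G x by rewrite /G; ring.
rewrite expr2 mulrA.
have [xy'|xy'] := leP x y.
  rewrite {2}(ger0_norm (_ : 0 <= y - x)) ?subr_ge0//.
  apply: (lipschitz_is_derive _ (fun z => f' z + - f' x)) => // z zxy.
    by apply: HG; rewrite /A /B (min_idPl xy') (max_idPr xy').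
  by apply: HGM; rewrite /A /B (min_idPl xy') (max_idPr xy').
rewrite distrC [`|y - x|]distrC (ger0_norm (_ : 0 <= x - y)) ?subr_ge0; last exact: ltW.
apply: (lipschitz_is_derive _ (fun z => f' z + - f' x)); first exact: ltW.
  by move=> z zxy; apply: HG; rewrite /A /B (min_idPr (ltW xy')) (max_idPl (ltW xy')).
move=> z zxy; have -> : x - y = `|y - x| by rewrite distrC ger0_norm // subr_ge0 ltW.
by apply: HGM; rewrite /A /B (min_idPr (ltW xy')) (max_idPl (ltW xy')).
Qed.

(** Derivatives of pairings and integrals with respect to a parameter are found
with this criterion: a quadratic remainder survives any bounded linear
operation, uniformly in the other variables. *)
Lemma is_derive_of_remainder f x c M (d : R) : 0 < d ->
  (forall y, `|y - x| < d -> `|f y - f x - (y - x) * c| <= M * `|y - x| ^+ 2) ->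
  is_derive x (1 : R) f c.
Proof.
move=> d0 H.
have M0 : 0 <= M.
  have dx : `|x + d / 2 - x| = d / 2.
    by rewrite addrC addKr ger0_norm // ltW // divr_gt0.
  have := H (x + d / 2); rewrite dx => /(_ ltac:(lra)) /(le_trans (normr_ge0 _)).
  by rewrite pmulr_lge0 // exprn_gt0 // divr_gt0.
have key : (fun h => h^-1 *: (f (h *: (1 : R) + x) - f x)) @ 0^' --> c.
  apply/cvgrPdist_le => e e0.
  near=> h.
  have h0 : h != 0 by near: h; exact: nbhs_dnbhs_neq.
  have hd : `|h| < d by near: h; apply: dnbhs0_lt.
  have he : `|h| <= e / (M + 1).
    by near: h; apply: dnbhs0_le; rewrite divr_gt0 // ltr_wpDl.
  have := H (h + x); rewrite addrK => /(_ hd).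
  rewrite /GRing.scale /= mulr1 => Hh.
  rewrite (_ : c - _ = - h^-1 * (f (h + x) - f x - h * c)); last by field.
  rewrite normrM normrN normfV ler_pdivrMl ?normr_gt0//.
  apply: (le_trans Hh); rewrite expr2 mulrCA; apply: ler_wpM2l => //.
  apply: (@le_trans _ _ ((M + 1) * `|h|)); first by apply: ler_wpM2r => //; lra.
  by rewrite mulrC -ler_pdivlMr // ltr_wpDl.
by apply: DeriveDef; [apply/cvg_ex; exists c|rewrite /derive; apply/cvg_lim].
Unshelve. all: by end_near.
Qed.

End smooth_calculus.

(** * Plateau functions *)

Section bump.
Context {R : realType}.
Implicit Types (x y z : R).

Lemma pow_expRN_bounded (m : nat) :
  exists2 C : R, 0 < C & forall z, 0 <= z -> z ^+ m * expR (- z) <= C.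
Proof.
case: m => [|m].
  by exists 1 => // z z0; rewrite expr0 mul1r -expR0 ler_expR; lra.
exists (m.+1`!%:R); first by rewrite ltr0n fact_gt0.
move=> z z0; rewrite expRN ler_pdivrMr ?expR_gt0//.
have := expR_ge1Dxn m z0; rewrite addrC => H.
rewrite mulrC -ler_pdivrMr ?ltr0n ?fact_gt0//; apply: le_trans H.
by rewrite lerDl.
Qed.

(** The powers of 1/x in front of exp (- 1/x) make the family stable under
differentiation, so that all its members are smooth at once. *)
Definition flat (k : nat) x : R := if 0 < x then x^-1 ^+ k * expR (- x^-1) else 0.

Lemma flat_gt0 x : 0 < x -> 0 < flat 0 x.
Proof. by move=> x0; rewrite /flat x0 expr0 mul1r expR_gt0. Qed.

Lemma flat_le0 k x : x <= 0 -> flat k x = 0.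
Proof. by rewrite /flat leNgt => /negbTE ->. Qed.

Lemma flat0_ge0 x : 0 <= flat 0 x.
Proof. by have [x0|x0] := ltP 0 x; [exact: ltW (flat_gt0 _ x0)|rewrite flat_le0]. Qed.

(** At 0 the exponential beats every power of 1/x, which leaves a quadratic
remainder. *)
Lemma is_derive_flat k x :
  is_derive x (1 : R) (flat k) ((- k%:R) * flat k.+1 x + flat k.+2 x).
Proof.
have [x0|x0|->] := ltgtP x 0.
- rewrite !flat_le0 ?(ltW x0)// mulr0 addr0.
  apply: (@near_eq_is_derive R R R (cst 0) _ x 1 0).
  near=> y; rewrite flat_le0//; near: y.
  by apply: filterS (lt_nbhsl x0) => y; exact: ltW.
- have inv : is_derive x (1 : R) (fun y => y^-1) (- (x^-1 * x^-1)).
    have xn0 : x != 0 by rewrite gt_eqF.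
    have H := @is_deriveV R id x 1 1 xn0 (is_derive_id _ _).
    apply: is_derive_eq.
    by rewrite /GRing.scale /= mulr1 -exprVn expr2.
  apply: (@near_eq_is_derive _ _ _ (fun y => y^-1 ^+ k * expR (- y^-1))).
    near=> y; rewrite /flat ifT//; near: y; exact: lt_nbhsr x0.
  have He : is_derive x (1 : R) (fun y => expR ((-1) * y^-1 + 0))
      ((-1) * expR ((-1) * x^-1 + 0) * (- (x^-1 * x^-1))).
    apply: (is_derive_comp (fun z => expR ((-1) * z + 0)) (fun y => y^-1)) => //.
    exact: (is_derive_comp_affine (-1) 0 expR _ _ (is_derive_expR _)).
  have Hp : is_derive x (1 : R) (fun y => y^-1 ^+ k)
      (k%:R * x^-1 ^+ k.-1 * (- (x^-1 * x^-1))).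
    apply: (is_derive_comp (fun z => z ^+ k) (fun y => y^-1)) => //.
    have H := @is_deriveX R R id k x^-1 1 1 (is_derive_id _ _).
    rewrite exprfctE in H.
    by apply: is_derive_eq; rewrite /GRing.scale /= mulr1.
  have -> : (fun y => y^-1 ^+ k * expR (- y^-1)) =
            (fun y => y^-1 ^+ k * expR ((-1) * y^-1 + 0)).
    by apply/funext => y; congr (_ * expR _); ring.
  apply: (is_derive_eq (is_derive_mul _ _ _ _ _ Hp He)).
  rewrite /flat x0 mulN1r addr0.
  case: k {Hp} => [|k] /=; rewrite ?expr0 !exprS; ring.
- rewrite !flat_le0// mulr0 addr0.
  have [C C0 HC] := pow_expRN_bounded k.+2.
  apply: (is_derive_of_remainder _ _ _ C 1 ltr01) => y _.
  rewrite (flat_le0 k 0)// mulr0 !subr0.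
  have [y0|y0] := ltP 0 y; last by rewrite flat_le0// normr0 mulr_ge0 ?exprn_ge0// ltW.
  have yV : 0 <= y^-1 by rewrite invr_ge0 ltW.
  rewrite /flat y0 ger0_norm ?mulr_ge0 ?exprn_ge0 ?expR_ge0//.
  rewrite (ger0_norm (ltW y0)).
  have := HC _ yV; rewrite !exprS -!mulrA => H.
  have -> : y^-1 ^+ k * expR (- y^-1) =
            y^-1 * (y^-1 * (y^-1 ^+ k * expR (- y^-1))) * (y * y).
    by field; rewrite gt_eqF.
  by rewrite expr0 mulr1; apply: ler_wpM2r => //; rewrite mulr_ge0// ltW.
Unshelve. all: by end_near.
Qed.

Lemma smooth_flat k : smooth (flat k).
Proof.
apply/smooth_n_derivable => n; elim: n k => [k m x //|n IH] k.
apply/n_derivableS; exists (fun x => (- k%:R) * flat k.+1 x + flat k.+2 x).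
  by move=> x; exact: is_derive_flat.
apply: n_derivable_add; last exact: IH.
by apply: n_derivable_mul; [exact: n_derivable_cst|exact: IH].
Qed.

Lemma flat_den_gt0 x : 0 < flat 0 x + flat 0 ((-1) * x + 1).
Proof.
have [x0|x0] := ltP 0 x.
  by apply: ltr_wpDr; [exact: flat0_ge0|exact: flat_gt0].
by apply: ltr_wpDl; [exact: flat0_ge0|apply: flat_gt0; lra].
Qed.

Definition smooth_step x : R := flat 0 x * (flat 0 x + flat 0 ((-1) * x + 1))^-1.

Lemma smooth_smooth_step : smooth smooth_step.
Proof.
apply: smooth_mul; first exact: smooth_flat.
apply: smooth_inv; first by move=> x; rewrite gt_eqF// flat_den_gt0.
apply: smooth_add; first exact: smooth_flat.
exact: (smooth_comp_affine _ _ _ (smooth_flat 0)).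
Qed.

Lemma smooth_step_le0 x : x <= 0 -> smooth_step x = 0.
Proof. by move=> x0; rewrite /smooth_step flat_le0// mul0r. Qed.

Lemma smooth_step_ge1 x : 1 <= x -> smooth_step x = 1.
Proof.
move=> x1; rewrite /smooth_step (flat_le0 _ ((-1) * x + 1)); last lra.
by rewrite addr0 divff// gt_eqF// flat_gt0//; lra.
Qed.

(** The two margins leave room for the plateau to be 1 on a neighbourhood of the
segment, as a cutoff must be, and still have compact support. *)
Definition plateau c d (e : R) x : R :=
  smooth_step (2 / e * x + 2 / e * (e - c)) *
  smooth_step (- (2 / e) * x + 2 / e * (d + e)).

Lemma smooth_plateau c d e : smooth (plateau c d e).
Proof.
by apply: smooth_mul; apply: smooth_comp_affine; exact: smooth_smooth_step.
Qed.

Lemma plateau_eq1 c d e x : 0 < e -> c - e / 2 <= x <= d + e / 2 ->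
  plateau c d e x = 1.
Proof.
move=> e0 /andP[cx xd]; rewrite /plateau !smooth_step_ge1 ?mulr1//.
  rewrite (_ : _ + _ = 2 / e * (d + e - x)); last by ring.
  by rewrite mulrAC ler_pdivlMr//; lra.
rewrite -mulrDr mulrAC ler_pdivlMr//; lra.
Qed.

Lemma plateau_eq0 c d e x : 0 < e -> (x <= c - e) || (d + e <= x) ->
  plateau c d e x = 0.
Proof.
move=> e0 /orP[xc|dx]; rewrite /plateau.
  rewrite smooth_step_le0 ?mul0r// -mulrDr pmulr_rle0 ?divr_gt0//; lra.
rewrite [X in _ * X]smooth_step_le0 ?mulr0//.
rewrite (_ : _ + _ = 2 / e * (d + e - x)); last by ring.
by rewrite pmulr_rle0 ?divr_gt0//; lra.
Qed.

End bump.

(** * Test functions and their supports *)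

Section test_functions.
Context {R : realType}.
Implicit Types (f g phi psi : R -> R) (x y : R).

Lemma fun_support_sub f (F : set R) : closed F ->
  (forall x, f x != 0 -> F x) -> fun_support f `<=` F.
Proof. by move=> cF H; rewrite /fun_support closureE; apply: smallest_sub. Qed.

Lemma fun_support_nz f x : f x != 0 -> fun_support f x.
Proof. by move=> H; exact: subset_closure. Qed.

Lemma closed_segment (a b : R) : closed `[a, b].
Proof. exact: interval_closed. Qed.

Lemma test_functionI f a b : smooth f ->
  (forall x, f x != 0 -> a <= x <= b) -> test_function f.
Proof.
move=> sf H; split=> //.
apply: (subclosed_compact _ (@segment_compact R a b)); first exact: closed_closure.
apply: fun_support_sub; first exact: closed_segment.
by move=> x /H; rewrite /= in_itv.
Qed.

Lemma compact_segment (K : set R) : compact K -> exists M, 0 < M /\ K `<=` `[- M, M].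
Proof.
move=> /compact_bounded [M [_ HM]]; exists (`|M| + 1); split.
  by apply: ltr_wpDl.
move=> x Kx; have := HM (`|M| + 1) _ x Kx.
rewrite /= in_itv /= -ler_norml; apply.
by apply: le_lt_trans (ler_norm _) _; rewrite ltrDl.
Qed.

Lemma test_function_segment f : test_function f ->
  exists M, 0 < M /\ fun_support f `<=` `[- M, M].
Proof. by move=> [_]; exact: compact_segment. Qed.

Lemma test_function_mull f g : smooth f -> test_function g ->
  test_function (fun x => g x * f x).
Proof.
move=> sf /[dup] tg [sg _]; have [M [_ HM]] := test_function_segment _ tg.
apply: (test_functionI _ (- M) M); first exact: smooth_mul.
move=> x; rewrite mulf_eq0 negb_or => /andP[gx _].
by have := HM x (fun_support_nz _ _ gx); rewrite /= in_itv.
Qed.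

Lemma test_function_lin c f g : test_function f -> test_function g ->
  test_function (fun x => c * f x + g x).
Proof.
move=> /[dup] tf [sf _] /[dup] tg [sg _].
have [M [M0 HM]] := test_function_segment _ tf.
have [M' [M'0 HM']] := test_function_segment _ tg.
apply: (test_functionI _ (- (M + M')) (M + M')).
  exact: (smooth_add _ _ (smooth_scale c f sf) sg).
move=> x Hx.
have [fx|fx] := eqVneq (f x) 0.
  have gx : g x != 0 by move: Hx; rewrite fx mulr0 add0r.
  have := HM' x (fun_support_nz _ _ gx).
  by rewrite /= in_itv /= => /andP[? ?]; apply/andP; split; lra.
have := HM x (fun_support_nz _ _ fx).
by rewrite /= in_itv /= => /andP[? ?]; apply/andP; split; lra.
Qed.

Lemma test_function0 : test_function (fun=> 0 : R).
Proof. by apply: (test_functionI _ 0 0); [exact: smooth_cst|move=> x; rewrite eqxx]. Qed.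

Lemma test_function_add f g : test_function f -> test_function g ->
  test_function (fun x => f x + g x).
Proof.
move=> tf tg; have := test_function_lin 1 f g tf tg.
by under eq_fun do rewrite mul1r.
Qed.

Lemma zero_open_derive f (O : set R) : open O -> (forall x, O x -> f x = 0) ->
  forall x, O x -> is_derive x (1 : R) f 0.
Proof.
move=> oO fO x Ox.
apply: (@near_eq_is_derive R R R (cst 0) _ x 1 0).
have : nbhs x O by exact: open_nbhs_nbhs.
by apply: filterS => y /fO ->.
Qed.

Lemma zero_open_derive1n f (O : set R) n : open O -> (forall x, O x -> f x = 0) ->
  forall x, O x -> derive1n n f x = 0.
Proof.
move=> oO fO; elim: n => [//|n IH] x Ox.
rewrite derive1nS; apply: is_derive_derive1; exact: zero_open_derive Ox.
Qed.

Lemma fun_support_open f : open (~` fun_support f).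
Proof. by apply: closed_openC; exact: closed_closure. Qed.

Lemma fun_support0 f x : (~` fun_support f) x -> f x = 0.
Proof.
by move=> H; apply/eqP; apply: contrapT => /negP fx; apply: H; exact: fun_support_nz.
Qed.

Lemma fun_support_derive1 f : fun_support (derive1 f) `<=` fun_support f.
Proof.
apply: fun_support_sub; first exact: closed_closure.
move=> x fx; apply: contrapT => nx; move/negP: fx; apply; apply/eqP.
by apply: (zero_open_derive1n f _ 1 (fun_support_open f)) => // y; exact: fun_support0.
Qed.

Lemma test_function_derive1 f : test_function f -> test_function (derive1 f).
Proof.
move=> [sf cf]; split; first exact: smooth_derive1.
apply: subclosed_compact cf _; first exact: closed_closure.
exact: fun_support_derive1.
Qed.

Lemma derive1n_bounded f n (a b : R) : smooth f ->
  exists2 A, 0 <= A & forall x, a <= x <= b -> `|derive1n n f x| <= A.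
Proof.
move=> sf; have cf : {within `[a, b], continuous (derive1n n f)}.
  by apply: continuous_subspaceT; exact: smooth_continuous_derive1n.
have [M [_ HM]] := compact_bounded (continuous_compact cf (@segment_compact R a b)).
exists (`|M| + 1); first by rewrite addr_ge0.
move=> x xab; apply: (HM (`|M| + 1)); last by exists x; rewrite //= in_itv.
by apply: le_lt_trans (ler_norm _) _; rewrite ltrDl.
Qed.

Lemma jet_bound_segment f k (a b : R) : smooth f ->
  exists2 A, 0 <= A & forall x, a <= x <= b -> jet_bound k x A f.
Proof.
move=> sf; elim: k => [|k [A A0 HA]].
  have [A A0 HA] := derive1n_bounded f 0 a b sf.
  by exists A => // x xab [|//] _; exact: HA.
have [B B0 HB] := derive1n_bounded f k.+1 a b sf.
exists (A + B); first by rewrite addr_ge0.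
move=> x xab j; rewrite leq_eqVlt => /orP[/eqP ->|jk].
  by apply: le_trans (HB x xab) _; rewrite lerDr.
by apply: le_trans (HA x xab j jk) _; rewrite lerDl.
Qed.

End test_functions.

(** * The pairing with a compactly supported distribution *)

Section linear_functionals.
Context {R : realType}.
Implicit Types (f g phi psi chi : R -> R) (x y c d e : R) (mu : @functional R).

(** Locality and the choice of cutoffs are matters of linearity alone, so they
hold for derivatives and differences of distributions as well. *)
Definition test_linear mu : Prop := forall a f g,
  test_function f -> test_function g ->
  mu (fun x => a * f x + g x) = a * mu f + mu g.

Lemma test_linear0 mu : test_linear mu -> mu (fun=> 0) = 0.
Proof.
move=> H; have := H (-1) _ _ test_function0 test_function0.
by under eq_fun do rewrite mulr0 addr0; rewrite mulN1r addNr.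
Qed.

Lemma test_linearD mu f g : test_linear mu -> test_function f -> test_function g ->
  mu (fun x => f x + g x) = mu f + mu g.
Proof.
move=> H tf tg; have := H 1 f g tf tg; rewrite mul1r => <-.
by congr mu; apply/funext => x; rewrite mul1r.
Qed.

Lemma test_function_sum n (F : nat -> R -> R) :
  (forall k, test_function (F k)) -> test_function (fun x => \sum_(k < n) F k x).
Proof.
move=> tF; elim: n => [|n IH].
  rewrite (_ : (fun x => _) = (fun=> 0)); first exact: test_function0.
  by apply/funext => x; rewrite big_ord0.
rewrite (_ : (fun x => _) = (fun x => \sum_(k < n) F k x + F n x)).
  exact: test_function_add.
by apply/funext => x; rewrite big_ord_recr.
Qed.

Lemma test_linear_sum mu n (F : nat -> R -> R) : test_linear mu ->
  (forall k, test_function (F k)) ->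
  mu (fun x => \sum_(k < n) F k x) = \sum_(k < n) mu (F k).
Proof.
move=> H tF; elim: n => [|n IH].
  rewrite big_ord0 (_ : (fun x => _) = (fun=> 0)) ?test_linear0//.
  by apply/funext => x; rewrite big_ord0.
rewrite big_ord_recr /= -IH -test_linearD//; last exact: test_function_sum.
by congr mu; apply/funext => x; rewrite big_ord_recr.
Qed.

Lemma closed_dist_support mu : closed (dist_support mu).
Proof. by apply: open_closedC; apply: bigcup_open => V []. Qed.

Lemma dist_supportPn mu x : (~` dist_support mu) x ->
  exists V, [/\ open V, vanishes_on mu V & V x].
Proof.
by rewrite /dist_support setCK => -[V [oV vV] Vx]; exists V.
Qed.

(** Integer translates of this bump telescope to a partition of unity. *)
Definition hat (x : R) := smooth_step (x + 1) - smooth_step x.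

Lemma smooth_hat : smooth hat.
Proof.
have s1 : smooth (fun x : R => smooth_step (1 * x + 1)).
  exact: smooth_comp_affine (smooth_smooth_step).
have := smooth_add _ _ s1 (smooth_scale (-1) _ smooth_smooth_step).
by under eq_fun do rewrite mul1r mulN1r.
Qed.

Lemma hat_nz x : hat x != 0 -> `|x| < 1.
Proof.
rewrite /hat ltr_norml; apply: contraNT; rewrite negb_and -!leNgt => /orP[x1|x1].
  by rewrite !smooth_step_le0 ?subrr//; lra.
by rewrite !smooth_step_ge1 ?subrr//; lra.
Qed.

Lemma sum_hat x n : 0 <= x -> x + 1 <= n%:R -> \sum_(k < n) hat (x - k%:R) = 1.
Proof.
move=> x0 xn.
have H m : \sum_(k < m) hat (x - k%:R) = smooth_step (x + 1) - smooth_step (x + 1 - m%:R).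
  elim: m => [|m IH]; first by rewrite big_ord0 subr0 subrr.
  rewrite big_ord_recr /= IH /hat.
  have -> : x + 1 - m.+1%:R = x - m%:R by rewrite -natr1; ring.
  have -> : x - m%:R + 1 = x + 1 - m%:R by ring.
  by ring.
rewrite H smooth_step_ge1; last lra.
by rewrite smooth_step_le0 ?subr0//; lra.
Qed.

(** A Lebesgue number for the cover by vanishing sets, and a partition of unity
at that scale, reduce the claim to pieces each lying in one vanishing set. *)
Lemma dist_support_locality mu psi : test_linear mu -> test_function psi ->
  fun_support psi `&` dist_support mu = set0 -> mu psi = 0.
Proof.
move=> lmu /[dup] tpsi [spsi cpsi] disj.
pose P (e : R) x := exists2 V, vanishes_on mu V & ball x e `<=` V.
have [eta eta0 Heta] : exists2 e, 0 < e & forall x, fun_support psi x -> P e x.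
  have [|e [He e0]] := @filter_ex _ (0 : R)^'+ _
      (fun e => (forall x, fun_support psi x -> P e x) /\ 0 < e).
    apply: filterI; last exact: nbhs_right_gt.
    apply: (iffLR (compact_near_coveringP _) cpsi R (0 : R)^'+ P) => x Kx.
    have [|V [oV vV Vx]] := @dist_supportPn mu x.
      by move=> sx; have : set0 x by rewrite -disj.
    have /nbhs_ballP[r /= r0 rV] : nbhs x V by exact: open_nbhs_nbhs.
    have r20 : 0 < r / 2 by rewrite divr_gt0.
    exists (ball x (r / 2), [set e | e < r / 2]).
      split => /=; first exact: nbhsx_ballx.
      exact: nbhs_right_lt.
    move=> [x' e] /= [xx' er]; exists V => // z x'z; apply: rV.
    move: xx' x'z; rewrite -!ball_normE /= => xx' x'z.
    rewrite (_ : x - z = (x - x') + (x' - z)); last by ring.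
    by apply: le_lt_trans (ler_normD _ _) _; lra.
  by exists e.
have [M [M0 HM]] := test_function_segment _ tpsi.
(* each bump has support of width 2 dl, well within the Lebesgue number *)
pose dl := eta / 4; have dl0 : 0 < dl by rewrite divr_gt0.
pose u x := dl^-1 * x + M / dl.
pose F k x := psi x * hat (1 * u x + (- k%:R)).
have su : smooth u by exact: smooth_affine.
have tF k : test_function (F k).
  apply: (test_function_mull (fun x => hat (1 * u x + (- k%:R))) _ _ tpsi).
  apply: (smooth_comp (fun z => hat (1 * z + (- k%:R))) _ _ su).
  exact: (smooth_comp_affine _ _ _ smooth_hat).
have F0 k : mu (F k) = 0.
  have [[x0 Fx0]|nex] := pselect (exists x, F k x != 0); last first.
    rewrite (_ : F k = fun=> 0) ?test_linear0//; apply/funext => x.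
    by apply/eqP; apply: contrapT => /negP H; apply: nex; exists x.
  have /Heta[V vV HV] : fun_support psi x0.
    by apply: fun_support_nz; move: Fx0; rewrite mulf_eq0 negb_or => /andP[].
  apply: vV => //.
  apply: (@subset_trans _ `[x0 - 2 * dl, x0 + 2 * dl]); last first.
    move=> z; rewrite /= in_itv /= => /andP[z1 z2]; apply: HV.
    rewrite -ball_normE /=; apply: (@le_lt_trans _ _ (2 * dl)).
      by rewrite ler_norml; apply/andP; split; lra.
    by rewrite /dl; lra.
  apply: fun_support_sub; first exact: closed_segment.
  move=> z; move: Fx0; rewrite !mulf_eq0 !negb_or => /andP[_ /hat_nz h1] /andP[_ /hat_nz h2].
  have H : `|dl^-1 * (z - x0)| <= 2.
    rewrite (_ : _ * _ = (1 * u z + (- k%:R)) - (1 * u x0 + (- k%:R))); last by rewrite /u; ring.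
    by apply: le_trans (ler_normB _ _) _; lra.
  move: H; rewrite normrM (gtr0_norm (_ : 0 < dl^-1)) ?invr_gt0//.
  rewrite ler_pdivrMl// ler_norml /= in_itv /= => /andP[? ?].
  by apply/andP; split; lra.
have [n Hn] : exists n : nat, 2 * M / dl + 1 <= n%:R.
  by exists (Num.bound (2 * M / dl + 1)); rewrite ltW// archi_boundP// addr_ge0// divr_ge0// ?mulr_ge0// ltW.
have -> : psi = (fun x => \sum_(k < n) F k x).
  apply/funext => x; rewrite /F -mulr_sumr.
  have [->|px] := eqVneq (psi x) 0; first by rewrite mul0r.
  have := HM x (fun_support_nz _ _ px); rewrite /= in_itv /= => /andP[x1 x2].
  under eq_bigr do rewrite mul1r.
  rewrite sum_hat ?mulr1//.
    by rewrite /u mulrC -mulrDl; apply: divr_ge0; [lra|exact: ltW].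
  apply: le_trans Hn; rewrite lerD2r /u [_^-1 * _]mulrC -mulrDl ler_pM2r ?invr_gt0//; lra.
rewrite test_linear_sum// big1// => k _; exact: F0.
Qed.

Lemma test_linear_local mu f g : test_linear mu -> test_function f -> test_function g ->
  (forall x, dist_support mu x -> \forall y \near x, f y = g y) -> mu f = mu g.
Proof.
move=> lmu tf tg H.
have := lmu (-1) g f tg tf; set psi := (fun x => _).
suff -> : mu psi = 0 by move/eqP; rewrite mulN1r addrC eq_sym subr_eq0 => /eqP.
apply: dist_support_locality => //; first exact: test_function_lin.
rewrite -subset0 => x [Kx /H] Hx.
have [z [/= pz fgz]] := Kx _ Hx.
by move: pz; rewrite /psi fgz mulN1r addNr eqxx.
Qed.

Lemma plateau_cutoff mu c d e : 0 < e -> dist_support mu `<=` `[c, d] ->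
  cutoff mu (plateau c d e).
Proof.
move=> e0 H; split.
  apply: (test_functionI _ (c - e) (d + e)); first exact: smooth_plateau.
  move=> x; apply: contraNT; rewrite negb_and -!ltNge => H'.
  by apply/eqP; apply: plateau_eq0 => //; case/orP: H' => /ltW ->; rewrite ?orbT.
move=> v /H; rewrite /= in_itv /= => /andP[cv vd].
have e2 : 0 < e / 2 by rewrite divr_gt0.
apply/nbhs_ballP; exists (e / 2) => //= w; rewrite -ball_normE /= ltr_norml => /andP[w1 w2].
by apply: plateau_eq1 => //; apply/andP; split; lra.
Qed.

Lemma cutoff_exists mu : compact (dist_support mu) -> exists chi, cutoff mu chi.
Proof.
move=> /compact_segment[M [_ HM]]; exists (plateau (- M) M 1).
exact: plateau_cutoff.
Qed.

Definition std_cutoff mu : R -> R := xget (cst 0) (cutoff mu : set (R -> R)).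

Lemma std_cutoffP mu : compact (dist_support mu) -> cutoff mu (std_cutoff mu).
Proof. by move=> /cutoff_exists; exact: xgetPex. Qed.

(** Two cutoffs agree near the support, so by locality they give the same
value. *)
Lemma pairing_cutoff mu chi phi : test_linear mu -> compact (dist_support mu) ->
  cutoff mu chi -> smooth phi -> pairing mu phi = mu (fun v => chi v * phi v).
Proof.
move=> lmu cmu [tchi chi1] sphi.
have [tstd std1] := std_cutoffP mu cmu.
rewrite /pairing -/(std_cutoff mu); apply: test_linear_local lmu _ _ _.
- exact: test_function_mull.
- exact: test_function_mull.
move=> x Sx; near=> y.
have -> : chi y = 1 by near: y; exact: chi1.
by have -> : std_cutoff mu y = 1 by near: y; exact: std1.
Unshelve. all: by end_near.
Qed.

Lemma pairing_lin mu a f g : test_linear mu -> compact (dist_support mu) ->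
  smooth f -> smooth g ->
  pairing mu (fun x => a * f x + g x) = a * pairing mu f + pairing mu g.
Proof.
move=> lmu cmu sf sg; have [tc _] := std_cutoffP mu cmu.
have tcf := test_function_mull _ _ sf tc; have tcg := test_function_mull _ _ sg tc.
rewrite /pairing -/(std_cutoff mu) -(lmu a _ _ tcf tcg).
by congr mu; apply/funext => x; ring.
Qed.

Lemma pairing_scale mu a f : test_linear mu -> compact (dist_support mu) ->
  smooth f -> pairing mu (fun x => a * f x) = a * pairing mu f.
Proof.
move=> lmu cmu sf; have := pairing_lin mu a f (fun=> 0) lmu cmu sf (smooth_cst 0).
have -> : pairing mu (fun=> 0) = 0.
  rewrite /pairing (_ : (fun v => _) = (fun=> 0)) ?test_linear0//.
  by apply/funext => x; rewrite mulr0.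
by rewrite addr0 => <-; congr (pairing mu _); apply/funext => x; rewrite addr0.
Qed.

Lemma pairing_sum mu n (F : nat -> R -> R) : test_linear mu ->
  compact (dist_support mu) -> (forall k, smooth (F k)) ->
  pairing mu (fun x => \sum_(k < n) F k x) = \sum_(k < n) pairing mu (F k).
Proof.
move=> lmu cmu sF; have [tc _] := std_cutoffP mu cmu.
rewrite /pairing -/(std_cutoff mu).
rewrite -(test_linear_sum mu n (fun k x => std_cutoff mu x * F k x) lmu).
  by congr mu; apply/funext => x; rewrite mulr_sumr.
by move=> k; exact: test_function_mull.
Qed.

End linear_functionals.

(** * Continuity of the pairing and derivatives of distributions *)

Section schwartz.
Context {R : realType}.
Implicit Types (f g phi psi chi : R -> R) (x y c d e : R) (mu : @functional R).

(** The seminorm bound of the distribution, applied to a plateau times the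
function: outside the margin e of the segment the product vanishes, and inside it
the Leibniz rule leaves only the derivatives of the function. *)
Lemma pairing_bound mu c d e : schwartz_distribution mu ->
  compact (dist_support mu) -> dist_support mu `<=` `[c, d] -> 0 < e ->
  exists k, exists2 C, 0 <= C & forall phi M, smooth phi -> 0 <= M ->
    (forall v, c - e <= v <= d + e -> jet_bound k v M phi) ->
    `|pairing mu phi| <= C * M.
Proof.
move=> [lmu bmu] cmu smu e0.
have /= [k [C HC]] := bmu _ (@segment_compact R (c - e) (d + e)).
have [A A0 HA] := jet_bound_segment (plateau c d e) k (c - e) (d + e) (smooth_plateau c d e).
exists k; exists (`|C| * (\sum_(j < k.+1) (2 ^+ k * A))).
  by rewrite mulr_ge0// sumr_ge0// => j _; rewrite mulr_ge0// exprn_ge0.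
move=> phi M sphi M0 HM.
have cut := plateau_cutoff mu c d e e0 smu.
rewrite (pairing_cutoff mu _ _ lmu cmu cut sphi).
have tp : test_function (fun v => plateau c d e v * phi v).
  by apply: (test_function_mull _ _ sphi); case: cut.
have sup_sub : fun_support (fun v => plateau c d e v * phi v) `<=` `[c - e, d + e].
  apply: fun_support_sub; first exact: closed_segment.
  move=> x; rewrite mulf_eq0 negb_or => /andP[H _]; rewrite /= in_itv /=.
  apply: contraNT H; rewrite negb_and -!ltNge => H'.
  by apply/eqP; apply: plateau_eq0 => //; case/orP: H' => /ltW ->; rewrite ?orbT.
pose h := fun v => plateau c d e v * phi v.
have hM j x : (j <= k)%N -> `|derive1n j h x| <= 2 ^+ k * A * M.
  move=> jk; have [xin|xout] := boolP (c - e <= x <= d + e).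
    rewrite -mulrA; apply: (jet_bound_mul k _ _ _ _ _ (smooth_plateau c d e) sphi) => //.
      exact: HA.
    exact: HM.
  rewrite (zero_open_derive1n _ (~` `[c - e, d + e])) ?normr0 ?mulr_ge0 ?exprn_ge0//.
  - by apply: closed_openC; exact: closed_segment.
  - move=> z; rewrite /= in_itv /= => /negP; rewrite negb_and -!ltNge => H.
    rewrite /h plateau_eq0 ?mul0r//.
    by case/orP: H => /ltW ->; rewrite ?orbT.
  - by rewrite /= in_itv /=; exact/negP.
apply: le_trans (HC _ tp sup_sub) _.
have sup_bnd (j : 'I_k.+1) : 0 <= sup (range (fun x => `|derive1n j h x|)) <= 2 ^+ k * A * M.
  have jk : (j <= k)%N by rewrite -ltnS.
  have ub : ubound (range (fun x => `|derive1n j h x|)) (2 ^+ k * A * M).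
    by move=> _ [x _ <-]; exact: hM.
  apply/andP; split; last by apply: ge_sup => //; exists `|derive1n j h 0|, 0.
  apply: (@le_trans _ _ `|derive1n j h 0|) => //.
  by apply: ub_le_sup; [exists (2 ^+ k * A * M)|exists 0].
apply: (@le_trans _ _ (`|C| * \sum_(j < k.+1) sup (range (fun x => `|derive1n j h x|)))).
  apply: ler_wpM2r; last exact: ler_norm.
  by apply: sumr_ge0 => j _; have /andP[] := sup_bnd j.
rewrite -mulrA ler_wpM2l// mulr_suml; apply: ler_sum => j _.
by have /andP[] := sup_bnd j.
Qed.

Lemma test_linear_dist_deriv mu : test_linear mu -> test_linear (dist_deriv mu).
Proof.
move=> lmu a f g tf tg; rewrite /dist_deriv.
have [sf _] := tf; have [sg _] := tg.
have -> : derive1 (fun x => a * f x + g x) = (fun x => a * derive1 f x + derive1 g x).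
  apply: derive1_ext => x; apply: is_derive_add; last exact: smooth_is_derive1.
  by apply: is_derive_scale; exact: smooth_is_derive1.
by rewrite lmu; [ring|exact: test_function_derive1|exact: test_function_derive1].
Qed.

Lemma test_linear_dist_sub mu nu : test_linear mu -> test_linear nu ->
  test_linear (dist_sub mu nu).
Proof. by move=> lmu lnu a f g tf tg; rewrite /dist_sub lmu// lnu//; ring. Qed.

Lemma dist_support_dist_deriv mu : dist_support (dist_deriv mu) `<=` dist_support mu.
Proof.
move=> x Sx; apply: contrapT => /dist_supportPn[V [oV vV Vx]]; apply: Sx.
exists V => //; split => // f tf fV; rewrite /dist_deriv vV ?oppr0//.
  exact: test_function_derive1.
exact: subset_trans (fun_support_derive1 f) fV.
Qed.

Lemma dist_support_dist_sub mu nu :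
  dist_support (dist_sub mu nu) `<=` dist_support mu `|` dist_support nu.
Proof.
move=> x Sx; apply: contrapT => /not_orP[]
  /dist_supportPn[V [oV vV Vx]] /dist_supportPn[V' [oV' vV' V'x]].
apply: Sx; exists (V `&` V') => //; split; first exact: openI.
move=> f tf fV; rewrite /dist_sub vV ?vV' ?subrr// => z /fV[] //.
Qed.

(** The product rule leaves a term with the derivative of the plateau. It is
zero near the support of the distribution, hence invisible by locality. *)
Lemma dist_deriv_cutoff mu c d phi : test_linear mu -> compact (dist_support mu) ->
  dist_support mu `<=` `[c, d] -> smooth phi ->
  dist_deriv mu (fun v => plateau c d 1 v * phi v) = - pairing mu (derive1 phi).
Proof.
move=> lmu cmu smu sphi; rewrite /dist_deriv; congr (- _).
have cut := plateau_cutoff mu c d 1 ltr01 smu.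
rewrite (pairing_cutoff mu _ _ lmu cmu cut (smooth_derive1 _ sphi)).
have [tp p1] := cut.
apply: (test_linear_local _ _ _ lmu).
- by apply: test_function_derive1; exact: (test_function_mull _ _ sphi tp).
- exact: (test_function_mull _ _ (smooth_derive1 _ sphi) tp).
move=> x /p1 /nbhs_interior Hx.
near=> y.
have Hy : \forall z \near y, plateau c d 1 z = 1 by near: y; exact: Hx.
have dp : is_derive y (1 : R) (plateau c d 1) 0.
  apply: (@near_eq_is_derive R R R (cst 1) _ y 1 0).
  by near=> z; apply/esym; near: z.
have := is_derive_mul _ _ _ _ _ dp (smooth_is_derive1 _ y sphi).
rewrite mul0r add0r => /is_derive_derive1 ->.
by [].
Unshelve. all: by end_near.
Qed.

(** A single plateau serves as cutoff for both distributions and for the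
difference of their derivatives, whose support may be smaller. *)
Lemma pairing_dist_sub_deriv mu nu phi :
  schwartz_distribution mu -> schwartz_distribution nu ->
  compact (dist_support mu) -> compact (dist_support nu) -> smooth phi ->
  pairing (dist_sub (dist_deriv mu) (dist_deriv nu)) phi =
  - pairing mu (derive1 phi) + pairing nu (derive1 phi).
Proof.
move=> [lmu _] [lnu _] cmu cnu sphi.
have [M [M0 HM]] := compact_segment _ cmu.
have [M' [M'0 HM']] := compact_segment _ cnu.
set eta := dist_sub _ _.
have leta : test_linear eta.
  by apply: test_linear_dist_sub; exact: test_linear_dist_deriv.
pose c := - (M + M'); pose d := M + M'.
have smu : dist_support mu `<=` `[c, d].
  by move=> x /HM; rewrite /= !in_itv /= => /andP[? ?]; apply/andP; rewrite /c /d; split; lra.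
have snu : dist_support nu `<=` `[c, d].
  by move=> x /HM'; rewrite /= !in_itv /= => /andP[? ?]; apply/andP; rewrite /c /d; split; lra.
have seta : dist_support eta `<=` `[c, d].
  move=> x /dist_support_dist_sub[/dist_support_dist_deriv|/dist_support_dist_deriv].
    exact: smu.
  exact: snu.
have ceta : compact (dist_support eta).
  by apply: (subclosed_compact (closed_dist_support _) (@segment_compact R c d) seta).
have cut := plateau_cutoff eta c d 1 ltr01 seta.
rewrite (pairing_cutoff eta _ _ leta ceta cut sphi) /eta /dist_sub.
by rewrite !dist_deriv_cutoff// opprK.
Qed.

End schwartz.

(** * The normal distribution function and its derivatives *)

Section normal_cdf_facts.
Context {R : realType}.
Implicit Types (x y z a c : R).
Notation leb := (@lebesgue_measure R).
Notation ncdf := (@normal_cdf R).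

Lemma normal_pdf1E z : normal_pdf 0 1 z =
  (Num.sqrt (2 * pi))^-1 * expR (- (z ^+ 2) / 2) :> R.
Proof.
rewrite normal_pdfE ?oner_neq0// /normal_peak /normal_fun subr0 expr1n mul1r.
by rewrite -[pi *+ 2]mulr_natl.
Qed.

Lemma normal_pdfE1 s z : 0 < s -> normal_pdf 0 s z = s^-1 * normal_pdf 0 1 (s^-1 * z) :> R.
Proof.
move=> s0; rewrite normal_pdf1E normal_pdfE ?gt_eqF// /normal_peak /normal_fun subr0.
rewrite -mulrnAr -[pi *+ 2]mulr_natl sqrtrM ?sqr_ge0// sqrtr_sqr gtr0_norm// invfM -mulrA.
congr (_ * (_ * expR _)).
by rewrite -[_ *+ 2]mulr_natl; field; rewrite gt_eqF.
Qed.

Lemma integrable_normal_pdfS (A : set (measurableTypeR R)) (s : R) : measurable A ->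
  leb.-integrable A (EFin \o normal_pdf 0 s).
Proof.
move=> mA; apply: (@integrableS _ _ _ leb setT A) => //.
exact: integrable_normal_pdf.
Qed.

Lemma normal_cdfE x : (ncdf x)%:E = normal_prob 0 1 `]-oo, x].
Proof.
have f1 : normal_prob (0 : R) 1 `]-oo, x] \is a fin_num by exact: fin_num_measure.
rewrite -(fineK f1) /normal_prob /normal_cdf; congr (_%:E).
rewrite -RintegralZl//=.
  by rewrite /Rintegral; congr fine; apply: eq_integral => y _; rewrite normal_pdf1E.
have I := integrable_normal_pdfS `]-oo, x] 1 (measurable_itv _).
have mI : measurable (`]-oo, x] : set (measurableTypeR R)) by exact: measurable_itv.
have := integrableZl mI (Num.sqrt (2 * pi)) I.
apply: eq_integrable => // y _ /=; rewrite normal_pdf1E -EFinM mulrA divff ?mul1r//.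
by rewrite gt_eqF// sqrtr_gt0 mulr_gt0// pi_gt0.
Qed.

Lemma normal_cdf_ge0 x : 0 <= ncdf x.
Proof. by rewrite -lee_fin normal_cdfE. Qed.

Lemma normal_cdf_le1 x : ncdf x <= 1.
Proof. by rewrite -lee_fin normal_cdfE probability_le1. Qed.

Let idTR : measurableTypeR R -> R := idfun.

#[local] HB.instance Definition _ :=
  @isMeasurableFun.Build _ _ _ _ idTR (@measurable_id _ _ setT).

Lemma normal_cdf_cvgNy (e : R) : 0 < e -> exists A, forall x, x <= A -> ncdf x <= e.
Proof.
move=> e0.
have := cvg_cdfNy0 (idTR : {RV (normal_prob (0 : R) 1) >-> R}).
move=> /fine_cvgP[_ /cvgrPdist_le /(_ e e0)] [A [_ HA]].
exists (A - 1) => x xA; have := HA x; rewrite sub0r normrN => H.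
have -> : ncdf x = fine (cdf (idTR : {RV (normal_prob (0 : R) 1) >-> R}) x).
  by rewrite /cdf /distribution /pushforward /= preimage_id -normal_cdfE.
apply: le_trans (ler_norm _) (H _); lra.
Qed.

Lemma normal_cdf_cvgy (e : R) : 0 < e -> exists A, forall x, A <= x -> 1 - e <= ncdf x.
Proof.
move=> e0.
have := cvg_cdfy1 (idTR : {RV (normal_prob (0 : R) 1) >-> R}).
move=> /fine_cvgP[_ /cvgrPdist_le /(_ e e0)] [A [_ HA]].
exists (A + 1) => x xA; have := HA x => H.
have -> : ncdf x = fine (cdf (idTR : {RV (normal_prob (0 : R) 1) >-> R}) x).
  by rewrite /cdf /distribution /pushforward /= preimage_id -normal_cdfE.
rewrite lerBlDr -lerBlDl; apply: le_trans (ler_norm _) (H _); lra.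
Qed.

Lemma is_derive_normal_cdf x : is_derive x (1 : R) ncdf (normal_pdf 0 1 x).
Proof.
have x1 : x < x + 1 by rewrite ltrDl.
have I := integrable_normal_pdfS `]-oo, x + 1] 1 (measurable_itv _).
have := @continuous_FTC1 R (normal_pdf 0 1) -oo%O x (x + 1) x1 I (ltNyr _).
have -> : (fun y => \int[leb]_(t in `]-oo, y]) normal_pdf 0 1 t) = ncdf.
  by apply/funext => y; rewrite /Rintegral -/(normal_prob 0 1 _) -normal_cdfE.
have cn : {for x, continuous (@normal_pdf R 0 1)} by apply: continuous_normal_pdf; rewrite oner_neq0.
by move=> /(_ cn)[d1 d2]; have := derivable_is_derive1 d1; rewrite d2.
Qed.

Lemma is_derive_normal_pdf1 x :
  is_derive x (1 : R) (normal_pdf 0 1) (- (x * normal_pdf 0 1 x)).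
Proof.
have -> : @normal_pdf R 0 1 = fun z => (Num.sqrt (2 * pi))^-1 * expR (- (2^-1) * (z * z)).
  apply/funext => z; rewrite normal_pdf1E; congr (_ * expR _); rewrite expr2; ring.
have Hsq : is_derive x (1 : R) (fun z => - (2^-1) * (z * z)) (- x).
  have := is_derive_scale (- 2^-1) _ _ _ (is_derive_mul id id x 1 1 (is_derive_id _ _) (is_derive_id _ _)).
  by rewrite /= mulr1 mul1r (_ : - 2^-1 * (x + x) = - x)//; lra.
have := is_derive_scale ((Num.sqrt (2 * pi))^-1) _ _ _
  (is_derive_comp expR _ _ _ _ (is_derive_expR _) Hsq).
by congr (is_derive _ _ _ _); ring.
Qed.

Lemma smooth_normal_pdf1 : smooth (@normal_pdf R 0 1).
Proof.
apply/smooth_n_derivable; elim=> [m x //|n IH].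
apply/n_derivableS; exists (fun x => (-1 * x + 0) * normal_pdf 0 1 x).
  by move=> x; rewrite addr0 mulN1r mulNr; exact: is_derive_normal_pdf1.
apply: n_derivable_mul; last exact: IH.
exact: (iffLR (smooth_n_derivable _) (smooth_affine _ _)).
Qed.

Lemma smooth_normal_cdf : smooth ncdf.
Proof. exact: smoothI is_derive_normal_cdf smooth_normal_pdf1. Qed.

Notation dN j := (derive1n j ncdf).

Lemma dN1 : dN 1 = @normal_pdf R 0 1.
Proof. exact: derive1_ext is_derive_normal_cdf. Qed.

Lemma derive1_normal_cdf x : derive1 ncdf x = normal_pdf 0 1 x.
Proof. exact: (congr1 (fun f : R -> R => f x) dN1). Qed.

(** Hermite recurrence, by differentiating N'' (z) = - z N' (z) repeatedly. *)
Lemma dN_rec j z : dN j.+2 z = - (j%:R * dN j z) - z * dN j.+1 z.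
Proof.
elim: j z => [|j IH] z.
  rewrite mul0r oppr0 sub0r derive1nS dN1.
  exact: is_derive_derive1 (is_derive_normal_pdf1 z).
rewrite derive1nS; apply: is_derive_derive1.
have -> : dN j.+2 = fun z => (- j%:R) * dN j z + (-1) * (z * dN j.+1 z).
  by apply/funext => y; rewrite IH; ring.
have D k := smooth_is_derive ncdf k z smooth_normal_cdf.
have := is_derive_add _ _ _ _ _ (is_derive_scale (- j%:R) _ _ _ (D j))
  (is_derive_scale (-1) _ _ _ (is_derive_mul id _ z _ _ (is_derive_id _ _) (D j.+1))).
by congr (is_derive _ _ _ _); rewrite -natr1 IH; ring.
Qed.

(** The Gaussian factor beats polynomials at order one; the recurrence couples
consecutive orders, so the induction carries two of them. *)
Lemma dN_decay j m : exists2 C, 0 <= C & forall z, `|z| ^+ m * `|dN j.+1 z| <= C.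
Proof.
suff: forall j, (forall m, exists2 C, 0 <= C & forall z, `|z| ^+ m * `|dN j.+1 z| <= C) /\
  (forall m, exists2 C, 0 <= C & forall z, `|z| ^+ m * `|dN j.+2 z| <= C).
  by move=> /(_ j)[].
have base k : exists2 C, 0 <= C & forall z, `|z| ^+ k * `|dN 1 z| <= C.
  have [C C0 HC] := @pow_expRN_bounded R k.
  have c0 : 0 <= (Num.sqrt (2 * pi) : R)^-1 by rewrite invr_ge0.
  exists ((1 + 2 ^+ k * C) * (Num.sqrt (2 * pi))^-1).
    by rewrite mulr_ge0// addr_ge0// mulr_ge0// ?exprn_ge0// ltW.
  move=> z; rewrite dN1 (ger0_norm (normal_pdf_ge0 _ _ _)) normal_pdf1E mulrCA.
  rewrite [X in _ <= X]mulrC ler_wpM2l//.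
  have w0 : 0 <= z ^+ 2 / 2 by rewrite divr_ge0// sqr_ge0.
  have := HC _ w0; rewrite mulNr => Hw.
  have e1 : expR (- (z ^+ 2 / 2)) <= 1 by rewrite -[X in _ <= X]expR0 ler_expR oppr_le0.
  have [z1|z1] := leP `|z| 1.
    have le1 : `|z| ^+ k <= 1 by rewrite exprn_ile1.
    apply: (@le_trans _ _ 1).
      by rewrite -[X in _ <= X]mulr1; apply: ler_pM; rewrite ?exprn_ge0 ?expR_ge0.
    by rewrite lerDl mulr_ge0 ?exprn_ge0// ltW.
  apply: (@le_trans _ _ (2 ^+ k * C)); last by rewrite lerDr.
  apply: le_trans (_ : 2 ^+ k * ((z ^+ 2 / 2) ^+ k * expR (- (z ^+ 2 / 2))) <= _); last first.
    by rewrite ler_wpM2l// exprn_ge0.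
  rewrite mulrA -exprMn ler_wpM2r ?expR_ge0//.
  rewrite (_ : 2 * (z ^+ 2 / 2) = z ^+ 2); last by field.
  have -> : z ^+ 2 = `|z| ^+ 2 by rewrite -normrX ger0_norm// sqr_ge0.
  rewrite -exprM; apply: ler_weXn2l; first exact: ltW.
  by rewrite mul2n -addnn leq_addl.
elim=> [|i [IH0 IH1]].
- split; first exact: base.
  move=> k; have [C C0 HC] := base k.+1; exists C => // z.
  by rewrite dN_rec mul0r oppr0 sub0r normrN normrM mulrA -exprSr.
- split; first exact: IH1.
  move=> k; have [C C0 HC] := IH0 k; have [C' C'0 HC'] := IH1 k.+1.
  exists (i.+1%:R * C + C'); first by rewrite addr_ge0// mulr_ge0.
  move=> z; rewrite dN_rec; apply: (@le_trans _ _
    (`|z| ^+ k * (i.+1%:R * `|dN i.+1 z| + `|z| * `|dN i.+2 z|))).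
    rewrite ler_wpM2l ?exprn_ge0//; apply: le_trans (ler_normB _ _) _.
    by rewrite normrN !normrM normr_nat.
  rewrite mulrDr mulrCA [`|z| ^+ k * (`|z| * _)]mulrA -exprSr; apply: lerD; last exact: HC'.
  by rewrite ler_wpM2l.
Qed.

Lemma dN_bounded j : exists2 C, 0 <= C & forall z, `|dN j z| <= C.
Proof.
case: j => [|j].
  by exists 1 => // z; rewrite ger0_norm ?normal_cdf_ge0// normal_cdf_le1.
have [C C0 HC] := dN_decay j 0; exists C => // z.
by have := HC z; rewrite expr0 mul1r.
Qed.

(** * The heat kernels *)

(** The j-th derivative of y |-> N (sg y / sqrt s), written in closed form. With
sg = -1 or 1 these are the functions that define the two potentials, and one
family with index j contains all their space and time derivatives. *)
Definition kern (j : nat) (sg s y : R) : R :=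
  (sg / Num.sqrt s) ^+ j * dN j (sg / Num.sqrt s * y).

Lemma kernE j sg s y : kern j sg s y = derive1n j (kern 0 sg s) y.
Proof.
have -> : kern 0 sg s = fun y => ncdf (sg / Num.sqrt s * y + 0).
  by apply/funext => z; rewrite /kern expr0 mul1r addr0.
by rewrite (derive1n_comp_affine j _ _ _ smooth_normal_cdf) addr0.
Qed.

Lemma smooth_kern j sg s : smooth (kern j sg s).
Proof.
have -> : kern j sg s = derive1n j (kern 0 sg s) by apply/funext => y; exact: kernE.
apply: smooth_derive1n.
have -> : kern 0 sg s = fun y => ncdf (sg / Num.sqrt s * y + 0).
  by apply/funext => z; rewrite /kern expr0 mul1r addr0.
exact: (smooth_comp_affine _ _ _ smooth_normal_cdf).
Qed.

Lemma derive1n_kern i j sg s : derive1n i (kern j sg s) = kern (i + j) sg s.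
Proof.
have H k : kern k sg s = derive1n k (kern 0 sg s) by apply/funext => y; exact: kernE.
by rewrite (H j) (H (i + j)%N) /derive1n iterD.
Qed.

Lemma is_derive_kern j sg s y : is_derive y (1 : R) (kern j sg s) (kern j.+1 sg s y).
Proof.
have := smooth_is_derive1 _ y (smooth_kern j sg s).
by rewrite -[derive1 _]/(derive1n 1 _) derive1n_kern.
Qed.

Lemma kern_bounded j sg (e : R) : `|sg| = 1 -> 0 < e ->
  exists2 C, 0 <= C & forall s y, e <= s -> `|kern j sg s y| <= C.
Proof.
move=> sg1 e0; have [C C0 HC] := dN_bounded j.
exists ((Num.sqrt e)^-1 ^+ j * C).
  by rewrite mulr_ge0// exprn_ge0// invr_ge0 sqrtr_ge0.
move=> s y es; rewrite /kern normrM normrX normrM sg1 mul1r normfV.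
rewrite (ger0_norm (sqrtr_ge0 _)).
have s0 : 0 < s by exact: lt_le_trans es.
apply: ler_pM => //.
apply: lerXn2r; rewrite ?nnegrE ?invr_ge0 ?sqrtr_ge0//.
by rewrite lef_pV2 ?posrE ?sqrtr_gt0// ler_wsqrtr.
Qed.

(** Heat equation; the powers of 1 / sqrt s and the argument both vary with s,
and the Hermite recurrence combines the two contributions. *)
Lemma is_derive_kern_time j (sg s y : R) : sg ^+ 2 = 1 -> 0 < s ->
  is_derive s (1 : R) (fun r => kern j sg r y) (2^-1 * kern j.+2 sg s y).
Proof.
move=> sg1 s0; pose r := sg / Num.sqrt s.
have q0 : Num.sqrt s != 0 by rewrite gt_eqF// sqrtr_gt0.
have sq : Num.sqrt s ^+ 2 = s by rewrite sqr_sqrtr// ltW.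
have Hr : is_derive s (1 : R) (fun t => sg / Num.sqrt t) (- (2^-1 * r ^+ 3)).
  have H1 := @is_derive1_sqrt R s s0.
  have H2 := @is_deriveV R Num.sqrt s _ 1 q0 H1.
  apply: (is_derive_eq (is_derive_scale sg _ _ _ H2)); rewrite /GRing.scale /= /r -exprVn.
  set q := Num.sqrt s in q0 *.
  have -> : (sg / q) ^+ 3 = sg ^+ 2 * sg * q^-1 ^+ 3 by ring.
  by rewrite sg1; field.
have Hp : is_derive s (1 : R) (fun t => (sg / Num.sqrt t) ^+ j)
    (j%:R * r ^+ j.-1 * (- (2^-1 * r ^+ 3))).
  apply: (is_derive_comp (fun z => z ^+ j) (fun t => sg / Num.sqrt t)) => //.
  have H := @is_deriveX R R id j r 1 1 (is_derive_id _ _).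
  rewrite exprfctE in H; apply: (is_derive_eq H); by rewrite /GRing.scale /= mulr1.
have Hd : is_derive s (1 : R) (fun t => dN j (sg / Num.sqrt t * y))
    (dN j.+1 (r * y) * (- (2^-1 * r ^+ 3) * y)).
  apply: (is_derive_comp (dN j) (fun t => sg / Num.sqrt t * y)).
    exact: smooth_is_derive smooth_normal_cdf.
  have := is_derive_mul _ _ _ _ _ Hr (is_derive_cst y s 1).
  by rewrite mulr0 addr0.
apply: (is_derive_eq (is_derive_mul _ _ _ _ _ Hp Hd)); rewrite /kern -/r dN_rec.
by case: (j) => [|k] /=; rewrite ?expr0 !exprS; ring.
Qed.

Lemma sqrtr_le_of_lt_sqr (s D : R) : 0 <= D -> s < D ^+ 2 -> Num.sqrt s <= D.
Proof.
move=> D0 sD; rewrite -[D]ger0_norm// -sqrtr_sqr.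
by apply: ler_wsqrtr; exact: ltW.
Qed.

(** On the side where sg y is negative, the distribution function and its
derivatives vanish rapidly as the variance shrinks. *)
Lemma kern_decay j sg (dl e : R) : `|sg| = 1 -> 0 < dl -> 0 < e ->
  exists2 eta, 0 < eta & forall s y, 0 < s < eta -> sg * y <= - dl ->
    `|kern j sg s y| <= e.
Proof.
move=> sg1 dl0 e0.
have zE s y : sg / Num.sqrt s * y = sg * y / Num.sqrt s by ring.
case: j => [|j].
  have [A HA] := normal_cdf_cvgNy e e0.
  have A10 : 0 < `|A| + 1 by rewrite ltr_wpDl.
  (* below this variance dl / sqrt s exceeds |A| *)
  exists ((dl / (`|A| + 1)) ^+ 2); first by rewrite exprn_gt0// divr_gt0.
  move=> s y /andP[s0 se] sy; rewrite /kern expr0 mul1r ger0_norm ?normal_cdf_ge0//.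
  apply: HA; rewrite zE.
  have qs : 0 < Num.sqrt s by rewrite sqrtr_gt0.
  have ql : Num.sqrt s <= dl / (`|A| + 1).
    by apply: sqrtr_le_of_lt_sqr => //; rewrite divr_ge0// ltW.
  rewrite ler_pdivrMr//; apply: (le_trans sy); rewrite lerNl -mulNr.
  apply: (@le_trans _ _ ((`|A| + 1) * Num.sqrt s)).
    apply: ler_wpM2r; first exact: ltW.
    apply: (@le_trans _ _ `|A|); last lra.
    by rewrite -normrN ler_norm.
  by rewrite mulrC -ler_pdivlMr.
(* one power more than the factor sqrt s ^- j.+1, so that sqrt s remains *)
have [C C0 HC] := dN_decay j j.+2.
have D0 : 0 < dl ^+ j.+2 * e / (C + 1).
  by apply: divr_gt0; [rewrite mulr_gt0 ?exprn_gt0|rewrite ltr_wpDl].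
exists ((dl ^+ j.+2 * e / (C + 1)) ^+ 2); first by rewrite exprn_gt0.
move=> s y /andP[s0 se] sy; rewrite /kern.
have qs : 0 < Num.sqrt s by rewrite sqrtr_gt0.
have ql : Num.sqrt s <= dl ^+ j.+2 * e / (C + 1).
  by apply: sqrtr_le_of_lt_sqr => //; exact: ltW.
set z := sg / Num.sqrt s * y.
have y_dl : dl <= `|y|.
  have : dl <= `|sg * y| by rewrite -normrN; apply: le_trans (ler_norm _); lra.
  by rewrite normrM sg1 mul1r.
have y0 : 0 < `|y| by exact: lt_le_trans y_dl.
have zN : `|z| = `|y| / Num.sqrt s.
  by rewrite /z !normrM sg1 mul1r normfV (gtr0_norm qs) mulrC.
rewrite normrM normrX normrM sg1 mul1r normfV (gtr0_norm qs).
have := HC z; rewrite zN exprMn => H.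
have dn0 : 0 <= `|dN j.+1 z| by [].
have k1 : dl ^+ j.+2 * ((Num.sqrt s)^-1 ^+ j.+2 * `|dN j.+1 z|) <= C.
  apply: le_trans H; rewrite mulrA ler_wpM2r// ler_wpM2r ?exprn_ge0 ?invr_ge0 ?(ltW qs)//.
  by apply: lerXn2r; rewrite ?nnegrE// ltW.
have pos : 0 < dl ^+ j.+2 * (Num.sqrt s)^-1 by apply: mulr_gt0; rewrite ?exprn_gt0 ?invr_gt0.
rewrite -(ler_pM2l pos).
rewrite [X in X <= _](_ : _ = dl ^+ j.+2 * ((Num.sqrt s)^-1 ^+ j.+2 * `|dN j.+1 z|)); last first.
  by rewrite [in RHS](exprS (Num.sqrt s)^-1 j.+1); ring.
apply: (le_trans k1); rewrite [X in _ <= X]mulrAC ler_pdivlMr//.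
apply: (@le_trans _ _ ((C + 1) * Num.sqrt s)).
  by apply: ler_wpM2r; [exact: ltW|lra].
by rewrite mulrC -ler_pdivlMr ?ltr_wpDl.
Qed.

End normal_cdf_facts.

(** * Bounded functions under a probability on the line *)

Section bounded_integrals.
Context {R : realType} d (T : measurableType d) (nu : probability T R).
Implicit Types (f g : T -> R) (E : set T).

Lemma bounded_integrable E f M : measurable E -> measurable_fun setT f ->
  (forall x, E x -> `|f x| <= M) -> nu.-integrable E (EFin \o f).
Proof.
move=> mE mf fM; apply: measurable_bounded_integrable => //.
- by apply: le_lt_trans (probability_le1 nu mE) _; rewrite ltry.
- exact: measurable_funS mf.
- exists M; split; first exact: num_real.
  by move=> y My x Ex; apply: le_trans (fM x Ex) (ltW My).
Qed.

Lemma bounded_Rintegral_le E f M : measurable E -> measurable_fun setT f -> 0 <= M ->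
  (forall x, E x -> `|f x| <= M) -> `|\int[nu]_(x in E) f x| <= M.
Proof.
move=> mE mf M0 fM; have If := bounded_integrable E f M mE mf fM.
apply: le_trans (le_normr_Rintegral mE If) _.
apply: (@le_trans _ _ (\int[nu]_(x in E) M)).
  apply: le_Rintegral => //.
  - apply: (bounded_integrable E (fun x => `|f x|) M mE); first exact: measurableT_comp.
    by move=> x Ex; rewrite normr_id; exact: fM.
  - by apply: (bounded_integrable E (fun=> M) `|M|).
rewrite Rintegral_cst// ler_piMr// -lee_fin fineK ?fin_num_measure//.
exact: probability_le1.
Qed.

Lemma Rintegral_sum_bounded E n (F : nat -> T -> R) (M : nat -> R) : measurable E ->
  (forall k, measurable_fun setT (F k)) -> (forall k x, `|F k x| <= M k) ->
  \int[nu]_(x in E) (\sum_(k < n) F k x) = \sum_(k < n) \int[nu]_(x in E) F k x.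
Proof.
move=> mE mF FM; elim: n => [|n IH].
  rewrite big_ord0 (_ : (fun x => _) = cst 0) ?Rintegral_cst ?mul0r//.
  by apply/funext => x; rewrite big_ord0.
rewrite big_ord_recr /= -IH -RintegralD//.
- by congr (Rintegral _ _ _); apply/funext => x; rewrite big_ord_recr.
- apply: (bounded_integrable E _ (\sum_(k < n) M k)) => //.
    exact: measurable_sum.
  by move=> x _; apply: le_trans (ler_norm_sum _ _ _) _; apply: ler_sum => k _.
- by apply: (bounded_integrable E _ (M n)).
Qed.

End bounded_integrals.
Arguments bounded_integrable {R d T}.
Arguments bounded_Rintegral_le {R d T}.
Arguments Rintegral_sum_bounded {R d T}.

Section bounded_smooth.
Context {R : realType}.
Implicit Types (f g kap : R -> R) (M x y z : R).

(** The kernels do not have compact support, but bounded derivatives are enough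
for Taylor remainders that are uniform under translation. *)
Definition bounded_smooth kap : Prop :=
  smooth kap /\ forall j, exists2 M : R, 0 <= M & forall y, `|derive1n j kap y| <= M.

Lemma bounded_smooth_jet kap k : bounded_smooth kap ->
  exists2 M : R, 0 <= M & forall y, jet_bound k y M kap.
Proof.
move=> [sk bk]; elim: k => [|k [M M0 HM]].
  by have [M M0 HM] := bk 0%N; exists M => // y [|//] _; exact: HM.
have [A A0 HA] := bk k.+1; exists (M + A); first by rewrite addr_ge0.
move=> y j; rewrite leq_eqVlt => /orP[/eqP ->|jk].
  by apply: le_trans (HA y) _; rewrite lerDr.
by apply: le_trans (HM y j jk) _; rewrite lerDl.
Qed.

Lemma bounded_smooth_derive1n n kap : bounded_smooth kap -> bounded_smooth (derive1n n kap).
Proof.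
move=> [sk bk]; split; first exact: smooth_derive1n.
by move=> j; have := bk (j + n)%N; rewrite /derive1n iterD.
Qed.

Lemma derive1n_shift j kap x : smooth kap ->
  derive1n j (fun v => kap (v - x)) = (fun v => derive1n j kap (v - x)).
Proof.
move=> sk; have := derive1n_comp_affine j 1 (- x) kap sk.
have -> : (fun v => kap (1 * v + - x)) = (fun v => kap (v - x)).
  by apply/funext => v; rewrite mul1r.
by move=> ->; apply/funext => v; rewrite expr1n !mul1r.
Qed.

Lemma smooth_shift kap x : smooth kap -> smooth (fun v => kap (v - x)).
Proof.
move=> sk; have := smooth_comp_affine 1 (- x) kap sk.
by under eq_fun do rewrite mul1r.
Qed.

Lemma bounded_smooth_shift kap x : bounded_smooth kap -> bounded_smooth (fun v => kap (v - x)).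
Proof.
move=> [sk bk]; split; first exact: smooth_shift.
by move=> j; have [M M0 HM] := bk j; exists M => // y; rewrite derive1n_shift.
Qed.

Lemma bounded_smooth_taylor1 kap M x y : smooth kap ->
  (forall z, `|derive1n 2 kap z| <= M) ->
  `|kap y - kap x - (y - x) * derive1n 1 kap x| <= M * `|y - x| ^+ 2.
Proof.
move=> sk HM; apply: taylor1_is_derive => z _.
  exact: smooth_is_derive1.
exact: (lipschitz_line (derive1n 1 kap) _ M x z (fun w => smooth_is_derive kap 1 w sk) HM).
Qed.

Lemma bounded_smooth_kern j sg s : `|sg| = 1 -> 0 < s -> bounded_smooth (kern j sg s).
Proof.
move=> sg1 s0; split; first exact: smooth_kern.
move=> i; rewrite derive1n_kern.
by have [C C0 HC] := kern_bounded (i + j) sg s sg1 s0; exists C => // y; exact: HC.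
Qed.

End bounded_smooth.

Section convolution.
Context {R : realType} (nu : probability (measurableTypeR R) R) (E : set (measurableTypeR R)).
Hypothesis mE : measurable E.
Implicit Types (F kap : R -> R) (M e : R).

Lemma measurable_continuous (F : R -> R) : continuous F ->
  measurable_fun (setT : set (measurableTypeR R)) F.
Proof. exact: measurable_realfun.continuous_measurable_fun. Qed.

Definition smear kap (v : R) : R := \int[nu]_(x in E) kap (v - x).

Lemma measurable_shiftN kap v : smooth kap ->
  measurable_fun (setT : set (measurableTypeR R)) (fun x : R => kap (v - x)).
Proof.
move=> sk; apply: measurable_continuous; apply: smooth_continuous.
have := smooth_comp_affine (-1) v kap sk.
by congr smooth; apply/funext => x; congr kap; ring.
Qed.

Lemma is_derive_smear kap v : bounded_smooth kap ->
  is_derive v (1 : R) (smear kap) (smear (derive1n 1 kap) v).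
Proof.
move=> [sk bk]; have [M M0 HM] := bk 2%N.
have [M1 _ HM1] := bk 1%N; have [M2 _ HM2] := bk 0%N.
apply: (is_derive_of_remainder _ _ _ M 1 ltr01) => w _.
have mk z := measurable_shiftN kap z sk.
have mk1 := measurable_shiftN _ v (smooth_derive1n 1 _ sk).
have I1 z := bounded_integrable nu E _ M2 mE (mk z) (fun x _ => HM2 (z - x)).
have I2 := bounded_integrable nu E _ M1 mE mk1 (fun x _ => HM1 (v - x)).
have I3 : nu.-integrable E (EFin \o (fun x => (w - v) * derive1n 1 kap (v - x))).
  by have := integrableZl mE (w - v) I2; apply: eq_integrable.
have I4 : nu.-integrable E (EFin \o (fun x => kap (w - x) - kap (v - x))).
  by have := integrableB mE (I1 w) (I1 v); apply: eq_integrable.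
rewrite /smear -RintegralZl// -RintegralB// -RintegralB//.
apply: bounded_Rintegral_le => //.
- apply: measurable_funB; first exact: measurable_funB.
  exact: measurable_funM.
- by rewrite mulr_ge0// exprn_ge0.
- move=> x _; have -> : w - v = (w - x) - (v - x) by ring.
  exact: bounded_smooth_taylor1.
Qed.

Lemma derive1n_smear kap j : bounded_smooth kap ->
  derive1n j (smear kap) = smear (derive1n j kap).
Proof.
move=> bk; elim: j => [//|j IH]; rewrite derive1nS IH.
apply: derive1_ext => v.
exact: is_derive_smear (bounded_smooth_derive1n j _ bk).
Qed.

Lemma smooth_smear kap : bounded_smooth kap -> smooth (smear kap).
Proof.
move=> bk j x; rewrite derive1n_smear//.
by have [] := is_derive_smear (derive1n j kap) x (bounded_smooth_derive1n j _ bk).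
Qed.

Lemma tail_small (e : R) : 0 < e -> exists2 m : nat, m.+1%:R^-1 <= e &
  fine (nu (~` `[- m.+1%:R, m.+1%:R[)) <= e.
Proof.
move=> e0.
pose A (m : nat) : set (measurableTypeR R) := ~` [set` `[- m.+1%:R, m.+1%:R[].
have mA m : measurable (A m) by apply: measurableC; exact: measurable_itv.
have A0 : \bigcap_m A m = set0.
  rewrite -subset0 => x Ax; have := Ax (Num.truncn `|x|) I; apply.
  have /andP[_ H] := truncn_itv (normr_ge0 x).
  rewrite /= in_itv /=; have := H; rewrite ltr_norml => /andP[h1 ->].
  by rewrite ltW.
have := nonincreasing_cvg_mu (_ : (nu (A 0%N) < +oo)%E) mA (bigcapT_measurable mA) _.
rewrite A0 measure0 => /(_ (le_lt_trans (probability_le1 nu (mA 0%N)) (ltry 1))).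
have ni : nonincreasing_seq A.
  move=> m n mn; apply/subsetPset => x; rewrite /A /= !in_itv /= => H.
  apply: contra_not H => /andP[h1 h2]; apply/andP; split.
    by apply: le_trans h1; rewrite lerN2 ler_nat.
  by apply: lt_le_trans h2 _; rewrite ler_nat.
move=> /(_ ni) /fine_cvgP[_ /cvgrPdist_le /(_ e e0) [N1 _ H1]].
have [N2 HN2] : exists N2 : nat, e^-1 <= N2%:R.
  by exists (Num.bound e^-1); rewrite ltW// archi_boundP// invr_ge0 ltW.
exists (N1 + N2)%N.
  rewrite invf_ple ?posrE// ?ltr0n//; apply: le_trans HN2 _.
  by rewrite ler_nat ltnW// ltnS leq_addl.
have := H1 (N1 + N2)%N (leq_addr _ _); rewrite sub0r normrN.
exact: le_trans (ler_norm _).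
Qed.

(** Nodes and weights depend on the precision only: a large interval carries
almost all the mass, and on short cells a Lipschitz function is almost constant.
This uniformity lets one rule serve a function and all its derivatives. *)
Lemma quadrature (e : R) : 0 < e -> exists (n : nat) (x w : nat -> R),
  forall (F : R -> R) (M0 M1 : R), continuous F -> 0 <= M0 -> 0 <= M1 ->
    (forall y, `|F y| <= M0) -> (forall y z, `|F y - F z| <= M1 * `|y - z|) ->
    `|\int[nu]_(y in E) F y - \sum_(k < n) w k * F (x k)| <= e * (M0 + M1).
Proof.
move=> e0; have [m me tail] := tail_small e e0.
set m1 := m.+1 in me tail.
have m1p : 0 < m1%:R :> R by rewrite ltr0n.
(* cells of length 1 / m1 that partition [- m1, m1[ *)
pose n := (2 * m1 * m1)%N.
pose x (k : nat) : R := k%:R / m1%:R - m1%:R.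
pose A (k : nat) : set (measurableTypeR R) := [set` `[x k, x k.+1[].
have mA k : measurable (A k) by exact: measurable_itv.
exists n, x, (fun k => \int[nu]_(y in E) \1_(A k) y).
move=> F M0 M1 cF M00 M10 FM0 FM1.
have mF := measurable_continuous F cF.
pose s (y : R) := \sum_(k < n) F (x k) * \1_(A k) y.
have xS k : x k.+1 = x k + m1%:R^-1.
  by rewrite /x -natr1 mulrDl mul1r; ring.
have x0E : x 0%N = - m1%:R by rewrite /x mul0r sub0r.
have xnE : x n = m1%:R.
  by rewrite /x /n !natrM; field; rewrite gt_eqF.
have x_le i k : (i <= k)%N -> x i <= x k.
  by move=> ik; rewrite lerB// ler_pM2r ?invr_gt0// ler_nat.
have disj k i y : A k y -> A i y -> k = i.
  rewrite /A /= !in_itv /= => /andP[k1 k2] /andP[i1 i2].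
  apply/eqP; rewrite eqn_leq; apply/andP; split; rewrite leqNgt; apply/negP => lt.
    by have := le_lt_trans (le_trans (x_le _ _ lt) k1) i2; rewrite ltxx.
  by have := le_lt_trans (le_trans (x_le _ _ lt) i1) k2; rewrite ltxx.
have s_in k y : (k < n)%N -> A k y -> s y = F (x k).
  move=> kn Ay; rewrite /s (bigD1 (Ordinal kn)) //= big1 ?addr0.
    by rewrite indicE mem_set// mulr1.
  move=> i ik; rewrite indicE memNset ?mulr0// => Ai.
  by move: ik; rewrite -val_eqE /= (disj _ _ _ Ai Ay) eqxx.
have cover y : (`[- m1%:R, m1%:R[%classic : set R) y -> exists2 k, (k < n)%N & A k y.
  rewrite /= in_itv /= => /andP[y1 y2].
  pose k := Num.truncn ((y + m1%:R) * m1%:R).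
  have p0 : 0 <= (y + m1%:R) * m1%:R by apply: mulr_ge0; [lra|exact: ltW].
  have /andP[k1 k2] := truncn_itv p0.
  exists k; last first.
    rewrite /A /= in_itv /= /x; apply/andP; split.
      by rewrite lerBlDr ler_pdivrMr.
    by rewrite ltrBrDr ltr_pdivlMr.
  rewrite -(ltr_nat R); apply: le_lt_trans k1 _.
  rewrite /n !natrM ltr_pM2r//; lra.
have s_tail y : ~ (`[- m1%:R, m1%:R[%classic : set R) y -> s y = 0.
  move=> Ny; rewrite /s big1// => k _; rewrite indicE memNset ?mulr0// => Ay.
  apply: Ny; move: Ay; rewrite /A /= !in_itv /= => /andP[a1 a2].
  rewrite -x0E -xnE; apply/andP; split; first by apply: le_trans a1; exact: x_le.
  by apply: lt_le_trans a2 _; apply: x_le.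
have ms : measurable_fun (setT : set (measurableTypeR R)) s.
  by apply: measurable_sum => k; apply: measurable_funM.
have sM0 y : `|s y| <= M0.
  have [/cover[k kn Ak]|Ny] := pselect ((`[- m1%:R, m1%:R[%classic : set R) y).
    by rewrite (s_in k).
  by rewrite s_tail// normr0.
have -> : \sum_(k < n) \int[nu]_(y in E) \1_(A k) y * F (x k) = \int[nu]_(y in E) s y.
  rewrite (Rintegral_sum_bounded nu E n (fun k y => F (x k) * \1_(A k) y) (fun=> M0)) //.
  - apply: eq_bigr => k _; rewrite mulrC -RintegralZl//.
    apply: (bounded_integrable nu E _ 1) => // y _.
    by rewrite indicE; case: (_ \in _); rewrite ?normr1 ?normr0.
  - by move=> k; apply: measurable_funM.
  - move=> k y; rewrite indicE; case: (_ \in _); rewrite ?mulr1 ?mulr0 ?normr0//.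
have IF := bounded_integrable nu E F M0 mE mF (fun y _ => FM0 y).
have Is := bounded_integrable nu E s M0 mE ms (fun y _ => sM0 y).
rewrite -RintegralB//.
set tl : set (measurableTypeR R) := ~` [set` `[- m1%:R, m1%:R[].
have mtl : measurable tl by apply: measurableC; exact: measurable_itv.
have mB : measurable_fun (setT : set (measurableTypeR R)) (fun y => F y - s y).
  exact: measurable_funB.
have IB := @integrableB _ _ _ nu E mE _ _ IF Is.
apply: le_trans (le_normr_Rintegral mE _) _ => //.
apply: (@le_trans _ _ (\int[nu]_(y in E) (e * M1 + M0 * \1_tl y))).
  apply: le_Rintegral => //.
  - apply: (bounded_integrable nu E _ (M0 + M0)) => //.
      exact: measurableT_comp.
    by move=> y _; rewrite normr_id; apply: le_trans (ler_normB _ _) _; exact: lerD.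
  - apply: (bounded_integrable nu E _ (e * M1 + M0)) => //.
      by apply: measurable_funD => //; apply: measurable_funM.
    move=> y _; rewrite indicE; apply: le_trans (ler_normD _ _) _.
    rewrite (ger0_norm (mulr_ge0 (ltW e0) M10)) lerD2l.
    by case: (_ \in _); rewrite ?mulr1 ?mulr0 ?normr0 ?ger0_norm.
  - move=> y _; have [yin|Ny] := pselect ((`[- m1%:R, m1%:R[%classic : set R) y).
      have [k kn Ak] := cover y yin; rewrite (s_in k)// indicE memNset; last by move=> /(_ yin).
      rewrite mulr0 addr0; apply: le_trans (FM1 _ _) _; rewrite mulrC ler_wpM2r//.
      apply: le_trans me; move: Ak; rewrite /A /= in_itv /= xS => /andP[a1 a2].
      by rewrite ger0_norm; lra.
    rewrite s_tail// subr0 indicE mem_set// mulr1; apply: le_trans (FM0 y) _.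
    by rewrite lerDr mulr_ge0// ltW.
rewrite RintegralD//; last 2 first.
- by apply: (bounded_integrable nu E _ (e * M1)) => // y _; rewrite ger0_norm// mulr_ge0// ltW.
- apply: (bounded_integrable nu E _ M0) => //; first by apply: measurable_funM.
  by move=> y _; rewrite indicE; case: (_ \in _); rewrite ?mulr1 ?mulr0 ?normr0 ?ger0_norm.
rewrite mulrDr addrC; apply: lerD.
  rewrite RintegralZl//; last first.
    apply: (bounded_integrable nu E _ 1) => // y _.
    by rewrite indicE; case: (_ \in _); rewrite ?normr1 ?normr0.
  rewrite mulrC ler_wpM2r//; apply: le_trans tail.
  rewrite /Rintegral integral_indic// fine_le ?fin_num_measure//.
    exact: measurableI.
  by apply: le_measure; rewrite ?inE//; exact: measurableI.
rewrite Rintegral_cst// ler_piMr ?mulr_ge0 ?(ltW e0)//.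
by rewrite -lee_fin fineK ?fin_num_measure//; exact: probability_le1.
Qed.

End convolution.

(** * Pairing with translates: derivatives and Fubini *)

Section pairing_translates.
Context {R : realType} (mu : @functional R).
Hypotheses (smu : schwartz_distribution mu) (cmu : compact (dist_support mu)).
Implicit Types (kap phi : R -> R) (M C e a b c x y z s t : R) (j k n : nat).

Lemma eq_of_small a b K : 0 <= K -> (forall e, 0 < e -> `|a - b| <= e * K) -> a = b.
Proof.
move=> K0 H; apply/eqP; rewrite -subr_eq0 -normr_le0; apply/ler_addgt0Pr => e e0.
have K1 : 0 < K + 1 by rewrite ltr_wpDl.
rewrite add0r; apply: le_trans (H _ (divr_gt0 e0 K1)) _.
by rewrite -mulrA ler_piMr ?(ltW e0)// mulrC ler_pdivrMr// mul1r lerDl.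
Qed.

Lemma pairing_global_bound : exists k, exists2 C, 0 <= C & forall phi M,
  smooth phi -> 0 <= M -> (forall v, jet_bound k v M phi) -> `|pairing mu phi| <= C * M.
Proof.
have [L [L0 HL]] := compact_segment _ cmu.
have [k [C C0 HC]] := pairing_bound mu (- L) L 1 smu cmu HL ltr01.
by exists k, C => // phi M sphi M0 H; apply: HC.
Qed.

Definition pairing_shift kap x : R := pairing mu (fun v => kap (v - x)).

Lemma smooth_remainder (f g h : R -> R) c : smooth f -> smooth g -> smooth h ->
  smooth (fun v => (- c) * h v + ((-1) * g v + f v)).
Proof.
move=> sf sg sh.
exact: (smooth_add _ _ (smooth_scale (- c) _ sh) (smooth_add _ _ (smooth_scale (-1) _ sg) sf)).
Qed.

Lemma pairing_remainder (f g h : R -> R) c :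
  smooth f -> smooth g -> smooth h ->
  pairing mu f - pairing mu g - c * pairing mu h =
  pairing mu (fun v => (- c) * h v + ((-1) * g v + f v)).
Proof.
move=> sf sg sh; have [lmu _] := smu.
have sgf : smooth (fun v => (-1) * g v + f v) by apply: smooth_add sf; exact: smooth_scale.
rewrite (pairing_lin mu (- c) h _ lmu cmu sh sgf) (pairing_lin mu (-1) g f lmu cmu sg sf).
ring.
Qed.

Lemma derive1n_remainder j (f g h : R -> R) c :
  smooth f -> smooth g -> smooth h ->
  derive1n j (fun v => (- c) * h v + ((-1) * g v + f v)) =
  (fun v => derive1n j f v - derive1n j g v - c * derive1n j h v).
Proof.
move=> sf sg sh.
have sg1 := smooth_scale (-1) _ sg.
rewrite (derive1n_add _ _ _ (smooth_scale (- c) _ sh) (smooth_add _ _ sg1 sf)).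
rewrite (derive1n_add _ _ _ sg1 sf) !derive1n_scale//.
by apply/funext => v; ring.
Qed.

(** The continuity of the distribution turns quadratic remainders of finitely
many space derivatives into a quadratic remainder of the pairing. *)
Lemma is_derive_pairing (psi : R -> R -> R) (chi : R -> R) s d : 0 < d ->
  (forall t, smooth (psi t)) -> smooth chi ->
  (forall k, exists2 M, 0 <= M & forall t v j, (j <= k)%N -> `|t - s| < d ->
     `|derive1n j (psi t) v - derive1n j (psi s) v - (t - s) * derive1n j chi v|
       <= M * `|t - s| ^+ 2) ->
  is_derive s (1 : R) (fun t => pairing mu (psi t)) (pairing mu chi).
Proof.
move=> d0 spsi schi H; have [k [C C0 HC]] := pairing_global_bound.
have [M M0 HM] := H k.
apply: (is_derive_of_remainder _ _ _ (C * M) d d0) => t td.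
rewrite (pairing_remainder _ _ _ _ (spsi t) (spsi s) schi) -mulrA.
apply: HC.
- exact: (smooth_remainder _ _ _ _ (spsi t) (spsi s) schi).
- by rewrite mulr_ge0// exprn_ge0.
- by move=> v j jk; rewrite (derive1n_remainder j _ _ _ _ (spsi t) (spsi s) schi); exact: HM.
Qed.

Lemma pairing_shift_bound : exists k, exists2 C, 0 <= C & forall kap M,
  smooth kap -> 0 <= M -> (forall y, jet_bound k y M kap) ->
  forall x, `|pairing_shift kap x| <= C * M.
Proof.
have [k [C C0 HC]] := pairing_global_bound; exists k, C => // kap M sk M0 H x.
apply: (HC _ _ (smooth_shift _ x sk) M0).
by move=> v j jk; rewrite (derive1n_shift _ _ _ sk); exact: H.
Qed.

Lemma is_derive_pairing_shift kap x : bounded_smooth kap ->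
  is_derive x (1 : R) (pairing_shift kap) (- pairing_shift (derive1n 1 kap) x).
Proof.
move=> bk; have [sk _] := bk.
have sk1 := smooth_derive1n 1 _ sk.
have -> : - pairing_shift (derive1n 1 kap) x = pairing mu (fun v => (-1) * derive1n 1 kap (v - x)).
  have [lmu _] := smu.
  by rewrite (pairing_scale mu _ _ lmu cmu (smooth_shift _ x sk1)) mulN1r.
apply: (is_derive_pairing (fun z v => kap (v - z)) _ x 1 ltr01).
- by move=> t; exact: smooth_shift.
- by apply: smooth_scale; exact: smooth_shift.
move=> k; have [M M0 HM] := bounded_smooth_jet kap k.+2 bk.
exists M => // t v j jk _.
rewrite !(derive1n_shift _ _ _ sk) (derive1n_scale _ _ _ (smooth_shift _ x sk1)).
rewrite (derive1n_shift _ _ _ sk1).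
have -> : (t - x) * (-1 * derive1n j (derive1n 1 kap) (v - x)) =
    ((v - t) - (v - x)) * derive1n 1 (derive1n j kap) (v - x).
  by rewrite /derive1n -iterD -iterD addnC; ring.
have -> : `|t - x| = `|(v - t) - (v - x)| by rewrite -normrN; congr `|_|; ring.
apply: bounded_smooth_taylor1; first exact: smooth_derive1n.
move=> z; have := HM z j.+2; rewrite /derive1n !iterS; apply.
by rewrite !ltnS.
Qed.

Lemma continuous_pairing_shift kap : bounded_smooth kap -> continuous (pairing_shift kap).
Proof. by move=> bk x; exact: is_derive_continuous (is_derive_pairing_shift _ x bk). Qed.

Lemma pairing_shift_lipschitz kap M : bounded_smooth kap ->
  (forall x, `|pairing_shift (derive1n 1 kap) x| <= M) ->
  forall x y, `|pairing_shift kap y - pairing_shift kap x| <= M * `|y - x|.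
Proof.
move=> bk HM x y; apply: (lipschitz_line _ _ M x y (fun z => is_derive_pairing_shift _ z bk)).
by move=> z; rewrite normrN.
Qed.

Lemma smooth_sum n (F : nat -> R -> R) : (forall i, smooth (F i)) ->
  smooth (fun v => \sum_(i < n) F i v).
Proof.
move=> sF; elim: n => [|n IH].
  by under eq_fun do rewrite big_ord0; exact: smooth_cst.
under eq_fun do rewrite big_ord_recr /=.
exact: (smooth_add _ _ IH (sF n)).
Qed.

Lemma derive1n_sum j n (F : nat -> R -> R) : (forall i, smooth (F i)) ->
  derive1n j (fun v => \sum_(i < n) F i v) = (fun v => \sum_(i < n) derive1n j (F i) v).
Proof.
move=> sF; elim: n => [|n IH].
  have -> : (fun v => \sum_(i < 0) F i v) = (fun=> 0) by apply/funext => v; rewrite big_ord0.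
  have -> : (fun v => \sum_(i < 0) derive1n j (F i) v) = (fun=> 0) by apply/funext => v; rewrite big_ord0.
  by case: j => [//|j]; exact: derive1n_cst.
have -> : (fun v => \sum_(i < n.+1) F i v) = (fun v => \sum_(i < n) F i v + F n v).
  by apply/funext => v; rewrite big_ord_recr.
rewrite (derive1n_add j _ _ (smooth_sum n F sF) (sF n)) IH.
by apply/funext => v; rewrite big_ord_recr.
Qed.

(** Fubini for distributions. The pairing commutes with quadrature sums by
linearity, and both sides are close to the same sum, the left one uniformly with
all derivatives. *)
Lemma pairing_smear (nu : probability (measurableTypeR R) R)
    (E : set (measurableTypeR R)) kap :
  measurable E -> bounded_smooth kap ->
  pairing mu (smear nu E kap) = \int[nu]_(x in E) pairing_shift kap x.
Proof.
move=> mE bk; have [sk _] := bk; have [lmu _] := smu.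
have [k [C C0 HC]] := pairing_global_bound.
have [k' [C' C'0 HC']] := pairing_shift_bound.
have [M M0 HM] := bounded_smooth_jet kap k.+1 bk.
have [M' M'0 HM'] := bounded_smooth_jet kap k'.+1 bk.
have sk1 := smooth_derive1n 1 _ sk.
have B0 x : `|pairing_shift kap x| <= C' * M'.
  by apply: HC' => // y; apply: jet_boundW; exact: HM'.
have B1 x : `|pairing_shift (derive1n 1 kap) x| <= C' * M'.
  by apply: HC' => // y; have /jet_boundS[] := HM' y.
apply: (eq_of_small _ _ (C * (M + M) + (C' * M' + C' * M'))).
  by rewrite !(addr_ge0, mulr_ge0).
move=> e e0; have [n [x [w Q]]] := quadrature nu E mE e e0.
set S := \sum_(i < n) w i * pairing_shift kap (x i).
rewrite (_ : _ - _ = (pairing mu (smear nu E kap) - S)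
                   - (\int[nu]_(x in E) pairing_shift kap x - S)); last by ring.
rewrite mulrDr; apply: le_trans (ler_normB _ _) _; apply: lerD; last first.
  apply: Q => //; first exact: continuous_pairing_shift.
  - by rewrite mulr_ge0.
  - by rewrite mulr_ge0.
  - by move=> y z; exact: pairing_shift_lipschitz.
pose F (i : nat) v := w i * kap (v - x i).
have sF i : smooth (F i) by apply: smooth_scale; exact: smooth_shift.
have -> : S = pairing mu (fun v => \sum_(i < n) F i v).
  rewrite pairing_sum//; apply: eq_bigr => i _; rewrite /F /pairing_shift.
  by rewrite (pairing_scale mu _ _ lmu cmu (smooth_shift _ (x i) sk)).
have ss := smooth_smear nu E mE kap bk; have sS := smooth_sum n F sF.
have := pairing_remainder _ _ (fun=> 0) 0 ss sS (smooth_cst 0).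
rewrite mul0r subr0 => ->; rewrite mulrCA.
apply: HC.
- exact: (smooth_remainder _ _ (fun=> 0) 0 ss sS (smooth_cst 0)).
- by rewrite mulr_ge0 ?addr_ge0// ltW.
move=> v j jk; rewrite (derive1n_remainder j _ _ _ _ ss sS (smooth_cst 0)) mul0r subr0.
rewrite (derive1n_smear nu E mE kap j bk) (derive1n_sum j n F sF).
have -> : \sum_(i < n) derive1n j (F i) v = \sum_(i < n) w i * derive1n j kap (v - x i).
  apply: eq_bigr => i _; rewrite /F derive1n_scale; last exact: smooth_shift.
  by rewrite derive1n_shift.
have cK : continuous (fun y : R => derive1n j kap (v - y)).
  apply: smooth_continuous.
  have := smooth_comp_affine (-1) v _ (smooth_derive1n j _ sk).
  by congr smooth; apply/funext => y; congr (derive1n j kap); ring.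
apply: Q => //.
- by move=> y; apply: HM; exact: leqW.
- move=> y z; have -> : `|y - z| = `|(v - y) - (v - z)| by rewrite -normrN; congr `|_|; ring.
  apply: (lipschitz_line _ _ M _ _ (fun u => smooth_is_derive kap j u sk)) => u.
  exact: (HM u j.+1).
Qed.

(** * Heat potentials *)

Definition heat_pot (sg : R) j s x : R := pairing_shift (kern j sg s) x.

Lemma is_derive_heat_pot sg j s x : `|sg| = 1 -> 0 < s ->
  is_derive x (1 : R) (heat_pot sg j s) (- heat_pot sg j.+1 s x).
Proof.
move=> sg1 s0; have := is_derive_pairing_shift _ x (bounded_smooth_kern j sg s sg1 s0).
by rewrite derive1n_kern.
Qed.

Lemma heat_pot_bounded sg j e : `|sg| = 1 -> 0 < e ->
  exists2 B, 0 <= B & forall s x, e <= s -> `|heat_pot sg j s x| <= B.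
Proof.
move=> sg1 e0; have [k [C C0 HC]] := pairing_shift_bound.
have [M M0 HM] : exists2 M, 0 <= M & forall s, e <= s -> forall y, jet_bound k y M (kern j sg s).
  elim: (k) => [|k' [M M0 HM]].
    have [M M0 HM] := kern_bounded j sg e sg1 e0.
    by exists M => // s es y [|//] _; exact: HM.
  have [M' M'0 HM'] := kern_bounded (k'.+1 + j) sg e sg1 e0.
  exists (M + M'); first by rewrite addr_ge0.
  move=> s es y i; rewrite leq_eqVlt => /orP[/eqP ->|ik].
    by rewrite derive1n_kern; apply: le_trans (HM' s y es) _; rewrite lerDr.
  by apply: le_trans (HM s es y i ik) _; rewrite lerDl.
exists (C * M); first by rewrite mulr_ge0.
move=> s x es; apply: HC => //; first exact: smooth_kern.
exact: HM.
Qed.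

Lemma is_derive_heat_pot_time sg j s x : sg ^+ 2 = 1 -> 0 < s ->
  is_derive s (1 : R) (fun t => heat_pot sg j t x) (2^-1 * heat_pot sg j.+2 s x).
Proof.
move=> sg2 s0.
have sg1 : `|sg| = 1 by apply/eqP; rewrite -sqr_norm_eq1 sg2.
have [lmu _] := smu.
have -> : 2^-1 * heat_pot sg j.+2 s x = pairing mu (fun v => 2^-1 * kern j.+2 sg s (v - x)).
  by rewrite (pairing_scale mu _ _ lmu cmu (smooth_shift _ x (smooth_kern j.+2 sg s))).
have s20 : 0 < s / 2 by rewrite divr_gt0.
apply: (is_derive_pairing (fun t v => kern j sg t (v - x)) _ s (s / 2) s20).
- by move=> t; apply: smooth_shift; exact: smooth_kern.
- by apply: smooth_scale; apply: smooth_shift; exact: smooth_kern.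
move=> k.
have [M M0 HM] : exists2 M, 0 <= M & forall t y i, (i <= k)%N -> s / 2 <= t ->
    `|kern (i + j).+4 sg t y| <= M.
  elim: k => [|k [M M0 HM]].
    have [M M0 HM] := kern_bounded j.+4 sg _ sg1 s20.
    by exists M => // t y [|//] _; exact: HM.
  have [M' M'0 HM'] := kern_bounded (k.+1 + j).+4 sg _ sg1 s20.
  exists (M + M'); first by rewrite addr_ge0.
  move=> t y i; rewrite leq_eqVlt => /orP[/eqP ->|ik] st.
    by apply: le_trans (HM' t y st) _; rewrite lerDr.
  by apply: le_trans (HM t y i ik st) _; rewrite lerDl.
exists (4^-1 * M); first by rewrite mulr_ge0.
move=> t v i ik ts.
rewrite !(derive1n_shift _ _ _ (smooth_kern j sg _)).
rewrite (derive1n_scale _ _ _ (smooth_shift _ x (smooth_kern j.+2 sg s))).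
rewrite (derive1n_shift _ _ _ (smooth_kern j.+2 sg s)) !derive1n_kern.
set y := v - x.
have pos z : Num.min s t <= z -> s / 2 <= z.
  apply: le_trans; rewrite le_min; move: ts; rewrite ltr_norml => /andP[? ?].
  by apply/andP; split; lra.
have time z i' : Num.min s t <= z -> is_derive z (1 : R) (fun r => kern i' sg r y) (2^-1 * kern i'.+2 sg z y).
  by move=> /pos sz; apply: is_derive_kern_time => //; apply: lt_le_trans sz.
rewrite !addnS.
apply: (taylor1_is_derive (fun r => kern (i + j) sg r y) (fun r => 2^-1 * kern (i + j).+2 sg r y)).
  by move=> z /andP[mz _]; exact: time.
move=> z /andP[mz zM].
have key a b : Num.min s t <= a -> a <= b ->
    `|2^-1 * kern (i + j).+2 sg b y - 2^-1 * kern (i + j).+2 sg a y| <= 4^-1 * M * (b - a).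
  move=> ma ab.
  apply: (lipschitz_is_derive (fun r => 2^-1 * kern (i + j).+2 sg r y)
    (fun r => 2^-1 * (2^-1 * kern (i + j).+4 sg r y)) _ a b ab).
    move=> r /andP[ar _]; apply: is_derive_scale; apply: time.
    exact: le_trans ma ar.
  move=> r /andP[ar _]; rewrite mulrA normrM ger0_norm// (_ : 2^-1 * 2^-1 = 4^-1); last by field.
  by rewrite ler_wpM2l//; apply: HM => //; apply: pos; exact: le_trans ma ar.
have [sz|zs] := leP s z.
  rewrite (ger0_norm (_ : 0 <= z - s)) ?subr_ge0//.
  by apply: key => //; rewrite ge_min lexx.
rewrite distrC (distrC z) (ger0_norm (_ : 0 <= s - z)) ?subr_ge0; last exact: ltW.
by apply: key => //; exact: ltW.
Qed.

Lemma heat_pot_lipschitz sg j e : sg ^+ 2 = 1 -> 0 < e ->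
  exists2 B, 0 <= B & forall s t x y, e <= s -> e <= t ->
    `|heat_pot sg j t y - heat_pot sg j s x| <= B * (`|t - s| + `|y - x|).
Proof.
move=> sg2 e0; have sg1 : `|sg| = 1 by apply/eqP; rewrite -sqr_norm_eq1 sg2.
have [B1 B10 HB1] := heat_pot_bounded sg j.+1 e sg1 e0.
have [B2 B20 HB2] := heat_pot_bounded sg j.+2 e sg1 e0.
exists (B1 + B2); first by rewrite addr_ge0.
move=> s t x y es et.
rewrite (_ : _ - _ = (heat_pot sg j t y - heat_pot sg j s y) +
  (heat_pot sg j s y - heat_pot sg j s x)); last by ring.
apply: le_trans (ler_normD _ _) _; rewrite mulrDr; apply: lerD.
  have key a b : e <= a -> a <= b -> `|heat_pot sg j b y - heat_pot sg j a y| <= (B1 + B2) * (b - a).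
    move=> ea ab; apply: (lipschitz_is_derive (fun r => heat_pot sg j r y)
      (fun r => 2^-1 * heat_pot sg j.+2 r y)) => // r /andP[ar _].
      by apply: is_derive_heat_pot_time => //; apply: lt_le_trans e0 _; exact: le_trans ea ar.
    rewrite normrM ger0_norm//; apply: le_trans (_ : 1 * B2 <= _); last by rewrite mul1r lerDr.
    by apply: ler_pM => //; [lra|apply: HB2; exact: le_trans ea ar].
  have [st|ts] := leP s t.
    by rewrite (ger0_norm (_ : 0 <= t - s)) ?subr_ge0//; exact: key.
  rewrite distrC (distrC t) (ger0_norm (_ : 0 <= s - t)) ?subr_ge0; last exact: ltW.
  by apply: key => //; exact: ltW.
have s0 : 0 < s by exact: lt_le_trans es.
apply: (lipschitz_line _ _ (B1 + B2) x y (fun z => is_derive_heat_pot sg j s z sg1 s0)) => z.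
by rewrite normrN; apply: le_trans (HB1 _ _ es) _; rewrite lerDl.
Qed.

(** The distribution only sees a neighbourhood of its support, which may be
extended by half of the distance dl to the point; there the kernel and its
derivatives decay. *)
Lemma heat_pot_terminal sg c dl e : `|sg| = 1 -> 0 < dl -> 0 < e ->
  (forall v, dist_support mu v -> sg * (v - c) <= 0) ->
  exists2 eta, 0 < eta & forall s x, 0 < s < eta -> sg * (c - x) <= - dl ->
    `|heat_pot sg 0 s x| <= e.
Proof.
move=> sg1 dl0 e0 supp.
have [L [L0 HL]] := compact_segment _ cmu.
have dl20 : 0 < dl / 2 by rewrite divr_gt0.
have [a [b [Hab Hsub]]] : exists a b, dist_support mu `<=` `[a, b] /\
    forall v, a - dl / 2 <= v <= b + dl / 2 -> sg * (v - c) <= dl / 2.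
  have : sg ^+ 2 == 1 by rewrite sqr_norm_eq1 sg1.
  rewrite sqrf_eq1 => /orP[/eqP sgE|/eqP sgE]; rewrite sgE in supp *.
    exists (- L), c; split.
      by move=> v Hv; have := supp v Hv; have := HL v Hv; rewrite /= !in_itv /= => /andP[-> _]; rewrite mul1r subr_le0.
    by move=> v /andP[? ?]; lra.
  exists c, L; split.
    by move=> v Hv; have := supp v Hv; have := HL v Hv; rewrite /= !in_itv /= => /andP[_ ->]; rewrite mulN1r oppr_le0 subr_ge0 andbT.
  by move=> v /andP[? ?]; lra.
have [k [C C0 HC]] := pairing_bound mu a b (dl / 2) smu cmu Hab dl20.
have e'0 : 0 < e / (C + 1) by rewrite divr_gt0// ltr_wpDl.
have [eta eta0 Heta] : exists2 eta, 0 < eta & forall s y j, (j <= k)%N -> 0 < s < eta ->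
    sg * y <= - (dl / 2) -> `|kern j sg s y| <= e / (C + 1).
  elim: (k) => [|k' [eta eta0 IH]].
    have [eta eta0 H] := kern_decay 0 sg (dl / 2) _ sg1 dl20 e'0.
    by exists eta => // s y [|//] _; exact: H.
  have [eta' eta'0 H] := kern_decay k'.+1 sg (dl / 2) _ sg1 dl20 e'0.
  exists (Num.min eta eta'); first by rewrite lt_min eta0.
  move=> s y j; rewrite lt_min leq_eqVlt => /orP[/eqP ->|jk] /and3P[s0 s1 s2] sy.
    by apply: H => //; rewrite s0.
  by apply: IH => //; rewrite s0.
exists eta => // s x sbnd sx.
apply: (@le_trans _ _ (C * (e / (C + 1)))); last first.
  by rewrite mulrCA ler_piMr ?(ltW e0)// ler_pdivrMr ?mul1r ?lerDl// ltr_wpDl.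
apply: HC.
- by apply: smooth_shift; exact: smooth_kern.
- exact: ltW.
move=> v vab j jk; rewrite (derive1n_shift _ _ _ (smooth_kern 0 sg s)) derive1n_kern addn0.
apply: Heta => //; have := Hsub v vab.
rewrite (_ : sg * (v - x) = sg * (v - c) + sg * (c - x)); last by ring.
lra.
Qed.

End pairing_translates.

(** * Independent increments *)

Section restricted_law.
Context {R : realType} d (T : measurableType d) (P : probability T R).
Context d' (Y : measurableType d').
Variables (A : set T) (mA : measurable A) (phi : T -> Y) (mphi : measurable_fun setT phi).

(** Independence of an event and a variable is an identity between a law
restricted to the event and a multiple of the full law, hence a restriction by
[A] is built in. *)
Definition restricted_law & measurable_fun setT phi : set Y -> \bar R :=
  pushforward (mrestr P mA) phi.

Local Notation law := (restricted_law mphi).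

Let law0 : law set0 = 0%E.
Proof. by rewrite /restricted_law /pushforward preimage_set0 measure0. Qed.

Let law_ge0 B : (0 <= law B)%E.
Proof. exact: measure_ge0. Qed.

Let mpre B : measurable B -> measurable (phi @^-1` B).
Proof. by move=> mB; rewrite -[X in measurable X]setTI; exact: mphi. Qed.

Let law_sigma_additive : semi_sigma_additive law.
Proof.
move=> F mF tF mUF; rewrite /restricted_law /pushforward preimage_bigcup.
apply: measure_semi_sigma_additive.
- by move=> n; exact: mpre.
- apply/trivIsetP => /= i j _ _ ij; rewrite -preimage_setI.
  by move/trivIsetP : tF => /(_ _ _ _ _ ij) ->//; rewrite preimage_set0.
- by rewrite -preimage_bigcup; exact: mpre.
Qed.

HB.instance Definition _ := isMeasure.Build _ _ _
  law law0 law_ge0 law_sigma_additive.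

Let law_finite : fin_num_fun law.
Proof.
move=> U mU; rewrite /restricted_law /pushforward /mrestr fin_num_measure//.
by apply: measurableI => //; exact: mpre.
Qed.

HB.instance Definition _ := Measure_isFinite.Build _ _ _ law law_finite.

Lemma restricted_lawE B : law B = P (A `&` phi @^-1` B).
Proof. by rewrite /restricted_law /pushforward /mrestr setIC. Qed.

Lemma ge0_integral_restricted_law (f : Y -> \bar R) :
  measurable_fun setT f -> (forall y, 0 <= f y)%E ->
  (\int[law]_y f y = \int[P]_(x in A) f (phi x))%E.
Proof.
move=> mf f0; rewrite ge0_integral_pushforward//.
rewrite preimage_setT -(setUv A) ge0_integral_setU//.
- rewrite (@null_set_integral _ _ _ (mrestr P mA) (~` A))//.
  + by rewrite adde0; apply: eq_measure_integral => B mB BA; rewrite /= /mrestr setIidl.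
  + exact: measurableC.
  + by apply: (measurable_funS measurableT) => //; exact: measurableT_comp.
  + by rewrite /= /mrestr setICl measure0.
- exact: measurableC.
- by rewrite setUv; exact: measurableT_comp.
- by move=> x _; exact: f0.
- by apply/disj_setPS => x [].
Qed.

End restricted_law.
Arguments restricted_law {R d T} P {d' Y A} mA {phi}.
Arguments restricted_lawE {R d T} P {d' Y A} mA {phi}.
Arguments ge0_integral_restricted_law {R d T} P {d' Y A} mA {phi}.

Section independent_increment.
Context {R : realType} d (T : measurableType d) (P : probability T R).
Variable nu : probability (measurableTypeR R) R.
Variables (A : set T) (mA : measurable A) (X Y : T -> R).
Hypotheses (mX : measurable_fun setT (X : T -> measurableTypeR R))
           (mY : measurable_fun setT (Y : T -> measurableTypeR R)).
Hypothesis indep : forall C B : set (measurableTypeR R), measurable C -> measurable B ->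
  P (A `&` X @^-1` C `&` Y @^-1` B) = (P (A `&` X @^-1` C) * nu B)%E.

(** On the event [A] the two variables jointly follow a product law; then use
Tonelli. *)
Lemma Rintegral_independent_increment (F : R -> R) M :
  measurable_fun setT (F : measurableTypeR R -> R) ->
  (forall x, 0 <= F x <= M) ->
  \int[P]_(w in A) F (X w + Y w) = \int[P]_(w in A) \int[nu]_z F (X w + z).
Proof.
move=> mF F0M; have F0 x : 0 <= F x by have /andP[] := F0M x.
have FM x : F x <= M by have /andP[] := F0M x.
have mXY : measurable_fun setT (fun w => (X w, Y w) : (measurableTypeR R * measurableTypeR R)%type).
  exact: measurable_fun_pair.
pose m1 : {finite_measure set (measurableTypeR R) -> \bar R} := restricted_law P mA mX.
pose m' : {finite_measure set (measurableTypeR R * measurableTypeR R)%type -> \bar R} :=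
  restricted_law P mA mXY.
have prod_eq B : measurable B -> (m1 \x nu)%E B = m' B.
  apply: product_measure_unique => C D mC mD.
  by rewrite /m1 /m' /= !restricted_lawE -indep// setIA.
pose G (p : (measurableTypeR R * measurableTypeR R)%type) : \bar R := (F (p.1 + p.2))%:E.
have mG : measurable_fun setT G.
  apply/measurable_EFinP; apply: (measurableT_comp mF).
  exact: measurable_funD.
have G0 p : (0 <= G p)%E by rewrite lee_fin.
have key : (\int[P]_(w in A) (F (X w + Y w))%:E =
            \int[P]_(w in A) (\int[nu]_z F (X w + z))%:E)%E.
  transitivity (\int[m']_p G p)%E; first by rewrite (ge0_integral_restricted_law P mA mXY).
  transitivity (\int[m1 \x nu]_p G p)%E.
    by apply: eq_measure_integral => B mB _; exact/esym/prod_eq.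
  rewrite (fubini_tonelli1 G mG G0) /fubini_F.
  have mFG := measurable_fun_fubini_tonelli_F G mG G0 (m2 := nu).
  rewrite (ge0_integral_restricted_law P mA mX _ mFG); last first.
    by move=> x; apply: integral_ge0 => z _; exact: G0.
  apply: eq_integral => w _; rewrite /fubini_F /G /= /Rintegral fineK//.
  apply: integrable_fin_num => //.
  apply: (bounded_integrable nu setT (fun z => F (X w + z)) M) => //.
    by apply: (measurableT_comp mF); exact: measurable_funD.
  by move=> z _; rewrite ger0_norm.
by rewrite /Rintegral key.
Qed.

End independent_increment.

Section independence.
Context {R : realType} d (Omega : measurableType d) (P : probability Omega R).

Section sigma_algebra_of_increments.
Variables (n : nat) (X : 'I_n.+1 -> Omega -> R).
Hypotheses (mX : forall k, measurable_fun setT (X k)) (indX : mutually_independent P X).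

Definition box (C : 'I_n.+1 -> set R) : set Omega :=
  [set w | forall k : 'I_n.+1, (k < n)%N -> C k (X k w)].

Definition boxes : set (set Omega) :=
  [set A | exists2 C, (forall k, measurable (C k)) & A = box C].

Let mpre (k : 'I_n.+1) (C : set R) : measurable C -> measurable (X k @^-1` C).
Proof. by move=> mC; rewrite -[X in measurable X]setTI; exact: mX. Qed.

Let boxI (C : 'I_n.+1 -> set R) (B : set R) : box C `&` X ord_max @^-1` B =
  \bigcap_(k in [set: 'I_n.+1]) (X k @^-1` (if (k < n)%N then C k else B)).
Proof.
apply/seteqP; split=> w /=.
  move=> [Cw Bw] k _ /=; case: ifPn => [kn|]; first exact: Cw.
  rewrite -leqNgt => nk; have -> : k = ord_max by apply/val_inj/eqP; rewrite eqn_leq nk -ltnS ltn_ord.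
  exact: Bw.
move=> H; split; last by have := H ord_max I; rewrite /= ltnn.
by move=> k kn; have := H k I; rewrite /= kn.
Qed.

Let boxT (C : 'I_n.+1 -> set R) : box C = box C `&` X ord_max @^-1` setT.
Proof. by rewrite preimage_setT setIT. Qed.

Lemma measurable_box C : (forall k, measurable (C k)) -> measurable (box C).
Proof.
move=> mC; rewrite boxT boxI; apply: fin_bigcap_measurable => // k _.
by apply: mpre; case: ifP.
Qed.

Lemma box_independent C B : (forall k, measurable (C k)) -> measurable B ->
  P (box C `&` X ord_max @^-1` B) = (P (box C) * P (X ord_max @^-1` B))%E.
Proof.
move=> mC mB.
have H D : measurable D -> P (box C `&` X ord_max @^-1` D) =
    (\prod_(k < n) P (X (widen_ord (leqnSn n) k) @^-1` C (widen_ord (leqnSn n) k)) *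
     P (X ord_max @^-1` D))%E.
  move=> mD; rewrite boxI indX; last by move=> k; case: ifP.
  rewrite big_ord_recr /= ltnn; congr (_ * _)%E.
  by apply: eq_bigr => k _; rewrite /= ltn_ord.
by rewrite H// [in RHS]boxT H// preimage_setT probability_setT mule1.
Qed.

Lemma sigma_boxes_independent A B : <<s boxes >> A -> measurable B ->
  P (A `&` X ord_max @^-1` B) = (P A * P (X ord_max @^-1` B))%E.
Proof.
move=> sA mB; have mXB := mpre ord_max B mB.
have fB : P (X ord_max @^-1` B) \is a fin_num by rewrite fin_num_measure.
have rB : 0 <= fine (P (X ord_max @^-1` B)) by rewrite fine_ge0.
pose m1 : {measure set Omega -> \bar R} := mrestr P mXB.
pose m2 : {measure set Omega -> \bar R} := mscale (NngNum rB) P.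
have -> : (P A * P (X ord_max @^-1` B))%E = m2 A.
  by rewrite /m2 /= /mscale /= fineK// muleC.
have boxTT : box (fun=> setT) = setT by apply/seteqP; split.
apply: (g_sigma_algebra_measure_unique boxes _ (fun=> setT) _ _ m1 m2) sA.
- by move=> _ [C mC ->]; exact: measurable_box.
- by move=> i; exists (fun=> setT).
- by rewrite bigcup_const//; exists 0%N.
- move=> _ _ [C mC ->] [D mD ->]; exists (fun k => C k `&` D k).
    by move=> k; exact: measurableI.
  apply/seteqP; split=> w /=; first by move=> [Cw Dw] k kn; split; [exact: Cw|exact: Dw].
  by move=> H; split=> k /H[].
- move=> _ [C mC ->]; rewrite /m1 /m2 /= /mrestr /mscale /= fineK// muleC.
  exact: box_independent.
- move=> k; rewrite /m1 /= /mrestr setTI; apply: le_lt_trans (probability_le1 P mXB) _.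
  exact: ltry.
Qed.

End sigma_algebra_of_increments.

Variable W : R -> {RV P >-> R}.
Hypothesis BM : standard_brownian_motion W.

Let W0 w : W 0 w = 0. Proof. by case: BM. Qed.

Lemma measurable_W t : measurable_fun setT (W t : Omega -> R).
Proof. exact: measurable_funP. Qed.

(** Only increments are assumed independent. Positions are sums of increments,
so a cylinder in positions belongs to the sigma-algebra of boxes of increments. *)
Lemma cylinder_independent (n : nat) (t : nat -> R) (C : nat -> set R) (B : set R) :
  t 0%N = 0 -> {homo t : j k / (j <= k)%N >-> j <= k} ->
  (forall k, measurable (C k)) -> measurable B ->
  P ([set w | forall k, (k <= n)%N -> C k (W (t k) w)] `&`
     (fun w => (W (t n.+1) w - W (t n) w)%R) @^-1` B) =
  (P [set w | forall k, (k <= n)%N -> C k (W (t k) w)] *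
   P ((fun w => (W (t n.+1) w - W (t n) w)%R) @^-1` B))%E.
Proof.
move=> t0 homt mC mB.
pose X (k : 'I_n.+1) w := W (t k.+1) w - W (t k) w.
have mX k : measurable_fun setT (X k) by apply: measurable_funB; exact: measurable_W.
have indX : mutually_independent P X.
  by have [_ _ _ H] := BM; apply: H => //; rewrite t0.
apply: (sigma_boxes_independent n X mX indX) mB.
pose S := g_sigma_algebraType (boxes n X).
have mXS (k : 'I_n.+1) : (k < n)%N -> measurable_fun (setT : set S) (X k : S -> R).
  move=> kn _ D mD; rewrite setTI; apply: sub_sigma_algebra.
  exists (fun i => if i == k then D else setT).
    by move=> i; case: ifP.
  apply/seteqP; split=> w /= H.
    by move=> i iN; case: eqP => // ->.
  by have := H k kn; rewrite eqxx.
have mWS k : (k <= n)%N -> measurable_fun (setT : set S) (W (t k) : S -> R).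
  elim: k => [_|k IH kn].
    rewrite t0 (_ : (W 0 : S -> R) = cst 0); first exact: measurable_cst.
    by apply/funext => w; rewrite W0.
  have kn1 : (k < n.+1)%N by rewrite ltnW.
  rewrite (_ : (W (t k.+1) : S -> R) = (fun w => X (Ordinal kn1) w + W (t k) w)); last first.
    by apply/funext => w; rewrite /X /= subrK.
  by apply: measurable_funD; [exact: mXS|apply: IH; exact: ltnW].
have -> : [set w | forall k, (k <= n)%N -> C k (W (t k) w)] =
    \bigcap_(k in [set k | (k <= n)%N]) ((W (t k) : S -> R) @^-1` C k).
  by apply/seteqP; split.
apply: (@bigcap_measurableType _ S) => k kn.
by rewrite -[X in measurable X]setTI; apply: mWS.
Qed.

End independence.

(** * Continuous paths and first hitting times *)

Section continuity_on_segments.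
Context {R : realType}.
Implicit Types (f h : R -> R) (a b s t x y e : R).

Definition segment_continuous a b f : Prop := forall x, a <= x <= b ->
  forall e, 0 < e -> exists2 dl, 0 < dl & forall y, a <= y <= b -> `|y - x| < dl -> `|f y - f x| < e.

Lemma segment_continuousP a b f : segment_continuous a b f <-> {within `[a, b], continuous f}.
Proof.
split=> [H|/subspace_continuousP H x xab e e0].
  apply/subspace_continuousP => x; rewrite /= in_itv /= => xab.
  apply/cvgrPdist_lt => e e0; have [dl dl0 Hdl] := H x xab e e0.
  rewrite near_withinE; apply/nbhs_ballP; exists dl => //= y.
  rewrite -ball_normE /= distrC => yx; rewrite in_itv /= => yab.
  by rewrite distrC; exact: Hdl.
have := H x; rewrite /= in_itv /= => /(_ xab) /cvgrPdist_lt /(_ e e0).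
rewrite near_withinE => /nbhs_ballP[dl /= dl0 Hdl].
exists dl => // y yab yx; rewrite distrC; apply: Hdl; rewrite ?in_itv//=.
by rewrite -ball_normE /= distrC.
Qed.

Lemma segment_continuousW a b a' b' f : a <= a' -> b' <= b ->
  segment_continuous a b f -> segment_continuous a' b' f.
Proof.
move=> aa bb H x /andP[x1 x2] e e0.
have [|dl dl0 Hdl] := H x _ e e0; first by rewrite (le_trans aa x1) (le_trans x2 bb).
exists dl => // y /andP[y1 y2]; apply: Hdl.
by rewrite (le_trans aa y1) (le_trans y2 bb).
Qed.

Lemma segment_continuousB a b f h : segment_continuous a b f -> segment_continuous a b h ->
  segment_continuous a b (fun x => f x - h x).
Proof.
move=> Hf Hh x xab e e0; have e20 : 0 < e / 2 by rewrite divr_gt0.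
have [d1 d10 H1] := Hf x xab _ e20; have [d2 d20 H2] := Hh x xab _ e20.
exists (Num.min d1 d2); first by rewrite lt_min d10.
move=> y yab; rewrite lt_min => /andP[y1 y2].
rewrite (_ : _ - _ = (f y - f x) - (h y - h x)); last by ring.
apply: le_lt_trans (ler_normB _ _) _.
by have := H1 y yab y1; have := H2 y yab y2; lra.
Qed.

Lemma segment_continuousD a b f h : segment_continuous a b f -> segment_continuous a b h ->
  segment_continuous a b (fun x => f x + h x).
Proof.
move=> Hf Hh x xab e e0; have e20 : 0 < e / 2 by rewrite divr_gt0.
have [d1 d10 H1] := Hf x xab _ e20; have [d2 d20 H2] := Hh x xab _ e20.
exists (Num.min d1 d2); first by rewrite lt_min d10.
move=> y yab; rewrite lt_min => /andP[y1 y2].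
rewrite (_ : _ - _ = (f y - f x) + (h y - h x)); last by ring.
apply: le_lt_trans (ler_normD _ _) _.
by have := H1 y yab y1; have := H2 y yab y2; lra.
Qed.

Lemma segment_continuous_cst a b c : segment_continuous a b (fun=> c).
Proof. by move=> x _ e e0; exists 1 => // y _ _; rewrite subrr normr0. Qed.

Lemma segment_continuous_min a b f h : segment_continuous a b f -> segment_continuous a b h ->
  segment_continuous a b (fun x => Num.min (f x) (h x)).
Proof.
move=> Hf Hh x xab e e0.
have [d1 d10 H1] := Hf x xab _ e0; have [d2 d20 H2] := Hh x xab _ e0.
exists (Num.min d1 d2); first by rewrite lt_min d10.
move=> y yab; rewrite lt_min => /andP[y1 y2].
have := H1 y yab y1; have := H2 y yab y2.
rewrite !ltr_norml => /andP[? ?] /andP[? ?].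
by rewrite /Num.min /=; case: (ltP (f y)); case: (ltP (f x)) => *; apply/andP; split; lra.
Qed.

Lemma segment_continuous_ge0 a b h t : segment_continuous a b h -> a <= t <= b ->
  (forall dl, 0 < dl -> exists2 q, a <= q <= b & `|q - t| < dl /\ 0 < h q) -> 0 <= h t.
Proof.
move=> ch tab H; rewrite leNgt; apply/negP => ht.
have ht' : 0 < - h t by lra.
have [dl dl0 Hdl] := ch t tab _ ht'.
have [q qab [qt hq]] := H dl dl0.
by have := Hdl q qab qt; rewrite ltr_norml => /andP[_]; lra.
Qed.

Definition hit_set s b h : set R := [set r | s <= r <= b /\ h r <= 0].

(** The value b + 1 encodes that no hit occurs before b; it compares correctly
with every time up to b. *)
Definition first_hit s b h : R :=
  if pselect (hit_set s b h !=set0) then inf (hit_set s b h) else b + 1.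

Lemma first_hitP s b h : s <= b -> segment_continuous s b h -> 0 < h s ->
  s < first_hit s b h /\
  (forall r, s <= r <= b -> r < first_hit s b h -> 0 < h r) /\
  (first_hit s b h <= b -> h (first_hit s b h) = 0).
Proof.
move=> sb ch hs; rewrite /first_hit; case: pselect => [ne|em] /=; last first.
  split; first by rewrite ltr_pwDr.
  split; last by move=> H; exfalso; lra.
  move=> r rsb _; rewrite ltNge; apply/negP => hr; apply: em.
  by exists r.
set tau := inf _.
have lb : lbound (hit_set s b h) s by move=> r [/andP[]].
have hlb : has_lbound (hit_set s b h) by exists s.
have [r0 [r0sb hr0]] := ne.
have taub : tau <= b.
  apply: le_trans (ge_inf hlb (conj r0sb hr0)) _.
  by case/andP: r0sb.
have stau : s <= tau by apply: lb_le_inf.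
have tausb : s <= tau <= b by rewrite stau.
have before r : s <= r <= b -> r < tau -> 0 < h r.
  move=> rsb rt; rewrite ltNge; apply/negP => hr.
  have := ge_inf hlb (conj rsb hr); rewrite -/tau; lra.
have htau : h tau <= 0.
  rewrite leNgt; apply/negP => ht.
  have [dl dl0 Hdl] := ch tau tausb (h tau) ht.
  have [r [rsb hr] rtau] := inf_adherent dl0 (conj ne hlb).
  have tr : tau <= r by apply: ge_inf.
  have := Hdl r rsb; rewrite ger0_norm ?subr_ge0// => /(_ _).
  rewrite ltr_norml => H; have /andP[] : - h tau < h r - h tau < h tau by apply: H; lra.
  lra.
have stau' : s < tau.
  rewrite lt_neqAle stau andbT; apply/eqP => st.
  by move: hs; rewrite st; lra.
split => //; split => // _; apply/eqP; rewrite eq_le htau /=.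
rewrite leNgt; apply/negP => ht.
have ht' : 0 < - h tau by lra.
have [dl dl0 Hdl] := ch tau tausb _ ht'.
pose r := Num.max s (tau - dl / 2).
have rtau : r < tau by rewrite gt_max stau'; lra.
have rs : s <= r by rewrite le_max lexx.
have rd : tau - dl / 2 <= r by rewrite le_max lexx orbT.
have rsb : s <= r <= b by rewrite rs /= (le_trans (ltW rtau)).
have := Hdl r rsb; rewrite ler0_norm; last lra.
rewrite ltr_norml => H; have /andP[] : - - h tau < h r - h tau < - h tau by apply: H; lra.
by have := before r rsb rtau; lra.
Qed.

Definition dyadic_pt s t (N i : nat) : R := s + (t - s) * (i%:R / (2 ^ N)%:R).

(** A positive continuous function on a segment has a positive minimum, hence a
positive lower bound at all dyadic points; conversely such a bound extends by
continuity. This turns staying inside into countably many conditions. *)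
Lemma pos_dyadicP s t h : s <= t -> segment_continuous s t h ->
  (forall r, s <= r <= t -> 0 < h r) <->
  exists j, forall N i, (i <= 2 ^ N)%N -> j.+1%:R^-1 <= h (dyadic_pt s t N i).
Proof.
move=> st ch.
have pt N i : (i <= 2 ^ N)%N -> s <= dyadic_pt s t N i <= t.
  move=> iN; have p0 : 0 < (2 ^ N)%:R :> R by rewrite ltr0n expn_gt0.
  have q0 : 0 <= i%:R / (2 ^ N)%:R :> R by rewrite divr_ge0.
  have q1 : i%:R / (2 ^ N)%:R <= 1 :> R by rewrite ler_pdivrMr// mul1r ler_nat.
  rewrite /dyadic_pt lerDl mulr_ge0 ?subr_ge0//=.
  by rewrite -lerBrDl ler_piMr// subr_ge0.
split=> [H|[j Hj] r /andP[rs rt]].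
  have [c] := EVT_min st (iffLR (segment_continuousP _ _ _) ch).
  rewrite in_itv /= => cst Hc; have hc := H c cst.
  have [j Hj] : exists j : nat, (h c)^-1 <= j%:R.
    by exists (Num.bound (h c)^-1); rewrite ltW// archi_boundP// invr_ge0 ltW.
  exists j => N i iN; apply: (@le_trans _ _ (h c)).
    rewrite invf_ple ?posrE// ?ltr0n//; apply: le_trans Hj _.
    by rewrite ler_nat.
  by apply: Hc; rewrite in_itv /=; exact: pt.
have j0 : 0 < j.+1%:R^-1 :> R by rewrite invr_gt0 ltr0n.
have rst : s <= r <= t by rewrite rs.
have [dl dl0 Hdl] := ch r rst _ j0.
have [s_eq_t|sNt] := eqVneq s t.
  have -> : r = dyadic_pt s t 0 0.
    by rewrite /dyadic_pt s_eq_t subrr mul0r addr0; apply/eqP; rewrite eq_le rt -s_eq_t.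
  by apply: lt_le_trans (Hj 0%N 0%N _).
have st' : 0 < t - s by rewrite subr_gt0 lt_neqAle sNt.
have [N HN] : exists N : nat, (t - s) / dl < (2 ^ N)%:R.
  exists (Num.bound ((t - s) / dl)).
  apply: lt_trans (archi_boundP _) _; first by rewrite divr_ge0 ?ltW.
  by rewrite ltr_nat ltn_expl.
have p0 : 0 < (2 ^ N)%:R :> R by rewrite ltr0n expn_gt0.
pose i := Num.truncn ((r - s) / (t - s) * (2 ^ N)%:R).
have z0 : 0 <= (r - s) / (t - s) * (2 ^ N)%:R.
  by rewrite mulr_ge0 ?divr_ge0 ?subr_ge0// ltW.
have /andP[i1 i2] := truncn_itv z0.
have iN : (i <= 2 ^ N)%N.
  rewrite -(ler_nat R); apply: le_trans i1 _.
  by apply: ler_piMl; [exact: ltW|rewrite ler_pdivrMr// mul1r lerB].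
have ph : j.+1%:R^-1 <= h (dyadic_pt s t N i) by exact: Hj.
have close : `|dyadic_pt s t N i - r| < dl.
  rewrite /dyadic_pt; set q := i%:R / (2 ^ N)%:R.
  have q1 : q <= (r - s) / (t - s) by rewrite ler_pdivrMr.
  have q2 : (r - s) / (t - s) < q + (2 ^ N)%:R^-1.
    have -> : q + (2 ^ N)%:R^-1 = i.+1%:R / (2 ^ N)%:R by rewrite /q -natr1 mulrDl mul1r.
    by rewrite ltr_pdivlMr.
  have b1 : (t - s) * q <= r - s by rewrite mulrC -ler_pdivlMr.
  have b2 : r - s < (t - s) * q + (t - s) / (2 ^ N)%:R.
    by rewrite -mulrDr mulrC -ltr_pdivrMr.
  have b3 : (t - s) / (2 ^ N)%:R < dl.
    by rewrite ltr_pdivrMr// mulrC -ltr_pdivrMr.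
  by rewrite ler0_norm; lra.
have := Hdl _ (pt N i iN) close; rewrite ltr_norml => /andP[_ h2].
by have := lt_le_trans h2 ph; rewrite ltrBlDr -ltrBlDl subrr.
Qed.

Lemma dyadic_pt_le s t N i j : s <= t -> (i <= j)%N -> dyadic_pt s t N i <= dyadic_pt s t N j.
Proof.
move=> st ij; rewrite /dyadic_pt lerD2l ler_wpM2l ?subr_ge0// ler_wpM2r ?invr_ge0//.
by rewrite ler_nat.
Qed.

Lemma dyadic_pt0 s t N : dyadic_pt s t N 0 = s.
Proof. by rewrite /dyadic_pt mul0r mulr0 addr0. Qed.

Lemma dyadic_ptn s t N : dyadic_pt s t N (2 ^ N) = t.
Proof.
by rewrite /dyadic_pt divff ?mulr1 ?subrKC// pnatr_eq0 expn_eq0.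
Qed.

Lemma dyadic_pt_double s t N i : dyadic_pt s t N.+1 (2 * i) = dyadic_pt s t N i.
Proof.
rewrite /dyadic_pt expnS !natrM; congr (_ + _ * _).
by field; rewrite pnatr_eq0 expn_eq0.
Qed.

End continuity_on_segments.

(** * Brownian paths between two barriers *)

Section inside_events.
Context {R : realType} d (Omega : measurableType d) (P : probability Omega R).
Variable W : R -> {RV P >-> R}.
Hypothesis BM : standard_brownian_motion W.
Variables (T u : R) (lo hi : R -> R).
Hypotheses (clo : segment_continuous 0 T lo) (chi : segment_continuous 0 T hi).
Implicit Types (s t r : R).

(** A single continuous function whose sign tells whether the path is between
the barriers, so that the first exit is the first time it stops being positive. *)
Definition gap (w : Omega) r : R := Num.min (u + W r w - lo r) (hi r - (u + W r w)).

Lemma gap_gt0 w r : 0 < gap w r <-> lo r < u + W r w < hi r.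
Proof. by rewrite /gap lt_min !subr_gt0. Qed.

Lemma le_gap w r c : c <= gap w r <-> lo r - u + c <= W r w <= hi r - u - c.
Proof.
rewrite /gap le_min; split=> /andP[h1 h2]; apply/andP; split; lra.
Qed.

Lemma path_continuous w : segment_continuous 0 T (fun r => W r w).
Proof.
have [_ cW _ _] := BM.
apply/segment_continuousP; apply: continuous_subspaceW (cW w).
by move=> r; rewrite /= !in_itv /= andbT => /andP[].
Qed.

Lemma gap_continuous w : segment_continuous 0 T (gap w).
Proof.
have cp : segment_continuous 0 T (fun r => u + W r w).
  by apply: segment_continuousD; [exact: segment_continuous_cst|exact: path_continuous].
by apply: segment_continuous_min; exact: segment_continuousB.
Qed.

Definition inside s t : set Omega := [set w | forall r, s <= r <= t -> 0 < gap w r].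

Definition dyadic_inside s t (j N : nat) : set Omega :=
  [set w | forall i, (i <= 2 ^ N)%N -> j.+1%:R^-1 <= gap w (dyadic_pt s t N i)].

Lemma insideE s t : 0 <= s -> s <= t -> t <= T ->
  inside s t = \bigcup_j \bigcap_N dyadic_inside s t j N.
Proof.
move=> s0 st tT; apply/seteqP; split=> w.
  move=> Hw; have [] := pos_dyadicP s t (gap w) st.
    exact: segment_continuousW s0 tT (gap_continuous w).
  by move=> /(_ Hw)[j Hj] _; exists j => // N _ i iN; exact: Hj.
move=> [j _ Hj]; have [_] := pos_dyadicP s t (gap w) st
  (segment_continuousW _ _ _ _ _ s0 tT (gap_continuous w)).
by apply; exists j => N i iN; exact: (Hj N I).
Qed.

Lemma measurable_preimage_W r (C : set R) : measurable C -> measurable ((W r : Omega -> R) @^-1` C).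
Proof. by move=> mC; rewrite -[X in measurable X]setTI; exact: measurable_W. Qed.

Lemma measurable_dyadic_inside s t j N : measurable (dyadic_inside s t j N).
Proof.
have -> : dyadic_inside s t j N = \bigcap_(i in [set i | (i <= 2 ^ N)%N])
   ((W (dyadic_pt s t N i) : Omega -> R) @^-1`
      `[lo (dyadic_pt s t N i) - u + j.+1%:R^-1, hi (dyadic_pt s t N i) - u - j.+1%:R^-1]).
  apply/seteqP; split=> w H i iN; first by rewrite /= in_itv /=; apply/le_gap; exact: H.
  by apply/le_gap; have := H i iN; rewrite /= in_itv.
apply: bigcap_measurableType => i _; apply: measurable_preimage_W.
exact: measurable_itv.
Qed.

Lemma dyadic_inside_nonincreasing s t j : nonincreasing_seq (dyadic_inside s t j).
Proof.
apply/nonincreasing_seqP => N; apply/subsetPset => w H i iN.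
rewrite -dyadic_pt_double; apply: H.
by rewrite expnS leq_mul2l iN orbT.
Qed.

Lemma dyadic_inside_nondecreasing s t :
  nondecreasing_seq (fun j => \bigcap_N dyadic_inside s t j N).
Proof.
apply/nondecreasing_seqP => j; apply/subsetPset => w H N _ i iN.
apply: le_trans (H N I i iN); rewrite lef_pV2 ?posrE ?ltr0n//.
by rewrite ler_nat.
Qed.

Lemma measurable_inside s t : 0 <= s -> s <= t -> t <= T -> measurable (inside s t).
Proof.
move=> s0 st tT; rewrite insideE//; apply: bigcupT_measurable => j.
by apply: bigcapT_measurable => N; exact: measurable_dyadic_inside.
Qed.

Lemma increment_law s t (B : set R) : 0 <= s < t -> measurable B ->
  P ((fun w => (W t w - W s w)%R) @^-1` B) = normal_prob 0 (Num.sqrt (t - s)) B.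
Proof. by move=> st mB; have [_ _ H _] := BM; exact: H. Qed.

(** The conditions at the dyadic times and the condition at time t form a
cylinder; an initial time 0 is prepended because the path starts there. *)
Lemma dyadic_inside_independent s t t' j N (C B : set R) :
  0 <= s -> s <= t -> t < t' -> measurable C -> measurable B ->
  P (dyadic_inside s t j N `&` (W t : Omega -> R) @^-1` C `&` (fun w => (W t' w - W t w)%R) @^-1` B) =
  (P (dyadic_inside s t j N `&` (W t : Omega -> R) @^-1` C) *
   normal_prob 0 (Num.sqrt (t' - t)) B)%E.
Proof.
move=> s0 st tt' mC mB.
(* time 0, then the dyadic times up to t, then t' *)
pose tm (k : nat) : R := if k is i.+1 then (if (i <= 2 ^ N)%N then dyadic_pt s t N i else t') else 0.
pose D (k : nat) : set R := if k is i.+1 then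
  `[lo (dyadic_pt s t N i) - u + j.+1%:R^-1, hi (dyadic_pt s t N i) - u - j.+1%:R^-1] `&`
  (if i == (2 ^ N)%N then C else setT) else setT.
have mD k : measurable (D k).
  case: k => [|k] //=; apply: measurableI; first exact: measurable_itv.
  by case: ifP.
have tm_last : tm (2 ^ N).+1 = t by rewrite /tm leqnn dyadic_ptn.
have tm_next : tm (2 ^ N).+2 = t' by rewrite /tm ltnn.
have homt : {homo tm : a b / (a <= b)%N >-> a <= b}.
  apply: homo_leq => [//|x y z|[|i]]; first exact: le_trans.
    by rewrite /tm leq0n dyadic_pt0.
  rewrite /tm; case: (leqP i.+1 (2 ^ N)) => i1.
    by rewrite ltnW//; exact: dyadic_pt_le.
  case: (leqP i (2 ^ N)) => i2 //.
  have -> : i = (2 ^ N)%N by apply/eqP; rewrite eqn_leq i2.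
  by rewrite dyadic_ptn ltW.
have -> : dyadic_inside s t j N `&` (W t : Omega -> R) @^-1` C =
    [set w | forall k, (k <= (2 ^ N).+1)%N -> D k (W (tm k) w)].
  apply/seteqP; split=> w.
    move=> [Hw Cw] [|i]; first by [].
    rewrite ltnS => iN; rewrite /D /tm iN; split.
      by rewrite /= in_itv /=; apply/le_gap; exact: Hw.
    by case: eqP => // ->; rewrite dyadic_ptn.
  move=> H; split=> [i iN|].
    have := H i.+1; rewrite ltnS /D /tm iN => /(_ isT)[].
    by rewrite /= in_itv /= => /le_gap.
  have := H (2 ^ N).+1 (leqnn _); rewrite tm_last /D eqxx.
  by move=> [].
have := @cylinder_independent R d Omega P W BM (2 ^ N).+1 tm D B erefl homt mD mB.
rewrite tm_next tm_last => ->; congr (_ * _)%E.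
by apply: increment_law => //; rewrite (le_trans s0 st).
Qed.

(** Both sides are finite measures of the staying event, continuous along the
monotone limits that exhaust it by cylinders. *)
Lemma inside_independent s t t' (C B : set R) :
  0 <= s -> s <= t -> t < t' -> t <= T -> measurable C -> measurable B ->
  P (inside s t `&` (W t : Omega -> R) @^-1` C `&` (fun w => (W t' w - W t w)%R) @^-1` B) =
  (P (inside s t `&` (W t : Omega -> R) @^-1` C) *
   normal_prob 0 (Num.sqrt (t' - t)) B)%E.
Proof.
move=> s0 st tt' tT mC mB.
have mWC : measurable ((W t : Omega -> R) @^-1` C) by exact: measurable_preimage_W.
have mWB : measurable ((fun w => (W t' w - W t w)%R) @^-1` B).
  by rewrite -[X in measurable X]setTI; apply: measurable_funB => //; exact: measurable_W.
have mCB := measurableI _ _ mWC mWB.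
have fB : normal_prob 0 (Num.sqrt (t' - t)) B \is a fin_num by rewrite fin_num_measure.
have rB : 0 <= fine (normal_prob 0 (Num.sqrt (t' - t)) B) by rewrite fine_ge0.
pose m1 : {measure set Omega -> \bar R} := mrestr P mCB.
pose m2 : {measure set Omega -> \bar R} := mscale (NngNum rB) (mrestr P mWC).
have m1E A : m1 A = P (A `&` (W t : Omega -> R) @^-1` C `&` (fun w => (W t' w - W t w)%R) @^-1` B).
  by rewrite /m1 /= /mrestr setIA.
have m2E A : m2 A = (P (A `&` (W t : Omega -> R) @^-1` C) * normal_prob 0 (Num.sqrt (t' - t)) B)%E.
  by rewrite /m2 /= /mscale /= /mrestr fineK// muleC.
rewrite -m1E -m2E insideE//.
have mD j : measurable (\bigcap_N dyadic_inside s t j N).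
  by apply: bigcapT_measurable => N; exact: measurable_dyadic_inside.
have eqj j : m1 (\bigcap_N dyadic_inside s t j N) = m2 (\bigcap_N dyadic_inside s t j N).
  have c1 := nonincreasing_cvg_mu (mu := m1) _ (measurable_dyadic_inside s t j) (mD j)
    (dyadic_inside_nonincreasing s t j).
  have c2 := nonincreasing_cvg_mu (mu := m2) _ (measurable_dyadic_inside s t j) (mD j)
    (dyadic_inside_nonincreasing s t j).
  have E : m1 \o dyadic_inside s t j = m2 \o dyadic_inside s t j.
    by apply/funext => N /=; rewrite m1E m2E; exact: dyadic_inside_independent.
  have f1 : (m1 (dyadic_inside s t j 0) < +oo)%E.
    rewrite m1E; apply: le_lt_trans (probability_le1 P _) (ltry _).
    apply: measurableI => //; apply: measurableI => //.
    exact: measurable_dyadic_inside.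
  have f2 : (m2 (dyadic_inside s t j 0) < +oo)%E.
    by have := congr1 (fun F => F 0%N) E; rewrite /= => <-.
  move: (c1 f1) (c2 f2); rewrite E => c1' c2'.
  exact: (cvg_unique _ c1' c2').
have c1 := nondecreasing_cvg_mu (mu := m1) mD (bigcupT_measurable _ mD)
  (dyadic_inside_nondecreasing s t).
have c2 := nondecreasing_cvg_mu (mu := m2) mD (bigcupT_measurable _ mD)
  (dyadic_inside_nondecreasing s t).
have E : m1 \o (fun j => \bigcap_N dyadic_inside s t j N) =
    m2 \o (fun j => \bigcap_N dyadic_inside s t j N).
  by apply/funext => j /=; exact: eqj.
move: c1 c2; rewrite E => c1' c2'.
exact: (cvg_unique _ c1' c2').
Qed.

(** Markov property on the event of staying inside. The shift by M makes the
integrand nonnegative, as the product law argument requires. *)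
Lemma inside_markov s t t' (F G : R -> R) M :
  0 <= s -> s <= t -> t < t' -> t <= T -> continuous F -> continuous G ->
  (forall x, `|F x| <= M) ->
  (forall x, \int[normal_prob 0 (Num.sqrt (t' - t))]_z F (x + z) = G x) ->
  \int[P]_(w in inside s t) F (u + W t' w) = \int[P]_(w in inside s t) G (u + W t w).
Proof.
move=> s0 st tt' tT cF cG FM FG; have M0 : 0 <= M by exact: le_trans (FM 0).
have mA := measurable_inside s t s0 st tT.
pose nu : probability (measurableTypeR R) R := normal_prob 0 (Num.sqrt (t' - t)).
have mF : measurable_fun setT (F : measurableTypeR R -> R).
  exact: measurable_realfun.continuous_measurable_fun.
have mGf : measurable_fun setT (G : measurableTypeR R -> R).
  exact: measurable_realfun.continuous_measurable_fun.
have mWt r : measurable_fun setT (W r : Omega -> measurableTypeR R) by exact: measurable_W.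
have mD : measurable_fun setT ((fun w => W t' w - W t w) : Omega -> measurableTypeR R).
  exact: (measurable_funB (mWt t') (mWt t)).
pose F' x := F (u + x) + M.
have cF' : continuous F'.
  move=> x; apply: cvgD; last exact: cvg_cst.
  apply: (continuous_comp (f := fun y => u + y) (g := F)); last exact: cF.
  by apply: cvgD; [exact: cvg_cst|exact: cvg_id].
have mF' : measurable_fun setT (F' : measurableTypeR R -> R).
  exact: measurable_realfun.continuous_measurable_fun.
have F'M x : 0 <= F' x <= M + M.
  by have := FM (u + x); rewrite /F' ler_norml => /andP[? ?]; apply/andP; split; lra.
have ind (C B : set (measurableTypeR R)) : measurable C -> measurable B ->
   P (inside s t `&` (W t : Omega -> R) @^-1` C `&` (fun w => (W t' w - W t w)%R) @^-1` B) =
   (P (inside s t `&` (W t : Omega -> R) @^-1` C) * nu B)%E.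
  by move=> mC mB; exact: inside_independent.
have key := @Rintegral_independent_increment R d Omega P nu (inside s t) mA
  (W t) (fun w => W t' w - W t w) (mWt t) mD ind F' (M + M) mF' F'M.
have mFs a : measurable_fun setT ((fun z => F (a + z)) : measurableTypeR R -> R).
  apply: (measurableT_comp mF); exact: measurable_funD.
have IM : P.-integrable (inside s t) (EFin \o (fun=> M)).
  by apply: (bounded_integrable P _ (fun=> M) `|M|).
have E2 w : \int[nu]_z F' (W t w + z) = G (u + W t w) + M.
  rewrite /F' RintegralD//.
  - rewrite Rintegral_cst// (_ : fine (nu setT) = 1) ?mulr1; last by rewrite probability_setT.
    by congr (_ + _); rewrite -FG; apply: eq_Rintegral => z _; rewrite addrA.
  - apply: (bounded_integrable nu setT (fun z => F (u + (W t w + z))) M) => //.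
    by have := mFs (u + W t w); under eq_fun do rewrite -addrA.
  - by apply: (bounded_integrable nu setT (fun=> M) `|M|).
have mFW : measurable_fun setT (fun w => F (u + W t' w)).
  by apply: (measurableT_comp mF); apply: measurable_funD => //; exact: mWt.
have mGW : measurable_fun setT (fun w => G (u + W t w)).
  by apply: (measurableT_comp mGf); apply: measurable_funD => //; exact: mWt.
have GM x : `|G x| <= M.
  by rewrite -FG; apply: (bounded_Rintegral_le nu setT (fun z => F (x + z))).
have I1 : P.-integrable (inside s t) (EFin \o (fun w => F (u + W t' w))).
  exact: (bounded_integrable P _ _ M).
have I2 : P.-integrable (inside s t) (EFin \o (fun w => G (u + W t w))).
  exact: (bounded_integrable P _ _ M).
have L : \int[P]_(w in inside s t) F' (W t w + (W t' w - W t w)) =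
    \int[P]_(w in inside s t) F (u + W t' w) + \int[P]_(w in inside s t) M.
  by rewrite -RintegralD//; apply: eq_Rintegral => w _; rewrite /F' subrKC.
have L' : \int[P]_(w in inside s t) \int[nu]_z F' (W t w + z) =
    \int[P]_(w in inside s t) G (u + W t w) + \int[P]_(w in inside s t) M.
  by rewrite -RintegralD//; apply: eq_Rintegral => w _; rewrite E2.
by apply: (addIr (\int[P]_(w in inside s t) M)); rewrite -L -L'.
Qed.

End inside_events.

(** * Bounded convergence *)

Section bounded_convergence.
Context {R : realType} d (T : measurableType d) (P : {measure set T -> \bar R}).

Lemma bounded_cvg_Rintegral (D : set T) (Y_ : nat -> T -> R) (Y : T -> R) (M : R) :
  measurable D -> (P D < +oo)%E -> (forall n, measurable_fun D (Y_ n)) ->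
  (forall w, D w -> Y_ n w @[n --> \oo] --> Y w) ->
  (forall n w, D w -> `|Y_ n w| <= M) ->
  measurable_fun D Y /\ \int[P]_(w in D) Y_ n w @[n --> \oo] --> \int[P]_(w in D) Y w.
Proof.
move=> mD fD mY_ YY_ bY; have mY := measurable_fun_cvg mY_ YY_.
split => //.
have Ig : P.-integrable D (EFin \o (fun=> M)).
  apply: measurable_bounded_integrable => //.
  by exists `|M|; split; [exact: num_real|move=> y My x _; exact: ltW].
have mEY_ n : measurable_fun D (EFin \o Y_ n) by exact/measurable_EFinP.
have mEY : measurable_fun D (EFin \o Y) by exact/measurable_EFinP.
have cE : {ae P, forall w, D w -> (EFin \o Y_ n) w @[n --> \oo] --> (EFin \o Y) w}.
  by apply: aeW => w Dw; apply: cvg_EFin; [exact: nearW|exact: YY_].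
have bE : {ae P, forall w n, D w -> (`|(EFin \o Y_ n) w| <= (EFin \o (fun=> M)) w)%E}.
  by apply: aeW => w n Dw; rewrite /= lee_fin; exact: bY.
have [IY _ H] := dominated_convergence mD mEY_ mEY cE Ig bE.
have fin : (\int[P]_(w in D) (Y w)%:E)%E \is a fin_num by exact: integrable_fin_num.
by apply: fine_cvg; rewrite /Rintegral fineK.
Qed.

Lemma Rintegral_negligible (D N : set T) (Y : T -> R) (M : R) :
  measurable D -> (P D < +oo)%E -> measurable N -> P N = 0%E -> measurable_fun D Y ->
  (forall w, D w -> `|Y w| <= M) ->
  \int[P]_(w in D) Y w = \int[P]_(w in D `\` N) Y w.
Proof.
move=> mD fD mN N0 mY bY; rewrite /Rintegral; congr fine.
apply: negligible_integral => //.
apply: measurable_bounded_integrable => //.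
by exists M; split; [exact: num_real|move=> y My x Dx; exact: le_trans (bY x Dx) (ltW My)].
Qed.

End bounded_convergence.

(** * Optional stopping at the first exit *)

Section optional_stopping.
Context {R : realType} d (Omega : measurableType d) (P : probability Omega R).
Variable W : R -> {RV P >-> R}.
Hypothesis BM : standard_brownian_motion W.
Variables (T u s : R) (lo hi : R -> R).
Hypotheses (s0 : 0 <= s) (sT : s < T).
Hypotheses (clo : segment_continuous 0 T lo) (chi : segment_continuous 0 T hi).
Implicit Types (f : R -> R -> R) (S t r x : R) (w : Omega).

(** What optional stopping uses of a sum of heat potentials: it is a space-time
martingale along Brownian motion, bounded between the barriers, and it vanishes
at the terminal time between the barriers. *)
Record strip_potential (c : R) f : Prop := StripPotential {
  potential_bounded : forall S, S < T -> exists2 M, 0 <= M &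
    forall t x, 0 <= t <= S -> `|f x t| <= M ;
  potential_lipschitz : forall S, S < T -> exists2 B, 0 <= B &
    forall t t' x x', 0 <= t <= S -> 0 <= t' <= S ->
      `|f x' t' - f x t| <= B * (`|t' - t| + `|x' - x|) ;
  potential_semigroup : forall t t' x, 0 <= t -> t < t' -> t' < T ->
    \int[normal_prob 0 (Num.sqrt (t' - t))]_z f (x + z) t' = f x t ;
  potential_terminal : forall dl e, 0 < dl -> 0 < e -> exists2 eta, 0 < eta &
    forall t x, 0 <= t < T -> T - t < eta -> lo T + dl <= x <= hi T - dl -> `|f x t| <= e ;
  potential_strip : forall t x, 0 <= t < T -> lo t <= x <= hi t -> `|f x t| <= c }.

Let gap_ := @gap R d Omega P W u lo hi.
Let ins := @inside R d Omega P W u lo hi.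
Let A0 := ins s s.
Let tau w := first_hit s T (gap_ w).

Let mA0 : measurable A0.
Proof. by apply: (@measurable_inside R d Omega P W BM T u lo hi clo chi s s s0 (lexx s)); exact: ltW. Qed.

Let A0P w : A0 w <-> 0 < gap_ w s.
Proof.
split; first by apply; rewrite lexx.
by move=> H r /andP[r1 r2]; have -> : r = s by apply/eqP; rewrite eq_le r1 r2.
Qed.

Let cgap w : segment_continuous s T (gap_ w).
Proof. exact: (segment_continuousW 0 T s T _ s0 (lexx T) (@gap_continuous R d Omega P W BM T u lo hi clo chi w)). Qed.

Let tauP w : A0 w -> s < tau w /\
  (forall r, s <= r <= T -> r < tau w -> 0 < gap_ w r) /\
  (tau w <= T -> gap_ w (tau w) = 0).
Proof. by move=> /A0P H; exact: (first_hitP _ _ _ (ltW sT) (cgap w) H). Qed.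

Let ins_tau w t : A0 w -> s <= t <= T -> ins s t w <-> t < tau w.
Proof.
move=> Aw /andP[st tT]; have [t1 [t2 t3]] := tauP w Aw.
split=> [H|H r /andP[r1 r2]].
  rewrite ltNge; apply/negP => tt.
  have := H (tau w); rewrite ltW// tt => /(_ isT).
  by rewrite -/(gap_ w _) t3 ?ltxx// (le_trans tt).
by apply: t2; [rewrite r1 (le_trans r2)|exact: le_lt_trans H].
Qed.

Let ins_A0 t : s <= t -> ins s t `<=` A0.
Proof. by move=> st w H r /andP[r1 r2]; apply: H; rewrite r1 (le_trans r2). Qed.

(** The sum of the increments performed while a decreasing condition holds stops
at the first index where it fails. *)
Lemma telescope_stopped (a : nat -> R) (c : nat -> bool) (N : nat) :
  (forall k, c k.+1 -> c k) ->
  exists2 kap, (kap <= N)%N &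
    [/\ \sum_(k < N) (if c k then a k.+1 - a k else 0) = a kap - a 0%N,
        forall k, (k < kap)%N -> c k & (kap < N)%N -> ~~ c kap].
Proof.
move=> mono; elim: N => [|N [kap kN [IH1 IH2 IH3]]].
  by exists 0%N => //; split => //; rewrite big_ord0 subrr.
have monoN k i : c (k + i)%N -> c k.
  by elim: i => [|i IHi]; rewrite ?addn0// addnS => /mono.
move: kN; rewrite leq_eqVlt => /orP[/eqP kE|kN]; last first.
  exists kap; first by exact: leq_trans (ltnW kN) (leqnSn N).
  have ncN : ~~ c N.
    by apply: contra (IH3 kN) => cN; apply: (monoN _ (N - kap)%N); rewrite subnKC// ltnW.
  split => //; last by move=> _; exact: IH3.
  by rewrite big_ord_recr /= (negbTE ncN) addr0.
case cN : (c N).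
  exists N.+1 => //; split; last by rewrite ltnn.
    by rewrite big_ord_recr /= cN IH1 kE; ring.
  by move=> k; rewrite ltnS leq_eqVlt => /orP[/eqP ->//|kN]; apply: IH2; rewrite kE.
exists kap; first by rewrite kE.
split => //; last by rewrite kE cN.
by rewrite big_ord_recr /= cN addr0.
Qed.

Section one_potential.
Variables (c : R) (f : R -> R -> R).
Hypothesis sf : strip_potential c f.

Let phi w r := f (u + W r w) r.

Let continuous_f t : 0 <= t < T -> continuous (f ^~ t).
Proof.
move=> /andP[t0 tT] x; have [B B0 HB] := potential_lipschitz _ _ sf _ tT.
apply/cvgrPdist_le => e e0; have B1 : 0 < B + 1 by rewrite ltr_wpDl.
near=> y; rewrite distrC; apply: le_trans (HB t t x y _ _) _; rewrite ?t0 ?lexx//.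
rewrite subrr normr0 add0r; apply: (@le_trans _ _ ((B + 1) * `|y - x|)).
  by rewrite ler_wpM2r// lerDl.
rewrite mulrC -ler_pdivlMr// distrC; near: y.
by apply: cvgr_dist_le; [exact: cvg_id|exact: divr_gt0].
Unshelve. all: by end_near.
Qed.

Let measurable_phi t : 0 <= t < T -> measurable_fun setT (fun w => phi w t).
Proof.
move=> t0T; have mf : measurable_fun setT (f ^~ t).
  by apply: measurable_realfun.continuous_measurable_fun; exact: continuous_f.
apply: (measurableT_comp mf); apply: measurable_funD => //; exact: measurable_W.
Qed.

Let phi_continuous w S : S < T -> segment_continuous s S (phi w).
Proof.
move=> ST x /andP[sx xS] e e0.
have [B B0 HB] := potential_lipschitz _ _ sf _ ST.
have B1 : 0 < B + 1 by rewrite ltr_wpDl.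
have e20 : 0 < e / 2 / (B + 1) by rewrite !divr_gt0.
have [|d1 d10 H1] := @path_continuous R d Omega P W BM T w x _ _ e20.
  by rewrite (le_trans s0 sx) (le_trans xS (ltW ST)).
exists (Num.min d1 (e / 2 / (B + 1))); first by rewrite lt_min d10.
move=> y /andP[sy yS]; rewrite lt_min => /andP[yd1 ye].
have Hy := H1 y _ yd1; have {}Hy : `|W y w - W x w| < e / 2 / (B + 1).
  by apply: Hy; rewrite (le_trans s0 sy) (le_trans yS (ltW ST)).
apply: le_lt_trans (HB _ _ _ _ _ _) _.
- by rewrite (le_trans s0 sx).
- by rewrite (le_trans s0 sy).
rewrite (_ : u + W y w - (u + W x w) = W y w - W x w); last by ring.
apply: (@le_lt_trans _ _ ((B + 1) * (`|y - x| + `|W y w - W x w|))).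
  by rewrite ler_wpM2r ?addr_ge0// lerDl.
rewrite mulrC -ltr_pdivlMr//.
have -> : e / (B + 1) = e / 2 / (B + 1) + e / 2 / (B + 1) by field; rewrite gt_eqF.
exact: ltrD.
Qed.

(** Discrete stopping on a grid of mesh (S - s) / (N + 1): the increments before
the exit have mean zero by the Markov property, and the telescoped value is taken
within one mesh of the exit time, so that N can go to infinity. *)
Let stop_before S : s < S -> S < T ->
  measurable_fun A0 (fun w => phi w (Num.min (tau w) S)) /\
  \int[P]_(w in A0) phi w (Num.min (tau w) S) = \int[P]_(w in A0) phi w s.
Proof.
move=> sS ST; have [M M0 HM] := potential_bounded _ _ sf _ ST.
have Ss : 0 < S - s by rewrite subr_gt0.
pose t (N k : nat) : R := s + (S - s) * (k%:R / N.+1%:R).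
have tS N k : t N k.+1 = t N k + (S - s) / N.+1%:R by rewrite /t -natr1; ring.
have t0 N : t N 0%N = s by rewrite /t mul0r mulr0 addr0.
have tN N : t N N.+1 = S by rewrite /t divff ?mulr1 ?subrKC// pnatr_eq0.
have tlt N k : t N k < t N k.+1 by rewrite tS ltrDl divr_gt0// ltr0n.
have tle N j k : (j <= k)%N -> t N j <= t N k.
  by move=> jk; rewrite /t lerD2l ler_wpM2l ?(ltW Ss)// ler_wpM2r// ler_nat.
have tb N k : (k <= N.+1)%N -> s <= t N k <= S.
  by move=> kN; rewrite -{1}(t0 N) -(tN N) !tle.
pose Dl N k w := phi w (t N k.+1) - phi w (t N k).
pose Y N w := phi w s + \sum_(k < N.+1) (Dl N k \_ (ins s (t N k))) w.
have tk N k : (k <= N.+1)%N -> 0 <= t N k < T.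
  by move=> /(tb N)/andP[a1 a2]; rewrite (le_trans s0 a1) (le_lt_trans a2).
have mins N k : (k <= N.+1)%N -> measurable (ins s (t N k)).
  move=> kN; have /andP[a1 a2] := tb N k kN.
  apply: (@measurable_inside R d Omega P W BM T u lo hi clo chi); [exact: s0|exact: a1|exact: le_trans a2 (ltW ST)].
have mDl N k : (k < N.+1)%N -> measurable_fun setT (Dl N k).
  by move=> kN; apply: measurable_funB; apply: measurable_phi; apply: tk => //; exact: ltnW.
have mDr N k : (k < N.+1)%N -> measurable_fun setT (Dl N k \_ (ins s (t N k))).
  move=> kN; apply/(measurable_restrictT _ (mins N k (ltnW kN))).
  exact: measurable_funS (mDl N k kN).
have bDl N k w : (k < N.+1)%N -> `|Dl N k w| <= M + M.
  move=> kN; apply: le_trans (ler_normB _ _) _; apply: lerD; apply: HM.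
    by have /andP[a1 ->] := tb N k.+1 kN; rewrite (le_trans s0 a1).
  by have /andP[a1 ->] := tb N k (ltnW kN); rewrite (le_trans s0 a1).
have mY N : measurable_fun setT (Y N).
  apply: measurable_funD; first by apply: measurable_phi; rewrite s0.
  have : forall n, (n <= N.+1)%N -> measurable_fun setT
      (fun w => \sum_(k < n) (Dl N k \_ (ins s (t N k))) w).
    elim=> [_|n IH nN].
      by under eq_fun do rewrite big_ord0; exact: measurable_cst.
    under eq_fun do rewrite big_ord_recr /=.
    by apply: measurable_funD; [apply: IH; exact: ltnW|exact: mDr].
  by apply.
have path N w : A0 w -> exists2 q, s <= q <= S &
    Y N w = phi w q /\ `|q - Num.min (tau w) S| <= (S - s) / N.+1%:R.
  move=> Aw; have [tau1 _] := tauP w Aw.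
  have mono k : t N k.+1 < tau w -> t N k < tau w by exact: lt_trans (tlt N k).
  have [kap kN [E H1 H2]] := telescope_stopped (fun k => phi w (t N k))
    (fun k => t N k < tau w) N.+1 mono.
  exists (t N kap); first exact: tb.
  split.
    rewrite /Y; have -> : \sum_(k < N.+1) (Dl N k \_ (ins s (t N k))) w = phi w (t N kap) - phi w s.
      rewrite -{2}(t0 N) -E; apply: eq_bigr => k _; rewrite patchE.
      have kS : s <= t N k <= T.
        have /andP[-> /le_trans ->] // := tb N k (ltnW (ltn_ord k)); exact: ltW.
      case: ifPn => [|]; rewrite ?inE ?notin_setE => H.
        by rewrite (iffLR (ins_tau w _ Aw kS) H).
      by case: ifPn => // H'; exfalso; apply: H; exact/(ins_tau w _ Aw kS).
    by rewrite subrKC.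
  case: kap kN E H1 H2 => [|kap] kN _ H1 H2.
    by have := H2 isT; rewrite t0 tau1.
  have H3 := H1 kap (ltnSn _).
  have m1 : t N kap < Num.min (tau w) S.
    by rewrite lt_min H3 -(tN N); apply: lt_le_trans (tlt N kap) _; exact: tle.
  have m2 : Num.min (tau w) S <= t N kap.+1.
    move: kN; rewrite leq_eqVlt => /orP[/eqP ->|kN].
      by rewrite tN ge_min lexx orbT.
    by rewrite ge_min leNgt (H2 kN).
  by rewrite ger0_norm ?subr_ge0//; rewrite lerBlDr tS addrC lerD2l ltW.
have cvgY w : A0 w -> Y N w @[N --> \oo] --> phi w (Num.min (tau w) S).
  move=> Aw; have [tau1 _] := tauP w Aw.
  have qS : s <= Num.min (tau w) S <= S by rewrite le_min (ltW tau1) (ltW sS) ge_min lexx orbT.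
  apply/cvgrPdist_le => e e0; have [dl dl0 Hdl] := phi_continuous w S ST _ qS e e0.
  have [N0 HN0] : exists N0 : nat, (S - s) / dl < N0%:R.
    by exists (Num.bound ((S - s) / dl)); apply: archi_boundP; rewrite divr_ge0// ltW.
  exists N0 => // N /= N0N; have [q qs [-> qe]] := path N w Aw.
  rewrite distrC; apply: ltW; apply: Hdl => //; apply: le_lt_trans qe _.
  rewrite ltr_pdivrMr ?ltr0n// mulrC -ltr_pdivrMr//; apply: lt_le_trans HN0 _.
  by rewrite ler_nat leqW.
have bY N w : A0 w -> `|Y N w| <= M.
  by move=> Aw; have [q /andP[q1 q2] [-> _]] := path N w Aw; apply: HM; rewrite (le_trans s0 q1).
have [mL cvgI] := bounded_cvg_Rintegral _ _ P A0 Y _ M mA0 (le_lt_trans (probability_le1 P mA0) (ltry 1))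
  (fun N => measurable_funS measurableT (@subsetT _ _) (mY N)) cvgY bY.
split => //.
have intY N : \int[P]_(w in A0) Y N w = \int[P]_(w in A0) phi w s.
  have Is : P.-integrable A0 (EFin \o (fun w => phi w s)).
    apply: (bounded_integrable P A0 _ M) => //; first by apply: measurable_phi; rewrite s0.
    by move=> w _; apply: HM; rewrite s0 ltW.
  have Ik k : (k < N.+1)%N -> P.-integrable A0 (EFin \o (Dl N k \_ (ins s (t N k)))).
    move=> kN; apply: (bounded_integrable P A0 _ (M + M)) => //; first exact: mDr.
    move=> w _; rewrite patchE; case: ifP => _; first exact: bDl.
    by rewrite normr0 addr_ge0.
  have zero k : (k < N.+1)%N -> \int[P]_(w in A0) (Dl N k \_ (ins s (t N k))) w = 0.
    move=> kN; rewrite -Rintegral_mkcondr.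
    have /andP[a1 a2] := tb N k (ltnW kN); have /andP[b1 b2] := tb N k.+1 kN.
    rewrite setIidr; last exact: ins_A0.
    have mi := mins N k (ltnW kN).
    rewrite /Dl RintegralB//.
    - have tk1 := tk N k.+1 kN; have /andP[_ tk1T] := tk1.
      rewrite /phi (@inside_markov R d Omega P W BM T u lo hi clo chi s (t N k) (t N k.+1)
        (f ^~ (t N k.+1)) (f ^~ (t N k)) M) ?subrr//.
      + exact: le_trans a2 (ltW ST).
      + exact: continuous_f.
      + by apply: continuous_f; apply: tk; exact: ltnW.
      + by move=> x; apply: HM; rewrite (le_trans s0 b1).
      + by move=> x; apply: (potential_semigroup _ _ sf) => //; exact: le_trans a1.
    - apply: (bounded_integrable P _ _ M) => //; first by apply: measurable_phi; exact: tk.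
      by move=> w _; apply: HM; rewrite (le_trans s0 b1).
    - apply: (bounded_integrable P _ _ M) => //; first by apply: measurable_phi; apply: tk; exact: ltnW.
      by move=> w _; apply: HM; rewrite (le_trans s0 a1).
  suff H n : (n <= N.+1)%N -> P.-integrable A0 (EFin \o
      (fun w => phi w s + \sum_(k < n) (Dl N k \_ (ins s (t N k))) w)) /\
      \int[P]_(w in A0) (phi w s + \sum_(k < n) (Dl N k \_ (ins s (t N k))) w) =
      \int[P]_(w in A0) phi w s.
    by have [] := H N.+1 (leqnn _).
  elim: n => [_|n IH nN].
    have E : (fun w => phi w s + \sum_(k < 0) (Dl N k \_ (ins s (t N k))) w) = phi^~ s.
      by apply/funext => w; rewrite big_ord0 addr0.
    by rewrite E.
  have [IH1 IH2] := IH (ltnW nN).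
  have E : (fun w => phi w s + \sum_(k < n.+1) (Dl N k \_ (ins s (t N k))) w) =
     (fun w => (phi w s + \sum_(k < n) (Dl N k \_ (ins s (t N k))) w) + (Dl N n \_ (ins s (t N n))) w).
    by apply/funext => w; rewrite big_ord_recr /= addrA.
  split.
    rewrite E; have := integrableD mA0 IH1 (Ik n nN); exact: eq_integrable.
  rewrite E RintegralD//; last exact: Ik.
  by rewrite IH2 zero// addr0.
have := cvgI; under eq_fun do rewrite intY.
by move=> /(cvg_lim (@Rhausdorff R)) <-; exact: lim_cst.
Qed.

Definition terminal_null : set Omega := [set w | u + W T w = lo T \/ u + W T w = hi T].

Let Z w := if tau w < T then phi w (tau w) else 0.

(** Let S tend to T. Paths that exit before T have already stopped; the others
are inside at time T, up to the null event that they end on a barrier, and there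
the potential vanishes. *)
Lemma stop_terminal : measurable terminal_null -> P terminal_null = 0%E ->
  measurable_fun (A0 `\` terminal_null) Z /\
  \int[P]_(w in A0 `\` terminal_null) Z w = \int[P]_(w in A0) phi w s.
Proof.
move=> mN N0; have Ts : 0 < T - s by rewrite subr_gt0.
(* m.+2 keeps these times strictly after s *)
pose S (m : nat) : R := T - (T - s) / m.+2%:R.
have S1 m : s < S m.
  rewrite /S ltrBrDr -ltrBrDl ltr_pdivrMr ?ltr0n// ltr_pMr//.
  by rewrite (ltr_nat _ 1).
have S2 m : S m < T by rewrite /S ltrBlDr ltrDl divr_gt0// ltr0n.
have S3 e : 0 < e -> \forall m \near \oo, T - S m < e.
  move=> e0.
  have [N HN] : exists N : nat, (T - s) / e < N%:R.
    by exists (Num.bound ((T - s) / e)); apply: archi_boundP; rewrite divr_ge0// ltW.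
  exists N => // m /= Nm; rewrite /S subKr ltr_pdivrMr ?ltr0n// mulrC -ltr_pdivrMr//.
  by apply: lt_le_trans HN _; rewrite ler_nat (leq_trans Nm)// leqW.
pose Y m w := phi w (Num.min (tau w) (S m)).
have strip w r : A0 w -> s <= r -> r < T -> r <= tau w -> `|phi w r| <= c.
  move=> Aw sr rT; have [t1 [t2 t3]] := tauP w Aw.
  have g0 : r <= tau w -> 0 <= gap_ w r.
    rewrite le_eqVlt => /orP[/eqP rE|rt]; first by rewrite rE t3// -rE ltW.
    by apply: ltW; apply: t2 => //; rewrite sr ltW.
  move=> /g0 /le_gap; rewrite subr0 addr0 => /andP[h1 h2].
  apply: (potential_strip _ _ sf); first by rewrite (le_trans s0 sr).
  by apply/andP; split; lra.
have cS m := stop_before (S m) (S1 m) (S2 m).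
have mD : measurable (A0 `\` terminal_null) by exact: (measurableD mA0 mN).
have bY m w : A0 w -> `|Y m w| <= c.
  move=> Aw; have [t1 _] := tauP w Aw; apply: strip => //.
  - by rewrite le_min (ltW t1) ltW.
  - by rewrite gt_min S2 orbT.
  - by rewrite ge_min lexx.
have cvgY w : (A0 `\` terminal_null) w -> Y m w @[m --> \oo] --> Z w.
  move=> [Aw Nw]; have [t1 [t2 t3]] := tauP w Aw.
  rewrite /Z; case: ifPn => [tT|].
    apply: cvg_near_cst.
    have e0 : 0 < T - tau w by rewrite subr_gt0.
    have := S3 _ e0; apply: filterS => m; rewrite ltrD2l ltrN2 => H.
    by rewrite /Y min_l// ltW.
  rewrite -leNgt le_eqVlt => /orP[/eqP tE|tT].
    exfalso; apply: Nw; have := t3; rewrite -tE => /(_ (lexx _)).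
    rewrite /gap_ /gap /Num.min /=; case: ifP => _ /eqP; rewrite subr_eq0 => /eqP; [by left|].
    by move=> hE; right; rewrite hE.
  have gT : 0 < gap_ w T by apply: t2 => //; rewrite lexx ltW.
  apply/cvgrPdist_le => e e0; pose dl := gap_ w T / 2.
  have dl0 : 0 < dl by rewrite divr_gt0.
  have [eta eta0 Heta] := potential_terminal _ _ sf _ _ dl0 e0.
  have TT : 0 <= T <= T by rewrite lexx (le_trans s0 (ltW sT)).
  have [d1 d10 H1] := @path_continuous R d Omega P W BM T w T TT _ dl0.
  near=> m; rewrite sub0r normrN /Y min_r; last exact: le_trans (ltW (S2 m)) (ltW tT).
  have Sm0 : 0 <= S m by exact: le_trans s0 (ltW (S1 m)).
  apply: Heta; first by rewrite Sm0 S2.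
    by near: m; exact: S3.
  have : `|W (S m) w - W T w| < dl.
    apply: H1; first by rewrite Sm0 ltW.
    by rewrite distrC ger0_norm ?subr_ge0 ?(ltW (S2 m))//; near: m; exact: S3.
  rewrite ltr_norml => /andP[w1 w2].
  have : 2 * dl <= gap_ w T by rewrite /dl mulrC divfK.
  by move=> /le_gap /andP[g1 g2]; apply/andP; split; lra.
have [mZ cvgI] := bounded_cvg_Rintegral _ _ P _ Y Z c mD (le_lt_trans (probability_le1 P mD) (ltry 1))
  (fun m => measurable_funS mA0 (@subDsetl _ _ _) (cS m).1) cvgY (fun m w Dw => bY m w Dw.1).
split => //.
have E m : \int[P]_(w in A0 `\` terminal_null) Y m w = \int[P]_(w in A0) phi w s.
  rewrite -(cS m).2; apply/esym.
  by apply: (Rintegral_negligible _ _ P A0 terminal_null _ c mA0 (le_lt_trans (probability_le1 P mA0) (ltry 1)) mN N0 (cS m).1) => w; exact: bY.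
move: cvgI; under eq_fun do rewrite E.
by move=> /(cvg_lim (@Rhausdorff R)) <-; exact: lim_cst.
Unshelve. all: by end_near.
Qed.

End one_potential.

Definition inside_upto : set Omega := [set w | forall r, s <= r < T -> 0 < gap_ w r].

Lemma inside_uptoE : inside_upto = \bigcap_m ins s (T - (T - s) / m.+2%:R).
Proof.
have Ts : 0 < T - s by rewrite subr_gt0.
apply/seteqP; split=> w H.
  move=> m _ r /andP[r1 r2]; apply: H; rewrite r1; apply: le_lt_trans r2 _.
  by rewrite ltrBlDr ltrDl divr_gt0// ltr0n.
move=> r /andP[r1 r2].
have [N HN] : exists N : nat, (T - s) / (T - r) < N%:R.
  by exists (Num.bound ((T - s) / (T - r))); apply: archi_boundP; rewrite divr_ge0// ltW// subr_gt0.
apply: (H N I r); rewrite r1 /= lerBrDr -lerBrDl ler_pdivrMr ?ltr0n//.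
rewrite mulrC -ler_pdivrMr ?subr_gt0//; apply: le_trans (ltW HN) _.
by rewrite ler_nat leqW// leqW.
Qed.

Lemma measurable_inside_upto : measurable inside_upto.
Proof.
rewrite inside_uptoE; apply: bigcapT_measurable => m.
have Ts : 0 < T - s by rewrite subr_gt0.
apply: (@measurable_inside R d Omega P W BM T u lo hi clo chi) => //.
  rewrite lerBrDr -lerBrDl ler_pdivrMr ?ltr0n// ler_peMr ?(ltW Ts)//.
  by rewrite (ler_nat _ 1).
by rewrite lerBlDr lerDl divr_ge0// ltW.
Qed.

(** The stopped value is 0 without exit and tends to 1 with an exit, as the
stopping position is then on a barrier. *)
Lemma exit_probability_limit (c : R) (f_ : nat -> R -> R -> R) :
  (forall n, strip_potential c (f_ n)) ->
  (forall t x, 0 <= t < T -> x = hi t \/ x = lo t -> f_ n x t @[n --> \oo] --> (1 : R)) ->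
  measurable terminal_null -> P terminal_null = 0%E ->
  \int[P]_(w in A0) f_ n (u + W s w) s @[n --> \oo] --> fine (P (A0 `\` inside_upto)).
Proof.
move=> sf f1 mN N0.
pose Z n w := if tau w < T then f_ n (u + W (tau w) w) (tau w) else 0.
have stp n := stop_terminal c (f_ n) (sf n) mN N0.
pose D := A0 `\` terminal_null.
have mD : measurable D by exact: (measurableD mA0 mN).
have mI := measurable_inside_upto.
have out w : A0 w -> (~ inside_upto w) <-> tau w < T.
  move=> Aw; have [t1 [t2 t3]] := tauP w Aw; split=> [H|H H'].
    rewrite ltNge; apply/negP => Tt; apply: H => r /andP[r1 r2].
    by apply: t2; [rewrite r1 ltW|exact: lt_le_trans Tt].
  have := H' (tau w); rewrite (ltW t1) H => /(_ isT).
  by rewrite t3 ?ltxx// ltW.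
have cvgZ w : D w -> Z n w @[n --> \oo] --> (\1_(~` inside_upto) w : R).
  move=> [Aw Nw]; have [t1 [t2 t3]] := tauP w Aw; rewrite /Z.
  case: (boolP (tau w < T)) => tT; last first.
    rewrite indicE memNset; first exact: cvg_cst.
    by move=> /(out w Aw); rewrite (negbTE tT).
  rewrite indicE mem_set; last exact/(out w Aw).
  apply: f1; first by rewrite tT (le_trans s0 (ltW t1)).
  have := t3 (ltW tT); rewrite /gap_ /gap /Num.min /=.
  by case: ifP => _ /eqP; rewrite subr_eq0 => /eqP; [right|move=> ->; left].
have bZ n w : D w -> `|Z n w| <= `|c|.
  move=> [Aw _]; have [t1 [t2 t3]] := tauP w Aw; rewrite /Z.
  case: ifPn => tT; last by rewrite normr0.
  apply: le_trans (ler_norm c); apply: (potential_strip _ _ (sf n)).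
    by rewrite tT (le_trans s0 (ltW t1)).
  have : 0 <= gap_ w (tau w) by rewrite t3// ltW.
  by move=> /le_gap; rewrite subr0 addr0 => /andP[h1 h2]; apply/andP; split; lra.
have [mL cvgI] := bounded_cvg_Rintegral _ _ P D Z _ `|c| mD (le_lt_trans (probability_le1 P mD) (ltry 1)) (fun n => (stp n).1) cvgZ bZ.
have -> : fine (P (A0 `\` inside_upto)) = \int[P]_(w in D) \1_(~` inside_upto) w.
  rewrite /Rintegral integral_indic//; last exact: measurableC.
  congr fine; apply/eqP; rewrite eq_le; apply/andP; split.
    have -> : P (A0 `\` inside_upto) = P ((A0 `\` inside_upto) `\` terminal_null).
      rewrite [RHS]measureD//; [|exact: measurableD|by apply: le_lt_trans (probability_le1 P _) (ltry _); exact: measurableD].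
      have PN : P ((A0 `\` inside_upto) `&` terminal_null) = 0%E.
        apply: (subset_measure0 _ mN _ N0); last by move=> w [].
        by apply: measurableI => //; exact: measurableD.
      by rewrite [X in (_ - X)%E](PN : _) sube0.
    apply: le_measure; rewrite ?inE; [by apply: measurableD => //; exact: measurableD| |].
      by apply: measurableI => //; exact: measurableC.
    by move=> w [[a b] e]; split.
  apply: le_measure; rewrite ?inE; [by apply: measurableI => //; exact: measurableC|exact: measurableD|].
  by move=> w [a [b e]]; split.
have E n : \int[P]_(w in A0) f_ n (u + W s w) s = \int[P]_(w in D) Z n w.
  by rewrite -(stp n).2.
by under eq_fun do rewrite E.
Qed.

End optional_stopping.

(** * Gaussian integrals *)

Section gaussian_laws.
Context {R : realType}.
Implicit Types (G F : R -> R) (a b m s x y z : R).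
Notation leb := (@lebesgue_measure R).
Notation ncdf := (@normal_cdf R).

Lemma affine_substitution G a b y : 0 < a -> continuous G -> (forall x, 0 <= G x) ->
  (\int[leb]_(x in [set` `]-oo, (a * y + b)%R]]) (G x)%:E =
   \int[leb]_(x in [set` `]-oo, y]]) (G (a * x + b)%R * a)%:E)%E.
Proof.
move=> a0 cG G0; pose L x := a * x + b.
have dL x : is_derive x (1 : R) L a by exact: is_derive_affine.
have L' : derive1 L = fun=> a.
  by apply/funext => x; exact: is_derive_derive1.
have cL : continuous L by move=> x; apply: is_derive_continuous (dL x).
have E := @increasing_ge0_integration_by_substitutionNy R L G y.
rewrite /L in E *; rewrite E; last by move=> x _; exact: G0.
- by apply: eq_integral => x _; rewrite -[derive1 _]/(derive1 L) L'.
- by move=> x1 x2 _ _ x12; rewrite ltrD2r ltr_pM2l.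
- by rewrite -/L L' => x _; exact: cst_continuous.
- by rewrite -/L L'; exact: is_cvg_cst.
- by rewrite -/L L'; exact: cvg_cst.
- split; first by move=> x _; exact: @ex_derive _ _ _ _ _ _ _ (dL x).
  exact: cvg_at_left_filter (cL y).
- apply/cvgrNyPleNy; near=> A; near=> x.
  have : x <= (A - b) / a by near: x; apply: nbhs_ninfty_le; exact: num_real.
  by rewrite ler_pdivlMr// mulrC lerBrDr.
- exact: continuous_subspaceT.
Unshelve. all: by end_near.
Qed.

Lemma normal_pdf_affine m s x : 0 < s -> normal_pdf m s (s * x + m) * s = normal_pdf 0 1 x :> R.
Proof.
move=> s0; rewrite !normal_pdfE ?gt_eqF// /normal_peak /normal_fun.
have p0 : 0 < Num.sqrt (pi *+ 2) :> R by rewrite sqrtr_gt0 mulrn_wgt0// pi_gt0.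
rewrite subr0 addrK expr1n mul1r -mulrnAr sqrtrM ?sqr_ge0// sqrtr_sqr gtr0_norm//.
have -> : - (s * x) ^+ 2 / (s ^+ 2 *+ 2) = - x ^+ 2 / 2 :> R.
  by field; rewrite gt_eqF.
by field; rewrite !gt_eqF.
Qed.

Lemma normal_prob_ray m s y : 0 < s ->
  normal_prob m s [set` `]-oo, y]] = (ncdf ((y - m) / s))%:E.
Proof.
move=> s0; rewrite normal_cdfE /normal_prob.
have -> : y = s * ((y - m) / s) + m by field; rewrite gt_eqF.
rewrite affine_substitution//; last by move=> x; exact: normal_pdf_ge0.
  rewrite (_ : (s * ((y - m) / s) + m - m) / s = (y - m) / s); last by field; rewrite gt_eqF.
  by apply: eq_integral => x _; rewrite normal_pdf_affine.
by apply: continuous_normal_pdf; rewrite gt_eqF.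
Qed.

(** A normal law is dominated by the Lebesgue measure, with its density as
Radon-Nikodym derivative. *)
Lemma integral_normal_prob m s (U : set (measurableTypeR R)) F M : 0 < s ->
  measurable U -> measurable_fun setT (F : measurableTypeR R -> R) ->
  (forall x, U x -> `|F x| <= M) ->
  \int[normal_prob m s]_(x in U) F x = \int[leb]_(x in U) (F x * normal_pdf m s x).
Proof.
move=> s0 mU mF FM; rewrite /Rintegral; congr fine.
have I := bounded_integrable (normal_prob m s) U F M mU mF FM.
rewrite -(Radon_Nikodym_change_of_variables (normal_prob_dominates m s))//=.
have sN : s != 0 by rewrite gt_eqF.
have mpdf : measurable_fun setT (normal_pdf m s : measurableTypeR R -> R) by exact: measurable_normal_pdf.
apply: ae_eq_integral => //.
- apply: emeasurable_funM; first by apply/measurable_EFinP; exact: measurable_funS mF.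
  apply: (measurable_int leb).
  apply: (integrableS _ _ (@subsetT _ _)) => //=.
  by apply: Radon_Nikodym_integrable; exact: normal_prob_dominates.
- apply/measurable_EFinP; apply: measurable_funM; first exact: measurable_funS mF.
  exact: measurable_funS mpdf.
- rewrite (_ : (fun x => (F x * normal_pdf m s x)%:E) = (fun x => (F x)%:E * (normal_pdf m s x)%:E)%E); last first.
    by apply/funext => x; rewrite EFinM.
  apply: ae_eqe_mul2l => /=.
  rewrite Radon_NikodymE//=; first exact: normal_prob_dominates.
  move=> dom; case: cid => /= h [h1 h2 h3].
  apply: integral_ae_eq => //=.
  + exact: integrableS h2.
  + by apply/measurable_EFinP; exact: measurable_funS mpdf.
  + by move=> E EU mE; rewrite -h3.
Qed.

Lemma normal_pdf1N x : normal_pdf 0 1 (- x) = normal_pdf 0 1 x :> R.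
Proof. by rewrite !normal_pdf1E sqrrN. Qed.

(** The sum of both sides' variable parts has derivative zero, and its limit at
infinity is 1. *)
Lemma normal_cdfN x : ncdf (- x) = 1 - ncdf x.
Proof.
pose D y := ncdf (-1 * y + 0) + ncdf y.
have dD y : is_derive y (1 : R) D 0.
  have d1 := is_derive_comp_affine (-1) 0 ncdf y _ (is_derive_normal_cdf (-1 * y + 0)).
  apply: (is_derive_eq (is_derive_add _ _ _ _ _ d1 (is_derive_normal_cdf y))).
  by rewrite addr0 !mulN1r normal_pdf1N addNr.
have cD y z : y <= z -> D z = D y.
  move=> yz; apply/eqP; rewrite -subr_eq0 -normr_le0 -(mul0r (z - y)).
  by apply: (lipschitz_is_derive D (fun=> 0)) => // t _; rewrite normr0.
have D1 : D x = 1.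
  apply: (eq_of_small _ _ 2) => // e e0.
  have [A HA] := normal_cdf_cvgNy e e0; have [B HB] := normal_cdf_cvgy e e0.
  pose y := Num.max x (Num.max (- A) B).
  have yx : x <= y by rewrite le_max lexx.
  have yA : - y <= A by rewrite lerNl !le_max lexx !orbT.
  have yB : B <= y by rewrite !le_max lexx !orbT.
  rewrite -(cD _ _ yx) /D addr0 mulN1r.
  have := HA _ yA; have := HB _ yB; have := normal_cdf_ge0 (- y); have := normal_cdf_le1 y.
  by move=> *; rewrite ler_norml; apply/andP; split; lra.
by move: D1; rewrite /D addr0 mulN1r; lra.
Qed.

Lemma normal_prob_dirac m s x : 0 < s -> normal_prob m s [set x] = 0%E.
Proof.
move=> s0; have /null_content_dominatesP := normal_prob_dominates m s.
by apply => //; exact: lebesgue_measure_set1.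
Qed.

End gaussian_laws.

Section bivariate_normal.
Context {R : realType}.
Implicit Types (rho t T x y u v : R).
Notation leb := (@lebesgue_measure R).
Notation ncdf := (@normal_cdf R).

(** Completing the square: given the first coordinate [u], the second one is
normal with mean [rho * u] and variance [1 - rho ^ 2]. *)
Lemma binormal_pdf_disintegration rho u v : `|rho| < 1 ->
  (2 * pi * Num.sqrt (1 - rho ^+ 2))^-1 *
    expR (- ((u ^+ 2 + v ^+ 2 - 2 * rho * u * v) / (2 * (1 - rho ^+ 2)))) =
  normal_pdf 0 1 u * normal_pdf (rho * u) (Num.sqrt (1 - rho ^+ 2)) v.
Proof.
move=> rho1; have r2 : 0 < 1 - rho ^+ 2.
  by rewrite subr_gt0 -real_normK ?num_real// expr_lt1.
have s0 : 0 < Num.sqrt (1 - rho ^+ 2) by rewrite sqrtr_gt0.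
rewrite normal_pdf1E normal_pdfE ?gt_eqF// /normal_peak /normal_fun sqr_sqrtr ?ltW//.
have p0 : 0 < 2 * pi :> R by rewrite mulr_gt0// pi_gt0.
have -> : Num.sqrt ((1 - rho ^+ 2) * pi *+ 2) = Num.sqrt (1 - rho ^+ 2) * Num.sqrt (2 * pi).
  by rewrite -sqrtrM ?ltW//; congr Num.sqrt; ring.
rewrite mulrACA -expRD; congr (_ * expR _).
  by rewrite -invfM; congr _^-1; rewrite mulrCA -expr2 sqr_sqrtr ?ltW// mulrC.
by field; rewrite gt_eqF.
Qed.

Lemma binormal_cdfE x y rho : `|rho| < 1 ->
  binormal_cdf x y rho =
  \int[leb]_(u in [set` `]-oo, x]]) (ncdf ((y - rho * u) / Num.sqrt (1 - rho ^+ 2)) * normal_pdf 0 1 u).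
Proof.
move=> rho1; have r2 : 0 < 1 - rho ^+ 2.
  by rewrite subr_gt0 -real_normK ?num_real// expr_lt1.
have s0 : 0 < Num.sqrt (1 - rho ^+ 2) by rewrite sqrtr_gt0.
rewrite /binormal_cdf; apply: eq_Rintegral => u _.
under eq_Rintegral do rewrite binormal_pdf_disintegration//.
rewrite RintegralZl//; last first.
  apply: (@integrableS _ _ _ leb setT) => //.
  exact: integrable_normal_pdf.
by rewrite mulrC; congr (_ * _); exact: (congr1 fine (normal_prob_ray (rho * u) _ y s0)).
Qed.

(** Rescaling W_t to unit variance makes the correlation of W_t and W_T appear,
which is sqrt (t / T). *)
Lemma Rintegral_kern_ray sg t T v y : sg ^+ 2 = 1 -> 0 < t -> t < T ->
  \int[normal_prob 0 (Num.sqrt t)]_(x in [set` `]-oo, y]]) kern 0 sg (T - t) (v - x) =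
  binormal_cdf (y / Num.sqrt t) (sg * v / Num.sqrt T) (sg * Num.sqrt (t / T)).
Proof.
move=> sg2 t0 tT; have T0 : 0 < T by exact: lt_trans tT.
have st : 0 < Num.sqrt t by rewrite sqrtr_gt0.
have sT : 0 < Num.sqrt T by rewrite sqrtr_gt0.
have sTt : 0 < Num.sqrt (T - t) by rewrite sqrtr_gt0 subr_gt0.
have rho2 : (sg * Num.sqrt (t / T)) ^+ 2 = t / T.
  by rewrite exprMn sg2 mul1r sqr_sqrtr// divr_ge0// ltW.
have rho1 : `|sg * Num.sqrt (t / T)| < 1.
  by rewrite -(expr_lt1 (n := 2))// real_normK ?num_real// rho2 ltr_pdivrMr// mul1r.
have K b x : kern 0 sg b x = ncdf (sg / Num.sqrt b * x) by rewrite /kern expr0 mul1r.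
have cK : continuous (fun x => kern 0 sg (T - t) (v - x)).
  move=> x; have d := is_derive_comp_affine (-1) v _ x _ (is_derive_kern 0 sg (T - t) (-1 * x + v)).
  rewrite (_ : (fun x0 => _) = (fun y => kern 0 sg (T - t) (-1 * y + v))).
    exact: is_derive_continuous d.
  by apply/funext => z; rewrite mulN1r [- z + v]addrC.
rewrite (integral_normal_prob 0 _ _ _ 1 st (measurable_itv _)); last 2 first.
- exact: measurable_realfun.continuous_measurable_fun.
- by move=> x _; rewrite K ger0_norm ?normal_cdf_ge0// normal_cdf_le1.
rewrite (binormal_cdfE _ _ _ rho1).
have -> : y = Num.sqrt t * (y / Num.sqrt t) + 0 by field; rewrite gt_eqF.
have yE : (Num.sqrt t * (y / Num.sqrt t) + 0) / Num.sqrt t = y / Num.sqrt t by field; rewrite gt_eqF.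
rewrite yE /Rintegral (affine_substitution (fun x => kern 0 sg (T - t) (v - x) * normal_pdf 0 (Num.sqrt t) x))//.
- congr fine; apply: eq_integral => u _; congr (_%:E).
  rewrite -mulrA normal_pdf_affine// addr0 K; congr (ncdf _ * _).
  rewrite rho2 (_ : 1 - t / T = (T - t) / T); last by field; rewrite gt_eqF.
  rewrite !sqrtrM ?ltW ?subr_gt0// sqrtrV ?ltW//.
  by field; rewrite !gt_eqF.
- move=> x; apply: cvgM; first exact: cK.
  by apply: continuous_normal_pdf; rewrite gt_eqF.
- by move=> x; rewrite mulr_ge0 ?normal_pdf_ge0// K normal_cdf_ge0.
Qed.

End bivariate_normal.

(** * Marginals of Brownian motion and Gaussian convolution *)

Section brownian_marginals.
Context {R : realType} d (Omega : measurableType d) (P : probability Omega R).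
Variable W : R -> {RV P >-> R}.
Hypothesis BM : standard_brownian_motion W.
Implicit Types (t a h x y z : R) (F : R -> R).
Notation ncdf := (@normal_cdf R).

Lemma marginal_law t (B : set (measurableTypeR R)) : 0 < t -> measurable B ->
  P ((W t : Omega -> R) @^-1` B) = normal_prob 0 (Num.sqrt t) B.
Proof.
move=> t0 mB; have [W0 _ _ _] := BM.
have t0' : 0 <= (0 : R) < t by rewrite t0 andbT.
have := @increment_law R d Omega P W BM 0 t B t0' mB; rewrite subr0 => <-.
by congr (P _); apply/seteqP; split=> w; rewrite /= W0 subr0.
Qed.

Lemma Rintegral_marginal t (E : set (measurableTypeR R)) F M : 0 < t -> measurable E ->
  measurable_fun setT (F : measurableTypeR R -> R) -> (forall x, `|F x| <= M) ->
  \int[P]_(w in (W t : Omega -> R) @^-1` E) F (W t w) =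
  \int[normal_prob 0 (Num.sqrt t)]_(x in E) F x.
Proof.
move=> t0 mE mF FM.
have mW : measurable_fun setT (W t : Omega -> measurableTypeR R) by exact: (@measurable_W R d Omega P W t).
have mEF : measurable_fun setT (EFin \o F : measurableTypeR R -> \bar R) by exact/measurable_EFinP.
rewrite /Rintegral; congr fine.
transitivity (\int[pushforward P (W t : Omega -> measurableTypeR R)]_(x in E) (F x)%:E)%E.
  rewrite integral_pushforward//.
  apply: (bounded_integrable P _ (fun w => F (W t w)) M) => //.
    by rewrite -[X in measurable X]setTI; exact: mW.
  exact: (measurableT_comp mF).
apply: eq_measure_integral => B mB _; exact: marginal_law.
Qed.

Lemma measurable_normal_cdf_affine a y :
  measurable_fun setT ((fun z => ncdf ((y - z) / a)) : measurableTypeR R -> R).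
Proof.
apply: measurable_realfun.continuous_measurable_fun => z.
  apply: (is_derive_continuous _ _ (- (a)^-1 * normal_pdf 0 1 (- (a)^-1 * z + y / a))).
  have := is_derive_comp_affine (- (a)^-1) (y / a) ncdf z _ (is_derive_normal_cdf _).
  by under eq_fun do rewrite addrC mulNr [X in _ - X]mulrC -mulrBl.
Qed.

(** W_{h+a} is the sum of W_h and an independent increment of variance a; both
sides are the probability that it is at most y. *)
Lemma normal_cdf_convolution a h y : 0 < a -> 0 < h ->
  \int[normal_prob 0 (Num.sqrt h)]_z ncdf ((y - z) / Num.sqrt a) =
  ncdf (y / Num.sqrt (a + h)).
Proof.
move=> a0 h0; have [W0 _ _ _] := BM.
have sa : 0 < Num.sqrt a by rewrite sqrtr_gt0.
have hah : 0 <= h < h + a by rewrite (ltW h0) ltrDl.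
pose nu : probability (measurableTypeR R) R := normal_prob 0 (Num.sqrt a).
have mW r : measurable_fun setT (W r : Omega -> measurableTypeR R) by exact: (@measurable_W R d Omega P W r).
have mD : measurable_fun setT ((fun w => W (h + a) w - W h w) : Omega -> measurableTypeR R).
  exact: (measurable_funB (mW _) (mW _)).
have ind (C B : set (measurableTypeR R)) : measurable C -> measurable B ->
   P (setT `&` (W h : Omega -> R) @^-1` C `&` (fun w => W (h + a) w - W h w)%R @^-1` B) =
   (P (setT `&` (W h : Omega -> R) @^-1` C) * nu B)%E.
  move=> mC mB.
  pose tm (k : nat) : R := if k is i.+1 then (if i is _.+1 then h + a else h) else 0.
  pose D (k : nat) : set R := if k is i.+1 then C else setT.
  have htm : {homo tm : j k / (j <= k)%N >-> j <= k}.
    apply: homo_leq => [//|u v z|[|[|i]]]; first exact: le_trans.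
    - exact: ltW.
    - by case/andP: hah => _ /ltW.
    - by rewrite /tm.
  have mDk k : measurable (D k).
    by case: k => [|k]; [exact: measurableT|exact: mC].
  have law := @increment_law R d Omega P W BM h (h + a) B hah mB.
  rewrite (_ : h + a - h = a) in law; last by ring.
  have E : [set w | forall k, (k <= 1)%N -> D k (W (tm k) w)] = setT `&` (W h : Omega -> R) @^-1` C.
    apply/seteqP; split=> w; first by move=> H; split => //; exact: (H 1%N).
    by move=> [_ Cw] [|[|k]].
  have H := @cylinder_independent R d Omega P W BM 1 tm D B erefl htm mDk mB.
  by rewrite -E; apply: (eq_trans H); congr (_ * _)%E; exact: law.
pose F x : R := \1_([set` `]-oo, y]] : set R) x.
have mF : measurable_fun setT (F : measurableTypeR R -> R) by apply: measurable_indic; exact: measurable_itv.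
have F01 x : 0 <= F x <= 1 by rewrite /F indicE; case: (_ \in _); rewrite /= ?lexx ler01.
have key := @Rintegral_independent_increment R d Omega P nu setT measurableT
  (W h) (fun w => W (h + a) w - W h w) (mW h) mD ind F 1 mF F01.
have mray x : measurable ([set` `]-oo, x]] : set (measurableTypeR R)) by exact: measurable_itv.
have L : \int[P]_w F (W h w + (W (h + a) w - W h w)) = ncdf (y / Num.sqrt (a + h)).
  rewrite /Rintegral; under eq_integral do rewrite subrKC.
  have -> : (fun w => (F (W (h + a) w))%:E) =
            (fun w => (\1_((W (h + a) : Omega -> R) @^-1` [set` `]-oo, y]]) w : R)%:E).
    by apply/funext => w; rewrite /F !indicE.
  rewrite integral_indic//; last by rewrite -[X in measurable X]setTI; exact: mW.
  rewrite setIT; apply: (eq_trans (congr1 fine (marginal_law (h + a) _ (addr_gt0 h0 a0) (mray y)))).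
  have sah : 0 < Num.sqrt (h + a) by rewrite sqrtr_gt0 addr_gt0.
  by rewrite (normal_prob_ray 0 _ y sah) /= subr0 addrC.
rewrite -L key.
have E w : \int[nu]_z F (W h w + z) = ncdf ((y - W h w) / Num.sqrt a).
  rewrite /Rintegral.
  have -> : (fun z => (F (W h w + z))%:E) =
            (fun z => (\1_([set` `]-oo, (y - W h w)%R]] : set R) z : R)%:E).
    apply/funext => z; rewrite /F !indicE; congr (nat_of_bool _)%:R%:E.
    by apply/idP/idP; rewrite !inE /= !in_itv /= lerBrDl.
  rewrite integral_indic// setIT.
  by apply: (eq_trans (congr1 fine (normal_prob_ray 0 _ _ sa))); rewrite subr0.
transitivity (\int[P]_w (ncdf ((y - W h w) / Num.sqrt a))); last by apply: eq_Rintegral => w _; rewrite E.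
have mG : measurable_fun setT ((fun z => ncdf ((y - z) / Num.sqrt a)) : measurableTypeR R -> R).
  exact: measurable_normal_cdf_affine.
have := @Rintegral_marginal h setT (fun z => ncdf ((y - z) / Num.sqrt a)) 1 h0 measurableT mG.
rewrite preimage_setT => -> // x.
by rewrite ger0_norm ?normal_cdf_ge0// normal_cdf_le1.
Qed.

(** The case sg = -1 follows by passing to the complementary probability. *)
Lemma kern_convolution sg a h y : sg ^+ 2 = 1 -> 0 < a -> 0 < h ->
  \int[normal_prob 0 (Num.sqrt h)]_z kern 0 sg a (y - z) = kern 0 sg (a + h) y.
Proof.
move=> sg2 a0 h0; have K b x : kern 0 sg b x = ncdf (sg * (x / Num.sqrt b)).
  by rewrite /kern expr0 mul1r derive1n0; congr ncdf; ring.
under eq_Rintegral do rewrite K.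
rewrite K; have : (sg == 1) || (sg == -1) by rewrite -eqf_sqr expr1n sg2.
case/orP => /eqP ->.
  by under eq_Rintegral do rewrite mul1r; rewrite mul1r normal_cdf_convolution.
under eq_Rintegral do rewrite mulN1r normal_cdfN.
rewrite mulN1r normal_cdfN RintegralB//.
- rewrite normal_cdf_convolution// Rintegral_cst//.
  pose nu : probability (measurableTypeR R) R := normal_prob 0 (Num.sqrt h).
  rewrite (_ : fine _ = 1) ?mulr1//.
  exact: (congr1 fine (probability_setT nu)).
- by apply: (bounded_integrable _ _ (fun=> 1) 1) => // x _; rewrite normr1.
- apply: (bounded_integrable _ _ _ 1) => //.
    exact: measurable_normal_cdf_affine.
  by move=> x _; rewrite ger0_norm ?normal_cdf_ge0// normal_cdf_le1.
Qed.

End brownian_marginals.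

(** * The sum of the two potentials *)

Section two_potentials.
Context {R : realType} (T : R) (mu0 mu1 : @functional R).
Hypotheses (smu0 : schwartz_distribution mu0) (smu1 : schwartz_distribution mu1).
Hypotheses (cmu0 : compact (dist_support mu0)) (cmu1 : compact (dist_support mu1)).
Implicit Types (t x y : R) (j : nat).

(** Indexed by j like the kernels; the kernels are taken at v - x, so each space
derivative changes the sign and increments j. *)
Definition potential j t x : R :=
  heat_pot mu0 (-1) j (T - t) x + heat_pot mu1 1 j (T - t) x.

Let N1 : `|-1 : R| = 1. Proof. by rewrite normrN normr1. Qed.
Let P1 : `|1 : R| = 1. Proof. exact: normr1. Qed.
Let N2 : (-1 : R) ^+ 2 = 1. Proof. by rewrite sqrrN expr1n. Qed.
Let P2 : (1 : R) ^+ 2 = 1. Proof. exact: expr1n. Qed.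

Lemma U_potential x t : 0 <= t < T ->
  U_ T ord0 x t mu0 + U_ T ord_max x t mu1 = potential 0 t x.
Proof.
move=> tT; rewrite /U_ /= /U tT /potential /heat_pot /pairing_shift; congr (_ + _).
  congr (pairing mu0 _); apply/funext => v.
  by rewrite /kern expr0 mul1r derive1n0; congr normal_cdf; ring.
congr (pairing mu1 _); apply/funext => v.
by rewrite /kern expr0 mul1r derive1n0; congr normal_cdf; ring.
Qed.

Lemma potential_bound j S : S < T -> exists2 M, 0 <= M &
  forall t x, t <= S -> `|potential j t x| <= M.
Proof.
move=> ST; have e0 : 0 < T - S by rewrite subr_gt0.
have [M M0 HM] := heat_pot_bounded _ smu0 cmu0 (-1) j _ N1 e0.
have [M' M'0 HM'] := heat_pot_bounded _ smu1 cmu1 1 j _ P1 e0.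
exists (M + M'); first exact: addr_ge0.
move=> t x tS; apply: le_trans (ler_normD _ _) _.
by apply: lerD; [apply: HM|apply: HM']; rewrite lerD2l lerN2.
Qed.

Lemma potential_lip j S : S < T -> exists2 B, 0 <= B &
  forall t t' x x', t <= S -> t' <= S ->
    `|potential j t' x' - potential j t x| <= B * (`|t' - t| + `|x' - x|).
Proof.
move=> ST; have e0 : 0 < T - S by rewrite subr_gt0.
have [M M0 HM] := heat_pot_lipschitz _ smu0 cmu0 (-1) j _ N2 e0.
have [M' M'0 HM'] := heat_pot_lipschitz _ smu1 cmu1 1 j _ P2 e0.
exists (M + M'); first exact: addr_ge0.
move=> t t' x x' tS tS'.
have a1 : T - S <= T - t by rewrite lerD2l lerN2.
have a2 : T - S <= T - t' by rewrite lerD2l lerN2.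
have E : `|(T - t') - (T - t)| = `|t' - t|.
  by rewrite -normrN; congr `|_|; ring.
rewrite /potential opprD addrACA; apply: le_trans (ler_normD _ _) _.
rewrite mulrDl; apply: lerD.
  by have := HM _ _ x x' a1 a2; rewrite E.
by have := HM' _ _ x x' a1 a2; rewrite E.
Qed.

Lemma is_derive_potential j t x : t < T ->
  is_derive x (1 : R) (potential j t) (- potential j.+1 t x).
Proof.
move=> tT; have e0 : 0 < T - t by rewrite subr_gt0.
apply: (is_derive_eq (is_derive_add _ _ _ _ _ (is_derive_heat_pot _ smu0 cmu0 (-1) j _ x N1 e0)
  (is_derive_heat_pot _ smu1 cmu1 1 j _ x P1 e0))).
by rewrite /potential opprD.
Qed.

Lemma is_derive_potential_time j t x : t < T ->
  is_derive t (1 : R) (fun s => potential j s x) (- (2^-1 * potential j.+2 t x)).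
Proof.
move=> tT; have e0 : 0 < -1 * t + T by rewrite mulN1r addrC subr_gt0.
have d0 := is_derive_comp_affine (-1) T _ t _ (is_derive_heat_pot_time _ smu0 cmu0 (-1) j _ x N2 e0).
have d1 := is_derive_comp_affine (-1) T _ t _ (is_derive_heat_pot_time _ smu1 cmu1 1 j _ x P2 e0).
have d := is_derive_add _ _ _ _ _ d0 d1.
rewrite (_ : (fun s => _) = (fun s => heat_pot mu0 (-1) j (-1 * s + T) x + heat_pot mu1 1 j (-1 * s + T) x)).
  apply: (is_derive_eq d).
  by rewrite /potential (_ : -1 * t + T = T - t); ring.
by apply/funext => s; rewrite /potential (_ : T - s = -1 * s + T); last ring.
Qed.

Lemma continuous_potential j t : t < T -> continuous (potential j t).
Proof. by move=> tT x; exact: is_derive_continuous (is_derive_potential j t x tT). Qed.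

End two_potentials.

Section two_potentials_and_brownian_motion.
Context {R : realType} d (Omega : measurableType d) (P : probability Omega R).
Variable W : R -> {RV P >-> R}.
Hypothesis BM : standard_brownian_motion W.

(** Fubini moves the Gaussian average onto the kernel, where it is a
convolution. *)
Lemma heat_pot_semigroup (mu : @functional R) sg (a h x : R) :
  schwartz_distribution mu -> compact (dist_support mu) ->
  sg ^+ 2 = 1 -> `|sg| = 1 -> 0 < a -> 0 < h ->
  \int[normal_prob 0 (Num.sqrt h)]_z heat_pot mu sg 0 a (x + z) = heat_pot mu sg 0 (a + h) x.
Proof.
move=> smu cmu sg2 sg1 a0 h0.
pose nu : probability (measurableTypeR R) R := normal_prob 0 (Num.sqrt h).
pose kap y := kern 0 sg a (y - x).
have bk : bounded_smooth kap by apply: bounded_smooth_shift; exact: bounded_smooth_kern.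
have := pairing_smear _ smu cmu nu setT kap measurableT bk.
rewrite (_ : \int[nu]_(z in setT) pairing_shift mu kap z = \int[normal_prob 0 (Num.sqrt h)]_z heat_pot mu sg 0 a (x + z)); last first.
  apply: eq_Rintegral => z _; rewrite /heat_pot /pairing_shift /kap; congr (pairing mu _).
  by apply/funext => v; congr kern; ring.
move=> <-; rewrite /heat_pot /pairing_shift; congr (pairing mu _); apply/funext => v.
rewrite /smear /kap -(@kern_convolution R d Omega P W BM sg a h (v - x) sg2 a0 h0).
by apply: eq_Rintegral => z _; congr kern; ring.
Qed.

Variables (T : R) (lo hi : R -> R) (mu0 mu1 : @functional R) (c : R).
Hypotheses (smu0 : schwartz_distribution mu0) (smu1 : schwartz_distribution mu1).
Hypotheses (cmu0 : compact (dist_support mu0)) (cmu1 : compact (dist_support mu1)).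
Hypotheses (supp0 : dist_support mu0 `<=` `[hi T, +oo[) (supp1 : dist_support mu1 `<=` `]-oo, lo T]).
Hypothesis strip : forall t x, 0 <= t < T -> lo t <= x <= hi t -> `|potential T mu0 mu1 0 t x| <= c.

Let N1 : `|-1 : R| = 1. Proof. by rewrite normrN normr1. Qed.
Let P1 : `|1 : R| = 1. Proof. exact: normr1. Qed.
Let N2 : (-1 : R) ^+ 2 = 1. Proof. by rewrite sqrrN expr1n. Qed.
Let P2 : (1 : R) ^+ 2 = 1. Proof. exact: expr1n. Qed.

Lemma potential_strip_potential :
  strip_potential T lo hi c (fun x t => potential T mu0 mu1 0 t x).
Proof.
split=> //.
- move=> S ST; have [M M0 HM] := potential_bound T mu0 mu1 smu0 smu1 cmu0 cmu1 0 S ST.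
  by exists M => // t x /andP[_]; exact: HM.
- move=> S ST; have [M M0 HM] := potential_lip T mu0 mu1 smu0 smu1 cmu0 cmu1 0 S ST.
  by exists M => // t t' x x' /andP[_ tS] /andP[_ tS']; exact: HM.
- move=> t t' x t0 tt' t'T; rewrite /potential.
  have a0 : 0 < T - t' by rewrite subr_gt0.
  have h0 : 0 < t' - t by rewrite subr_gt0.
  have E : T - t = T - t' + (t' - t) by ring.
  have I mu sg : schwartz_distribution mu -> compact (dist_support mu) -> `|sg| = 1 ->
    (normal_prob 0 (Num.sqrt (t' - t))).-integrable setT
      (EFin \o (fun z => heat_pot mu sg 0 (T - t') (x + z))).
    move=> smu cmu sg1; have [M M0 HM] := heat_pot_bounded _ smu cmu sg 0 _ sg1 a0.
    apply: (bounded_integrable _ _ _ M) => //; last by move=> z _; exact: HM.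
    apply: measurable_realfun.continuous_measurable_fun => z.
    rewrite (_ : (fun z => _) = (fun z => heat_pot mu sg 0 (T - t') (1 * z + x))); last first.
      by apply/funext => z'; rewrite mul1r [z' + x]addrC.
    exact: is_derive_continuous (is_derive_comp_affine 1 x _ z _ (is_derive_heat_pot _ smu cmu sg 0 _ _ sg1 a0)).
  rewrite RintegralD//; [|exact: I|exact: I].
  rewrite (heat_pot_semigroup mu0 (-1) _ _ x smu0 cmu0 N2 N1 a0 h0).
  by rewrite (heat_pot_semigroup mu1 1 _ _ x smu1 cmu1 P2 P1 a0 h0) -E.
- move=> dl e dl0 e0; have e20 : 0 < e / 2 by rewrite divr_gt0.
  have [v Hv|eta0 eta00 H0] := heat_pot_terminal _ smu0 cmu0 (-1) (hi T) _ _ N1 dl0 e20.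
    by have := supp0 _ Hv; rewrite /= in_itv /= andbT; lra.
  have [v Hv|eta1 eta10 H1] := heat_pot_terminal _ smu1 cmu1 1 (lo T) _ _ P1 dl0 e20.
    by have := supp1 _ Hv; rewrite /= in_itv /=; lra.
  exists (Num.min eta0 eta1); first by rewrite lt_min eta00.
  move=> t x /andP[t0 tT]; rewrite lt_min => /andP[l0 l1] /andP[x1 x2].
  apply: le_trans (ler_normD _ _) _.
  have h0 := H0 (T - t) x; have h1 := H1 (T - t) x.
  have {}h0 : `|heat_pot mu0 (-1) 0 (T - t) x| <= e / 2.
    by apply: h0; [rewrite subr_gt0 tT|lra].
  have {}h1 : `|heat_pot mu1 1 0 (T - t) x| <= e / 2.
    by apply: h1; [rewrite subr_gt0 tT|lra].
  lra.
Qed.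

End two_potentials_and_brownian_motion.

Lemma big_ord2 (V : zmodType) (F : 'I_2 -> V) : \sum_(i < 2) F i = F ord0 + F ord_max.
Proof.
rewrite !big_ord_recl big_ord0 addr0; congr (_ + F _); exact: val_inj.
Qed.

(** * First and last exit of the strip *)

Section exit_laws.
Context {R : realType} d (Omega : measurableType d) (P : probability Omega R).
Variables (W : R -> {RV P >-> R}) (T : R) (g : 'I_2 -> R -> R).
Hypotheses (BM : standard_brownian_motion W) (T0 : 0 < T).
Hypothesis g_cont : forall i, {within `[0, T], continuous (g i)}.
Implicit Types (t u x y : R) (w : Omega).

Notation lo := (g ord_max).
Notation hi := (g ord0).

Let clo : segment_continuous 0 T lo. Proof. by apply/segment_continuousP; exact: g_cont. Qed.
Let chi : segment_continuous 0 T hi. Proof. by apply/segment_continuousP; exact: g_cont. Qed.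

Let mW t : measurable_fun setT (W t : Omega -> measurableTypeR R).
Proof. exact: (@measurable_W R d Omega P W t). Qed.

Let mpre t (C : set (measurableTypeR R)) : measurable C -> measurable ((W t : Omega -> R) @^-1` C).
Proof. by move=> mC; rewrite -[X in measurable X]setTI; exact: mW. Qed.

Lemma marginal_atom t x : 0 < t -> P ((W t : Omega -> R) @^-1` [set x]) = 0%E.
Proof.
move=> t0; have m1 : measurable ([set x] : set (measurableTypeR R)) by exact: measurable_set1.
apply: (eq_trans (@marginal_law R d Omega P W BM t _ t0 m1)).
by apply: normal_prob_dirac; rewrite sqrtr_gt0.
Qed.

Lemma null_terminal u : measurable (terminal_null d Omega P W T u lo hi) /\
  P (terminal_null d Omega P W T u lo hi) = 0%E.
Proof.
have E : terminal_null d Omega P W T u lo hi =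
    (W T : Omega -> R) @^-1` [set lo T - u] `|` (W T : Omega -> R) @^-1` [set hi T - u].
  apply/seteqP; split=> w /=.
    by move=> [|] H; [left|right]; rewrite -H; ring.
  by move=> [|] H; [left|right]; rewrite H; ring.
have m1 (x : R) : measurable ((W T : Omega -> R) @^-1` [set x]).
  by apply: mpre; exact: measurable_set1.
rewrite E; split; first exact: measurableU.
by apply: null_set_setU => //; exact: marginal_atom.
Qed.

(** By continuity a path that is not strictly inside at some time has met a
barrier by then. *)
Lemma exit_before_terminal u w : lo 0 < u < hi 0 ->
  tau T g W u w < T <-> ~ inside_upto d Omega P W T u 0 lo hi w.
Proof.
move=> u_in; have [W0 _ _ _] := BM.
pose h := @gap R d Omega P W u lo hi w.
have h0 : 0 < h 0 by apply/gap_gt0; rewrite W0 addr0.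
have ch : segment_continuous 0 T h by exact: (@gap_continuous R d Omega P W BM T u lo hi clo chi w).
have hit t : h t = 0 -> u + W t w = g ord0 t \/ u + W t w = g ord_max t.
  rewrite /h /gap /Num.min /=; case: ifP => _ /eqP; rewrite subr_eq0 => /eqP; first by right.
  by left.
have hit' t : u + W t w = g ord0 t \/ u + W t w = g ord_max t -> ~ 0 < h t.
  by move=> H /gap_gt0 /andP[]; case: H => ->; lra.
split=> [|H].
  rewrite /tau; case: eqP => [_|/eqP/set0P[t [/andP[t0 tT] ht]] _ H]; first by rewrite ltxx.
  by apply: (hit' t ht); apply: H; rewrite t0.
have [r [rT hr]] : exists r, 0 <= r < T /\ h r <= 0.
  apply: contrapT => H'; apply: H => r rT; rewrite ltNge; apply/negP => hr.
  by apply: H'; exists r.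
have /andP[r0 rT'] := rT.
have [t1 [t2 t3]] := first_hitP _ _ _ r0 (segment_continuousW 0 T 0 r _ (lexx 0) (ltW rT') ch) h0.
set q := first_hit 0 r h in t1 t2 t3.
have qr : q <= r.
  rewrite leNgt; apply/negP => rq; have := t2 r; rewrite lexx r0 => /(_ isT rq); lra.
have Aq : 0 <= q < T /\ (u + W q w = g ord0 q \/ u + W q w = g ord_max q).
  by split; [rewrite ltW//= (le_lt_trans qr)|exact: hit (t3 qr)].
rewrite /tau; case: eqP => [E|_].
  have : set0 q by rewrite -E.
  by [].
apply: le_lt_trans (le_lt_trans qr rT'); apply: ge_inf; last exact: Aq.
by exists 0 => y [/andP[]].
Qed.

Lemma exit_at_start u w : u = hi 0 \/ u = lo 0 -> tau T g W u w < T.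
Proof.
move=> hu; have [W0 _ _ _] := BM.
have A0 : 0 <= (0 : R) < T /\ (u + W 0 w = g ord0 0 \/ u + W 0 w = g ord_max 0).
  by rewrite W0 addr0 lexx T0.
rewrite /tau; case: eqP => [E|_].
  have : set0 (0 : R) by rewrite -E.
  by [].
apply: le_lt_trans T0; apply: ge_inf; last exact: A0.
by exists 0 => y [/andP[]].
Qed.

Lemma last_exitE t : 0 < t < T -> [set w | sigma T g W w <= t] =
  [set w | forall r, t < r <= T -> 0 < @gap R d Omega P W 0 lo hi w r].
Proof.
move=> /andP[t0 tT]; apply/seteqP; split=> w /=; rewrite /sigma; last first.
  move=> H; case: eqP => [_|/eqP/set0P ne]; first exact: ltW.
  apply: ge_sup => // r [/andP[r0 rT] hr]; rewrite leNgt; apply/negP => tr.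
  have := H r; rewrite tr rT => /(_ isT)/gap_gt0; rewrite add0r => /andP[].
  by case: hr; lra.
case: eqP => [E _ r /andP[tr rT]|_ H r /andP[tr rT]];
  rewrite ltNge; apply/negP => gr.
all: have Ar : 0 < r <= T /\ (g ord0 r <= W r w \/ W r w <= g ord_max r).
1,3: rewrite (lt_trans t0 tr) rT; split => //; move: gr; rewrite leNgt => /negP gr;
  case: (leP (g ord0 r) (W r w)) => h1; [by left|right; rewrite leNgt; apply/negP => h2];
  by apply: gr; apply/gap_gt0; rewrite add0r h2.
- by have : set0 r by rewrite -E.
- have : r <= t; last by move: tr; lra.
  by apply: le_trans H; apply: ub_le_sup => //; exists T => y [/andP[]].
Qed.

(** The interval ]t, T] is exhausted by segments that end at T. *)
Lemma measurable_last_exit t : 0 < t < T -> measurable [set w | sigma T g W w <= t].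
Proof.
move=> tT; rewrite last_exitE//; case/andP: tT => t0 tT.
pose s m := t + (T - t) / m.+1%:R.
have s1 m : 0 <= s m by rewrite addr_ge0 ?(ltW t0)// divr_ge0// subr_ge0 ltW.
have s2 m : s m <= T.
  by rewrite /s -lerBrDl ler_pdivrMr ?ltr0n// ler_peMr ?subr_ge0 ?(ltW tT)// (ler_nat _ 1).
rewrite (_ : [set w | _] = \bigcap_m @inside R d Omega P W 0 lo hi (s m) T).
  apply: bigcapT_measurable => m.
  exact: (@measurable_inside R d Omega P W BM T 0 lo hi clo chi (s m) T (s1 m) (s2 m) (lexx T)).
apply/seteqP; split=> w H.
  move=> m _ r /andP[r1 r2]; apply: H; rewrite r2 andbT; apply: lt_le_trans r1.
  by rewrite ltrDl divr_gt0// subr_gt0.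
move=> r /andP[r1 r2].
have [N HN] : exists N : nat, (T - t) / (r - t) < N%:R.
  by exists (Num.bound ((T - t) / (r - t))); apply: archi_boundP; rewrite divr_ge0// ltW// subr_gt0.
apply: (H N I r); rewrite r2 andbT /s -lerBrDl ler_pdivrMr ?ltr0n//.
rewrite mulrC -ler_pdivrMr ?subr_gt0//; apply: le_trans (ltW HN) _.
by rewrite ler_nat.
Qed.

(** The two events differ by a possible touch of the barriers at time t or at
time T, which has probability zero. *)
Lemma last_exit_prob t : 0 < t < T ->
  P [set w | sigma T g W w <= t] = P (inside_upto d Omega P W T 0 t lo hi).
Proof.
move=> tT; have mS := measurable_last_exit t tT.
have /andP[t0 tT'] := tT.
have mI := @measurable_inside_upto R d Omega P W BM T 0 t lo hi (ltW t0) tT' clo chi.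
have [mN N0] := null_terminal 0.
pose Nt := (W t : Omega -> R) @^-1` [set lo t] `|` (W t : Omega -> R) @^-1` [set hi t].
have mNt : measurable Nt by apply: measurableU; apply: mpre; exact: measurable_set1.
have Nt0 : P Nt = 0%E.
  have m1 (x : R) : measurable ((W t : Omega -> R) @^-1` [set x]).
    by apply: mpre; exact: measurable_set1.
  by apply: null_set_setU => //; exact: marginal_atom.
rewrite last_exitE// in mS *.
apply/eqP; rewrite eq_le; apply/andP; split.
  apply: (@le_trans _ _ (P (inside_upto d Omega P W T 0 t lo hi `|` Nt))); last first.
    by rewrite measureU0.
  apply: le_measure; rewrite ?inE//; first exact: measurableU.
  move=> w H; case: (EM (Nt w)) => [|nNt]; [by right|left].
  move=> r /andP[tr rT]; move: tr; rewrite le_eqVlt => /orP[/eqP <-|tr]; last first.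
    by apply: H; rewrite tr ltW.
  (* the path is weakly inside at time t by continuity, and off the barriers *)
  have ch : segment_continuous 0 T (@gap R d Omega P W 0 lo hi w).
    exact: (@gap_continuous R d Omega P W BM T 0 lo hi clo chi w).
  have tb : 0 <= t <= T by rewrite !ltW.
  have g0 : 0 <= @gap R d Omega P W 0 lo hi w t.
    apply: (segment_continuous_ge0 0 T _ t ch tb) => dl dl0.
    pose q := Num.min T (t + dl / 2).
    have tq : t < q by rewrite lt_min tT' ltrDl divr_gt0.
    have qT : q <= T by rewrite ge_min lexx.
    have qd : q <= t + dl / 2 by rewrite ge_min lexx orbT.
    exists q; first by rewrite qT (le_trans (ltW t0) (ltW tq)).
    split; last by apply: H; rewrite tq.
    by rewrite ger0_norm ?subr_ge0 ?(ltW tq)//; lra.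
  move: g0 => /le_gap; rewrite !subr0 addr0 => /andP[h1 h2].
  apply/gap_gt0; rewrite add0r !lt_neqAle h1 h2 !andbT; apply/andP; split; apply/eqP => E.
    by apply: nNt; left.
  by apply: nNt; right.
apply: (@le_trans _ _ (P ([set w | forall r, t < r <= T -> 0 < @gap R d Omega P W 0 lo hi w r] `|` terminal_null d Omega P W T 0 lo hi))); last first.
  by rewrite measureU0.
apply: le_measure; rewrite ?inE//; first exact: measurableU.
move=> w H; case: (EM (terminal_null d Omega P W T 0 lo hi w)) => [|nN]; [by right|left].
move=> r /andP[tr]; rewrite le_eqVlt => /orP[/eqP ->|rT]; last by apply: H; rewrite rT ltW.
have ch : segment_continuous 0 T (@gap R d Omega P W 0 lo hi w).
  exact: (@gap_continuous R d Omega P W BM T 0 lo hi clo chi w).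
have tb : 0 <= T <= T by rewrite lexx ltW.
have g0 : 0 <= @gap R d Omega P W 0 lo hi w T.
  apply: (segment_continuous_ge0 0 T _ T ch tb) => dl dl0.
  pose q := Num.max t (T - dl / 2).
  have qT : q < T by rewrite gt_max tT' ltrBlDr ltrDl divr_gt0.
  have tq : t <= q by rewrite le_max lexx.
  have qd : T - dl / 2 <= q by rewrite le_max lexx orbT.
  exists q; first by rewrite (ltW qT) (le_trans (ltW t0) tq).
  split; last by apply: H; rewrite tq.
  by rewrite ler0_norm ?subr_le0 ?(ltW qT)//; lra.
move: g0 => /le_gap; rewrite !subr0 addr0 => /andP[h1 h2].
apply/gap_gt0; rewrite add0r !lt_neqAle h1 h2 !andbT; apply/andP; split; apply/eqP => E.
  by apply: nN; left; rewrite add0r.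
by apply: nN; right; rewrite add0r.
Qed.

Section potentials.
Variable mu : 'I_2 -> nat -> @functional R.
Hypotheses (smu : forall i n, schwartz_distribution (mu i n))
  (cmu : forall i n, compact (dist_support (mu i n)))
  (supp0 : forall n, dist_support (mu ord0 n) `<=` `[g ord0 T, +oo[)
  (supp1 : forall n, dist_support (mu ord_max n) `<=` `]-oo, g ord_max T]).
Variable c : R.
Hypotheses
  (boundary : forall t x, 0 <= t < T -> x = g ord0 t \/ x = g ord_max t ->
     (\sum_(i < 2) U_ T i x t (mu i n)) @[n --> \oo] --> (1 : R))
  (bounded : forall n i t x, 0 <= t < T -> g ord_max t <= x <= g ord0 t ->
     `|U_ T i x t (mu i n)| <= c).

Notation f n := (potential T (mu ord0 n) (mu ord_max n)).

Lemma strip_potentials n : strip_potential T lo hi (c + c) (fun x t => f n 0%N t x).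
Proof.
apply: (@potential_strip_potential R d Omega P W BM T lo hi (mu ord0 n) (mu ord_max n)) => //.
move=> t x tT xs; rewrite -U_potential//; apply: le_trans (ler_normD _ _) _.
by apply: lerD; exact: bounded.
Qed.

Lemma boundary_potential t x : 0 <= t < T -> x = hi t \/ x = lo t ->
  f n 0%N t x @[n --> \oo] --> (1 : R).
Proof.
move=> tT xs; have := boundary t x tT xs.
by under eq_fun do rewrite big_ord2 U_potential//.
Qed.

Lemma exit_probability u : lo 0 <= u <= hi 0 ->
  (\sum_(i < 2) U_ T i u 0 (mu i n)) @[n --> \oo] --> fine (P [set w | tau T g W u w < T]).
Proof.
move=> /andP[]; rewrite le_eqVlt => /orP[/eqP E _|ul].
  rewrite (_ : [set w | _] = setT); last by apply/seteqP; split=> // w _; apply: exit_at_start; right.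
  by rewrite probability_setT; apply: boundary; [rewrite lexx|right].
rewrite le_eqVlt => /orP[/eqP E|uh].
  rewrite (_ : [set w | _] = setT); last by apply/seteqP; split=> // w _; apply: exit_at_start; left.
  by rewrite probability_setT; apply: boundary; [rewrite lexx|left].
have u_in : lo 0 < u < hi 0 by rewrite ul.
have T0' : 0 <= (0 : R) < T by rewrite lexx.
under eq_fun do rewrite big_ord2 U_potential//.
have [mN N0] := null_terminal u.
have [W0 _ _ _] := BM.
have := @exit_probability_limit R d Omega P W BM T u 0 lo hi (lexx 0) T0 clo chi (c + c)
  (fun n x t => f n 0%N t x) strip_potentials boundary_potential mN N0.
have A0 : inside d Omega P W u lo hi 0 0 = setT.
  apply/seteqP; split=> // w _ r r0; apply/gap_gt0.
  have -> : r = 0 by apply/eqP; rewrite eq_le andbC.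
  by rewrite W0 addr0.
rewrite A0 (_ : [set w | _] = setT `\` inside_upto d Omega P W T u 0 lo hi).
  suff E n : \int[P]_w f n 0%N 0 (u + W 0 w) = f n 0%N 0 u by under eq_fun do rewrite E.
  under eq_Rintegral do rewrite W0 addr0.
  have P1 : fine (P setT) = 1 by rewrite probability_setT.
  by apply: (eq_trans _ (mulr1 _)); rewrite Rintegral_cst//; congr (_ * _); exact: P1.
apply/seteqP; split=> w /=; first by move=> /(exit_before_terminal u w u_in).
by move=> [_ /(exit_before_terminal u w u_in)].
Qed.

(** Since 1 - f is, up to the limit, the conditional probability of staying
inside during the rest of the time interval, integrating it against the law
of the position at time [t] gives the law of the last exit. *)
Lemma last_exit_limit t : 0 < t < T ->
  \int[normal_prob 0 (Num.sqrt t)]_(x in [set` `]lo t, hi t]]) (1 - f n 0%N t x) @[n --> \oo] -->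
  fine (P [set w | sigma T g W w <= t]).
Proof.
move=> tT; have /andP[t0 tT'] := tT.
have [mN N0] := null_terminal 0.
have t0T : 0 <= t < T by rewrite (ltW t0).
have H := @exit_probability_limit R d Omega P W BM T 0 t lo hi (ltW t0) tT' clo chi (c + c)
  (fun n x t => f n 0%N t x) strip_potentials boundary_potential mN N0.
have mI := @measurable_inside_upto R d Omega P W BM T 0 t lo hi (ltW t0) tT' clo chi.
set A0 := inside d Omega P W 0 lo hi t t in H.
have A0E : A0 = (W t : Omega -> R) @^-1` [set` `]lo t, hi t[].
  apply/seteqP; split=> w.
    move=> /(_ t); rewrite lexx => /(_ isT)/gap_gt0.
    by rewrite add0r /= in_itv.
  rewrite /= in_itv /= => wt r /andP[r1 r2]; have -> : r = t by apply/eqP; rewrite eq_le r1 r2.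
  by apply/gap_gt0; rewrite add0r.
have mA0 : measurable A0 by rewrite A0E; apply: mpre; exact: measurable_itv.
have PI : fine (P [set w | sigma T g W w <= t]) =
    fine (P A0) - fine (P (A0 `\` inside_upto d Omega P W T 0 t lo hi)).
  rewrite last_exit_prob//.
  have -> : inside_upto d Omega P W T 0 t lo hi = A0 `&` inside_upto d Omega P W T 0 t lo hi.
    apply/seteqP; split=> w; last by case.
    move=> Hw; split=> // r /andP[r1 r2]; apply: Hw; rewrite r1 /=; exact: le_lt_trans r2 tT'.
  rewrite setDIr setDv set0U; set I := inside_upto _ _ _ _ _ _ _ _ _.
  have -> : fine (P A0) = fine (P (A0 `\` I)) + fine (P (A0 `&` I)).
    rewrite -fineD ?fin_num_measure//; [|exact: measurableD|exact: measurableI].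
    by congr fine; exact: measureDI.
  by rewrite addrAC subrr add0r.
rewrite PI.
have E n : \int[normal_prob 0 (Num.sqrt t)]_(x in [set` `]lo t, hi t]]) (1 - f n 0%N t x) =
    fine (P A0) - \int[P]_(w in A0) f n 0%N t (0 + W t w).
  have [M M0 HM] := potential_bound T _ _ (smu ord0 n) (smu ord_max n) (cmu ord0 n) (cmu ord_max n) 0 _ tT'.
  have fM x : `|f n 0%N t x| <= M by exact: HM.
  have mf : measurable_fun setT (f n 0%N t : measurableTypeR R -> R).
    apply: measurable_realfun.continuous_measurable_fun.
    exact: (continuous_potential T _ _ (smu ord0 n) (smu ord_max n) (cmu ord0 n) (cmu ord_max n)).
  have mF : measurable_fun setT ((fun x => 1 - f n 0%N t x) : measurableTypeR R -> R).
    by apply: measurable_funB => //; exact: measurable_cst.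
  have FM x : `|1 - f n 0%N t x| <= 1 + M.
    by apply: le_trans (ler_normB _ _) _; rewrite normr1 lerD2l.
  have mE : measurable ([set` `]lo t, hi t]] : set (measurableTypeR R)) by exact: measurable_itv.
  rewrite -(@Rintegral_marginal R d Omega P W BM t _ _ (1 + M) t0 mE mF FM).
  have mD := mpre t _ mE.
  have m1 : measurable ((W t : Omega -> R) @^-1` [set hi t]).
    by apply: mpre; exact: measurable_set1.
  have mFW : measurable_fun setT (fun w => 1 - f n 0%N t (W t w)) by exact: (measurableT_comp mF).
  have mfW : measurable_fun setT (fun w => f n 0%N t (W t w)) by exact: (measurableT_comp mf).
  rewrite (Rintegral_negligible _ _ P _ _ _ (1 + M) mD (le_lt_trans (probability_le1 P mD) (ltry 1)) m1 (marginal_atom t _ t0) (measurable_funTS mFW) (fun w _ => FM (W t w))).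
  rewrite (_ : _ `\` _ = A0); last first.
    rewrite A0E; apply/seteqP; split=> w /=; rewrite !in_itv /=.
      by move=> [/andP[-> h1] h2]; rewrite lt_neqAle h1 andbT; apply/eqP.
    move=> /andP[-> h1]; split; first exact: ltW.
    by move=> h2; move: h1; rewrite h2 ltxx.
  have I1 : P.-integrable A0 (EFin \o (fun=> 1)).
    by apply: (bounded_integrable P A0 (fun=> 1) 1 mA0) => // w _; rewrite normr1.
  have I2 : P.-integrable A0 (EFin \o (fun w => f n 0%N t (W t w))).
    exact: (bounded_integrable P A0 _ M mA0 mfW (fun w _ => fM (W t w))).
  have C1 : \int[P]_(w in A0) 1 = fine (P A0) by apply: (eq_trans (Rintegral_cst P mA0 1)); exact: mul1r.
  have C2 : \int[P]_(w in A0) f n 0%N t (0 + W t w) = \int[P]_(w in A0) f n 0%N t (W t w).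
    by apply: eq_Rintegral => w _; rewrite add0r.
  by rewrite C2 -C1; exact: RintegralB.
under eq_fun do rewrite E.
by apply: cvgB; [exact: cvg_cst|exact: H].
Qed.

End potentials.
End exit_laws.

(** * The bivariate normal expression *)

Section binormal_expression.
Context {R : realType}.
Implicit Types (t x y : R).

Lemma Rintegral_heat_pot_ray (mu : @functional R) sg t T y (a : R -> R) rho :
  schwartz_distribution mu -> compact (dist_support mu) ->
  sg ^+ 2 = 1 -> `|sg| = 1 -> 0 < t -> t < T ->
  (forall v, a v = sg * v / Num.sqrt T) -> rho = sg * Num.sqrt (t / T) ->
  \int[normal_prob 0 (Num.sqrt t)]_(x in [set` `]-oo, y]]) heat_pot mu sg 0 (T - t) x =
  pairing mu (fun v => binormal_cdf (y / Num.sqrt t) (a v) rho).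
Proof.
move=> smu cmu sg2 sg1 t0 tT aE ->; have Tt : 0 < T - t by rewrite subr_gt0.
have my : measurable ([set` `]-oo, y]] : set (measurableTypeR R)) by exact: measurable_itv.
rewrite /heat_pot -(pairing_smear _ smu cmu (normal_prob 0 (Num.sqrt t)) _ _ my (bounded_smooth_kern 0 sg _ sg1 Tt)).
by congr (pairing mu _); apply/funext => v; rewrite aE; exact: Rintegral_kern_ray.
Qed.

(** The strip is the difference of two rays, and on a ray each potential
integrates to a pairing with a bivariate normal distribution function. *)
Lemma Rintegral_potential_strip (mu : 'I_2 -> @functional R) (y : 'I_2 -> R) t T :
  (forall i, schwartz_distribution (mu i)) -> (forall i, compact (dist_support (mu i))) ->
  0 < t -> t < T -> y ord_max <= y ord0 ->
  \int[normal_prob 0 (Num.sqrt t)]_(x in [set` `]y ord_max, y ord0]])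
     (1 - potential T (mu ord0) (mu ord_max) 0 t x) =
  \sum_(i < 2) (-1) ^+ i *
    (normal_cdf (y i / Num.sqrt t)
     - pairing (mu ord0) (fun v => binormal_cdf (y i / Num.sqrt t)
                            (- v / Num.sqrt T) (- Num.sqrt (t / T)))
     - pairing (mu ord_max) (fun v => binormal_cdf (y i / Num.sqrt t)
                            (v / Num.sqrt T) (Num.sqrt (t / T)))).
Proof.
move=> smu cmu t0 tT y10; have Tt : 0 < T - t by rewrite subr_gt0.
have st : 0 < Num.sqrt t by rewrite sqrtr_gt0.
pose nu : probability (measurableTypeR R) R := normal_prob 0 (Num.sqrt t).
pose F x := 1 - potential T (mu ord0) (mu ord_max) 0 t x.
have mray z : measurable ([set` `]-oo, z]] : set (measurableTypeR R)) by exact: measurable_itv.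
have IH m (sg : R) E : schwartz_distribution m -> compact (dist_support m) -> `|sg| = 1 ->
    measurable E -> nu.-integrable E (EFin \o (heat_pot m sg 0 (T - t))).
  move=> sm cm sg1 mE; have [M M0 HM] := heat_pot_bounded _ sm cm sg 0 _ sg1 Tt.
  apply: (bounded_integrable nu E _ M mE) => [|x _]; last exact: HM.
  apply: measurable_realfun.continuous_measurable_fun => x.
  exact: is_derive_continuous (is_derive_heat_pot _ sm cm sg 0 _ x sg1 Tt).
have I1 (E : set (measurableTypeR R)) : measurable E -> nu.-integrable E (EFin \o (fun=> 1)).
  by move=> mE; apply: (bounded_integrable nu E (fun=> 1) 1 mE) => // x _; rewrite normr1.
have N1 : `|-1 : R| = 1 by rewrite normrN normr1.
have N2 : (-1 : R) ^+ 2 = 1 by rewrite sqrrN expr1n.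
have IP E : measurable E -> nu.-integrable E (EFin \o potential T (mu ord0) (mu ord_max) 0 t).
  move=> mE.
  have := integrableD mE (IH _ _ _ (smu ord0) (cmu ord0) N1 mE) (IH _ _ _ (smu ord_max) (cmu ord_max) (normr1 R) mE).
  exact: eq_integrable.
pose B z := normal_cdf (z / Num.sqrt t)
     - pairing (mu ord0) (fun v => binormal_cdf (z / Num.sqrt t)
                            (- v / Num.sqrt T) (- Num.sqrt (t / T)))
     - pairing (mu ord_max) (fun v => binormal_cdf (z / Num.sqrt t)
                            (v / Num.sqrt T) (Num.sqrt (t / T))).
have ray z : \int[nu]_(x in [set` `]-oo, z]]) F x = B z.
  have C1 : \int[nu]_(x in [set` `]-oo, z]]) 1 = normal_cdf (z / Num.sqrt t).
    apply: (eq_trans (Rintegral_cst nu (mray z) 1)); rewrite mul1r.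
    by apply: (eq_trans (congr1 fine (normal_prob_ray 0 _ z st))); rewrite subr0.
  have aN v : - v / Num.sqrt T = -1 * v / Num.sqrt T by rewrite mulN1r.
  have aP v : v / Num.sqrt T = 1 * v / Num.sqrt T by rewrite mul1r.
  have rhoN : - Num.sqrt (t / T) = -1 * Num.sqrt (t / T) by rewrite mulN1r.
  have rhoP : Num.sqrt (t / T) = 1 * Num.sqrt (t / T) by rewrite mul1r.
  have H0 := Rintegral_heat_pot_ray _ (-1) t T z (fun v => - v / Num.sqrt T) (- Num.sqrt (t / T)) (smu ord0) (cmu ord0) N2 N1 t0 tT aN rhoN.
  have H1 := Rintegral_heat_pot_ray _ 1 t T z (fun v => v / Num.sqrt T) (Num.sqrt (t / T)) (smu ord_max) (cmu ord_max) (expr1n R 2) (normr1 R) t0 tT aP rhoP.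
  rewrite /B -C1 -addrA -opprD.
  transitivity (\int[nu]_(x in [set` `]-oo, z]]) 1 - \int[nu]_(x in [set` `]-oo, z]]) potential T (mu ord0) (mu ord_max) 0 t x).
    exact: (RintegralB (mray z) (I1 _ (mray z)) (IP _ (mray z))).
  congr (_ - _).
  apply: (eq_trans (RintegralD (mray z) (IH _ _ _ (smu ord0) (cmu ord0) N1 (mray z)) (IH _ _ _ (smu ord_max) (cmu ord_max) (normr1 R) (mray z)))).
  exact: (f_equal2 +%R H0 H1).
transitivity (B (y ord0) - B (y ord_max)); last first.
  by rewrite big_ord2; congr (_ + _); [exact/esym/mul1r|exact/esym/mulN1r].
move: B ray => B ray; rewrite -!ray.
apply/eqP; rewrite -subr_eq addrC opprK; apply/eqP.
have IF E : measurable E -> nu.-integrable E (EFin \o F).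
  by move=> mE; have := integrableB mE (I1 _ mE) (IP _ mE); exact: eq_integrable.
have mI : measurable ([set` `]y ord_max, y ord0]] : set (measurableTypeR R)) by exact: measurable_itv.
have UE : [set` `]-oo, y ord0]] = [set` `]-oo, y ord_max]] `|` [set` `]y ord_max, y ord0]] :> set R.
  apply/seteqP; split=> x; rewrite /= !in_itv /=.
    by move=> xy; case: (leP x (y ord_max)) => h; [left|right].
  by move=> [/le_trans ->//|/andP[]].
rewrite UE; apply/esym; apply: (Rintegral_setU (mray _) mI); first by rewrite -UE; exact: IF.
by apply/disj_setPLR => x; rewrite /= !in_itv /= => xy; rewrite ltNge xy.
Qed.

End binormal_expression.

(** * Differentiating an integral with a moving endpoint *)

Section bounded_lipschitz.
Context {R : realType}.
Variables (e S : R).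
Implicit Types (phi psi : R -> R -> R) (t x c M : R).

(** Closed under products, unlike mere Lipschitz continuity; it holds for the
kernels and the potentials with all their derivatives on time segments inside
]0, T[, and spares second time derivatives of products. *)
Definition bounded_lipschitz phi : Prop := exists2 M, 0 <= M &
  forall t t' x x', e <= t <= S -> e <= t' <= S ->
    `|phi t x| <= M /\ `|phi t' x' - phi t x| <= M * (`|t' - t| + `|x' - x|).

Lemma bounded_lipschitz_cst c : bounded_lipschitz (fun _ _ => c).
Proof.
exists `|c| => // t t' x x' _ _; rewrite subrr normr0; split => //.
Qed.

Lemma bounded_lipschitz_add phi psi : bounded_lipschitz phi -> bounded_lipschitz psi ->
  bounded_lipschitz (fun t x => phi t x + psi t x).
Proof.
move=> [M M0 HM] [N N0 HN]; exists (M + N); first exact: addr_ge0.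
move=> t t' x x' tI tI'; have [a1 a2] := HM t t' x x' tI tI'; have [b1 b2] := HN t t' x x' tI tI'.
split; first by apply: le_trans (ler_normD _ _) _; exact: lerD.
by rewrite opprD addrACA mulrDl; apply: le_trans (ler_normD _ _) _; exact: lerD.
Qed.

Lemma bounded_lipschitz_mul phi psi : bounded_lipschitz phi -> bounded_lipschitz psi ->
  bounded_lipschitz (fun t x => phi t x * psi t x).
Proof.
move=> [M M0 HM] [N N0 HN].
have MN : 0 <= M * N by exact: mulr_ge0.
exists (M * N + M * N); first exact: addr_ge0.
move=> t t' x x' tI tI'; have [a1 a2] := HM t t' x x' tI tI'; have [b1 b2] := HN t t' x x' tI tI'.
have [a1' _] := HM t' t x' x tI' tI.
split.
  rewrite normrM; apply: (@le_trans _ _ (M * N)); last by lra.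
  exact: ler_pM.
rewrite (_ : _ - _ = phi t' x' * (psi t' x' - psi t x) + (phi t' x' - phi t x) * psi t x); last by ring.
apply: le_trans (ler_normD _ _) _; rewrite !normrM mulrDl; apply: lerD.
  by rewrite -mulrA; exact: ler_pM.
by rewrite [M * N]mulrC -mulrA [leRHS]mulrC; exact: ler_pM.
Qed.

Lemma bounded_lipschitz_scale c phi : bounded_lipschitz phi ->
  bounded_lipschitz (fun t x => c * phi t x).
Proof. by move=> H; apply: bounded_lipschitz_mul => //; exact: bounded_lipschitz_cst. Qed.

Lemma bounded_lipschitz_continuous phi t : bounded_lipschitz phi -> e <= t <= S ->
  continuous (phi t).
Proof.
move=> [M M0 HM] tI x; apply/cvgrPdist_le => c c0; have M1 : 0 < M + 1 by rewrite ltr_wpDl.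
near=> y; rewrite distrC; have [_ h] := HM t t x y tI tI; apply: le_trans h _.
rewrite subrr normr0 add0r; apply: (@le_trans _ _ ((M + 1) * `|y - x|)).
  by rewrite ler_wpM2r// lerDl.
rewrite mulrC -ler_pdivlMr// distrC; near: y.
by apply: cvgr_dist_le; [exact: cvg_id|exact: divr_gt0].
Unshelve. all: by end_near.
Qed.

Lemma bounded_lipschitz_curve phi (y : R -> R) t : bounded_lipschitz phi -> e < t < S ->
  {for t, continuous y} -> {for t, continuous (fun s => phi s (y s))}.
Proof.
move=> [M M0 HM] /andP[et tS] cy; apply/cvgrPdist_le => c c0.
have M1 : 0 < M + 1 by rewrite ltr_wpDl.
have tI : e <= t <= S by rewrite !ltW.
have c1 : 0 < c / (M + 1) / 2 by rewrite !divr_gt0.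
near=> s; rewrite distrC.
have sI : e <= s <= S.
  have : `|t - s| < Num.min (t - e) (S - t).
    near: s; apply: cvgr_dist_lt; first exact: cvg_id.
    by rewrite lt_min !subr_gt0 et.
  rewrite lt_min !ltr_norml => /andP[/andP[? ?] /andP[? ?]].
  by apply/andP; split; lra.
have [_ h] := HM t s (y t) (y s) tI sI; apply: le_trans h _.
apply: (@le_trans _ _ ((M + 1) * (`|s - t| + `|y s - y t|))).
  by rewrite ler_wpM2r ?addr_ge0// lerDl.
rewrite mulrC -ler_pdivlMr//.
have -> : c / (M + 1) = c / (M + 1) / 2 + c / (M + 1) / 2 by field; rewrite gt_eqF.
apply: lerD; rewrite distrC; near: s.
  by apply: cvgr_dist_le => //; exact: cvg_id.
exact: cvgr_dist_le.
Unshelve. all: by end_near.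
Qed.

Lemma bounded_lipschitz_kern j sg : 0 < e -> `|sg| = 1 -> sg ^+ 2 = 1 ->
  bounded_lipschitz (fun t x => kern j sg t x).
Proof.
move=> e0 sg1 sg2.
have [C0 C00 H0] := kern_bounded j _ _ sg1 e0.
have [C1 C10 H1] := kern_bounded j.+1 _ _ sg1 e0.
have [C2 C20 H2] := kern_bounded j.+2 _ _ sg1 e0.
exists (C0 + C1 + C2); first by rewrite !addr_ge0.
move=> t t' x x' /andP[et _] /andP[et' _]; split.
  by apply: le_trans (H0 _ _ et) _; rewrite -addrA lerDl addr_ge0.
have tm a b z : e <= a -> a <= b -> `|kern j sg b z - kern j sg a z| <= C2 * (b - a).
  move=> ea ab; apply: (lipschitz_is_derive (fun s => kern j sg s z) (fun s => 2^-1 * kern j.+2 sg s z)) => //.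
    by move=> s /andP[as_ _]; apply: is_derive_kern_time => //; exact: lt_le_trans e0 (le_trans ea as_).
  move=> s /andP[as_ _]; rewrite normrM ger0_norm//.
  by have := H2 s z (le_trans ea as_); have := normr_ge0 (kern j.+2 sg s z); lra.
have tm' z : `|kern j sg t' z - kern j sg t z| <= C2 * `|t' - t|.
  have [tt|tt] := leP t t'; first by rewrite (ger0_norm (_ : 0 <= t' - t)) ?subr_ge0//; exact: tm.
  by rewrite distrC [`|t' - t|]distrC (ger0_norm (_ : 0 <= t - t')) ?subr_ge0 ?(ltW tt)//; apply: tm => //; exact: ltW.
rewrite (_ : _ - _ = (kern j sg t' x' - kern j sg t' x) + (kern j sg t' x - kern j sg t x)); last by ring.
apply: le_trans (ler_normD _ _) _.
have h1 : `|kern j sg t' x' - kern j sg t' x| <= C1 * `|x' - x|.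
  by apply: (lipschitz_line _ (kern j.+1 sg t')) => z; [exact: is_derive_kern|exact: H1].
have h2 := tm' x.
have p1 := mulr_ge0 C00 (normr_ge0 (t' - t)); have p2 := mulr_ge0 C00 (normr_ge0 (x' - x)).
have p3 := mulr_ge0 C10 (normr_ge0 (t' - t)); have p4 := mulr_ge0 C20 (normr_ge0 (x' - x)).
by rewrite mulrDr !mulrDl; lra.
Qed.

End bounded_lipschitz.

Section moving_endpoint.
Context {R : realType}.
Notation leb := (@lebesgue_measure R).
Implicit Types (f F y : R -> R) (a b t x z M : R).

Lemma is_derive_growth y t (y' : R) : is_derive t (1 : R) y y' -> exists K, exists2 d, 0 < d &
  0 <= K /\ forall s, `|s - t| < d -> `|y s - y t| <= K * `|s - t|.
Proof.
move=> dy; have [dv Dv] := dy.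
have : h^-1 *: (y (h *: (1 : R) + t) - y t) @[h --> 0^'] --> y' by rewrite -Dv; exact: dv.
move=> /cvgrPdist_le /(_ 1 ltr01); rewrite /dnbhs near_withinE => /nbhs_ballP[d /= d0 Hd].
exists (`|y'| + 1), d => //; split; first by rewrite addr_ge0.
move=> s sd; have [->|st] := eqVneq s t; first by rewrite !subrr normr0 mulr0.
have st0 : s - t != 0 by rewrite subr_eq0.
have := Hd (s - t); rewrite -ball_normE /= sub0r normrN => /(_ sd st0).
rewrite /GRing.scale /= mulr1 subrK => h.
have E : y s - y t = (s - t) * ((s - t)^-1 * (y s - y t)) by rewrite mulrA divff// mul1r.
rewrite E normrM mulrC ler_wpM2r//.
have -> : (s - t)^-1 * (y s - y t) = y' - (y' - (s - t)^-1 * (y s - y t)) by ring.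
by apply: le_trans (ler_normB _ _) _; rewrite lerD2l.
Qed.

Lemma continuous_integrable_segment f a b : (forall x, a <= x <= b -> {for x, continuous f}) ->
  leb.-integrable [set` `]a, b]] (EFin \o f).
Proof.
move=> cf; apply: (@integrableS _ _ _ leb [set` `[a, b]]) => //.
  by move=> x; rewrite /= !in_itv /= => /andP[/ltW -> ->].
apply: continuous_compact_integrable; first exact: segment_compact.
apply: continuous_in_subspaceT => x; rewrite inE /= in_itv /=; exact: cf.
Qed.

Lemma Rintegral_derivative F f a b : a <= b ->
  (forall x, a <= x <= b -> is_derive x (1 : R) F (f x)) ->
  (forall x, a <= x <= b -> {for x, continuous f}) ->
  \int[leb]_(x in [set` `]a, b]]) f x = F b - F a.
Proof.
rewrite le_eqVlt => /orP[/eqP <-|ab] dF cf.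
  by rewrite set_itv_ge ?bnd_simp ?ltxx// Rintegral_set0 subrr.
have I := continuous_integrable_segment f a b cf.
rewrite Rintegral_itv_obnd_cbnd//.
have := @continuous_FTC2 R f F a b ab; rewrite /Rintegral => -> //.
- by apply: continuous_in_subspaceT => x; rewrite inE /= in_itv /=; exact: cf.
- have cF x : a <= x <= b -> {for x, continuous F}.
    by move=> xab; exact: is_derive_continuous (dF x xab).
  split.
  + by move=> x; rewrite in_itv /= => /andP[ax xb]; have [] := dF x (introT andP (conj (ltW ax) (ltW xb))).
  + by apply: cvg_at_right_filter; apply: cF; rewrite lexx ltW.
  + by apply: cvg_at_left_filter; apply: cF; rewrite lexx ltW.
- move=> x; rewrite in_itv /= => /andP[ax xb].
  by have := is_derive_derive1 (dF x (introT andP (conj (ltW ax) (ltW xb)))).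
Qed.

Lemma is_derive_primitive f a x b : a < x -> x < b ->
  (forall z, a <= z <= b -> {for z, continuous f}) ->
  is_derive x (1 : R) (fun z => \int[leb]_(t in [set` `]a, z]]) f t) (f x).
Proof.
move=> ax xb cf; have I := continuous_integrable_segment f a b cf.
have cx : {for x, continuous f} by apply: cf; rewrite !ltW.
have ax' : (BRight a < BRight x)%O by rewrite bnd_simp.
have [dv Dv] := @continuous_FTC1 R f (BRight a) x b xb I ax' cx.
by have := derivable_is_derive1 dv; rewrite Dv.
Qed.

Lemma Rintegral_segment_bound f a b M : a <= b -> 0 <= M -> (forall x, {for x, continuous f}) ->
  (forall x, `|f x| <= M) -> `|\int[leb]_(x in [set` `]a, b]]) f x| <= M * (b - a).
Proof.
rewrite le_eqVlt => /orP[/eqP <-|ab] M0 cf fM.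
  by rewrite set_itv_ge ?bnd_simp ?ltxx// Rintegral_set0 subrr normr0 mulr0.
have I := continuous_integrable_segment f a b (fun x _ => cf x).
have cnf : forall x, {for x, continuous (fun x => `|f x|)}.
  by move=> x; apply: cvg_norm; exact: cf.
have In := continuous_integrable_segment _ a b (fun x _ => cnf x).
have Ic : leb.-integrable [set` `]a, b]] (EFin \o (fun=> M)).
  by apply: continuous_integrable_segment => x _; exact: cvg_cst.
have mI : measurable ([set` `]a, b]] : set (measurableTypeR R)) by exact: measurable_itv.
apply: le_trans (le_normr_Rintegral mI I) _.
apply: le_trans (le_Rintegral mI In Ic (fun x _ => fM x)) _.
have E : leb [set` `]a, b]] = (b - a)%:E by rewrite lebesgue_measure_itv /= lte_fin ab -EFinB.
rewrite le_eqVlt; apply/orP; left; apply/eqP.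
by apply: (eq_trans (Rintegral_cst _ mI M)); congr (_ * _); exact: (congr1 fine E).
Qed.

Lemma between_itv (e S a b s : R) : e <= a <= S -> e <= b <= S ->
  Num.min a b <= s <= Num.max a b -> e <= s <= S.
Proof.
move=> /andP[ea aS] /andP[eb bS] /andP[s1 s2]; apply/andP; split.
  by apply: le_trans s1; rewrite le_min ea.
by apply: le_trans s2 _; rewrite ge_max aS.
Qed.

(** Leibniz rule, when the time derivative of the integrand has a primitive [H]
in space. After subtracting q(t0, y(t0)) y(t) the remainder is quadratic: the
strip swept by the endpoint contributes a product of two small factors, and the
fixed part a Taylor remainder. *)
Lemma is_derive_moving_endpoint (q qt H : R -> R -> R) y e S a t0 (y' : R) :
  e < t0 < S -> bounded_lipschitz e S q -> bounded_lipschitz e S qt ->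
  (forall t x, e <= t <= S -> is_derive t (1 : R) (fun s => q s x) (qt t x)) ->
  (forall x, is_derive x (1 : R) (H t0) (qt t0 x)) ->
  is_derive t0 (1 : R) y y' -> a < y t0 ->
  is_derive t0 (1 : R) (fun t => \int[leb]_(x in [set` `]a, y t]]) q t x)
    (y' * q t0 (y t0) + (H t0 (y t0) - H t0 a)).
Proof.
move=> /andP[et0 t0S] Lq Lqt dq dH dy ay.
have t0I : e <= t0 <= S by rewrite !ltW.
have cq t : e <= t <= S -> continuous (q t) by exact: bounded_lipschitz_continuous.
have [M M0 HM] := Lq; have [N N0 HN] := Lqt.
have [K [d1 d10 [K0 HK]]] := is_derive_growth _ _ _ dy.
set y0 := y t0 in ay *; set q0 := q t0 y0.
pose d := Num.min d1 (Num.min (t0 - e) (Num.min (S - t0) ((y0 - a) / (K + 1)))).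
have K1 : 0 < K + 1 by rewrite ltr_wpDl.
have d0 : 0 < d by rewrite !lt_min d10 !subr_gt0 et0 t0S divr_gt0// subr_gt0.
pose Q t z := \int[leb]_(x in [set` `]a, z]]) q t x.
have dQ t z : e <= t <= S -> a < z -> is_derive z (1 : R) (Q t) (q t z).
  move=> tI az; apply: (is_derive_primitive _ _ _ (z + 1)) => //; first by rewrite ltrDl.
  by move=> w _; exact: cq.
(* the endpoint may be merely differentiable; only G has a quadratic remainder *)
pose G t := Q t (y t) + (- q0) * y t.
have near0 t : `|t - t0| < d -> [/\ e <= t <= S, a < y t & `|y t - y0| <= K * `|t - t0|].
  rewrite !lt_min => /and4P[h1 h2 h3 h4]; have hK := HK t h1.
  split=> //.
    by move: h2 h3; rewrite !ltr_norml => /andP[? ?] /andP[? ?]; apply/andP; split; lra.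
  have : `|y t - y0| < y0 - a.
    apply: le_lt_trans hK _; apply: (@le_lt_trans _ _ ((K + 1) * `|t - t0|)).
      by rewrite ler_wpM2r// lerDl.
    by rewrite mulrC -ltr_pdivlMr.
  by rewrite ltr_norml => /andP[? ?]; lra.
have partA t : `|t - t0| < d ->
    `|Q t (y t) - Q t y0 - (y t - y0) * q0| <= M * (K + 1) * K * `|t - t0| ^+ 2.
  move=> td; have [tI ayt hK] := near0 t td.
  pose E z := Q t z + (- q0) * z.
  have dE z : a < z -> is_derive z (1 : R) E (q t z + - q0).
    move=> az; apply: is_derive_add; first exact: dQ.
    by have := is_derive_affine (- q0) 0 z; under eq_fun do rewrite addr0.
  have bE z : `|z - y0| <= K * `|t - t0| -> `|q t z + - q0| <= M * (K + 1) * `|t - t0|.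
    move=> zK; have [_ h] := HM t0 t y0 z t0I tI; apply: le_trans h _.
    by rewrite -mulrA; apply: ler_wpM2l => //; rewrite mulrDl mul1r addrC lerD2r.
  have bd A B : A <= B -> a < A -> `|A - y0| <= K * `|t - t0| -> `|B - y0| <= K * `|t - t0| ->
      `|E B - E A| <= M * (K + 1) * `|t - t0| * (B - A).
    move=> AB aA hA hB; apply: (lipschitz_is_derive E (fun z => q t z + - q0)) => // z /andP[Az zB].
      exact: dE (lt_le_trans aA Az).
    apply: bE; move: hA hB; rewrite !ler_norml => /andP[? ?] /andP[? ?]; apply/andP; split; lra.
  have y0K : `|y0 - y0| <= K * `|t - t0| by rewrite subrr normr0 mulr_ge0.
  rewrite (_ : _ - _ = E (y t) - E y0); last by rewrite /E; ring.
  apply: (@le_trans _ _ (M * (K + 1) * `|t - t0| * `|y t - y0|)).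
    have [yy|yy] := leP y0 (y t).
      by rewrite (ger0_norm (_ : 0 <= y t - y0)) ?subr_ge0//; exact: bd.
    rewrite distrC [`|y t - y0|]distrC (ger0_norm (_ : 0 <= y0 - y t)) ?subr_ge0 ?(ltW yy)//.
    by apply: bd => //; exact: ltW.
  rewrite -!mulrA; do 2 apply: ler_wpM2l => //; first exact: ltW.
  by rewrite expr2 mulrCA; apply: ler_wpM2l.
have partB t : `|t - t0| < d ->
    `|Q t y0 - Q t0 y0 - (t - t0) * (H t0 y0 - H t0 a)| <= N * `|t - t0| ^+ 2 * (y0 - a).
  move=> td; have [tI _ _] := near0 t td.
  have cqt : continuous (qt t0) := bounded_lipschitz_continuous e S qt t0 Lqt t0I.
  have IH : H t0 y0 - H t0 a = \int[leb]_(x in [set` `]a, y0]]) qt t0 x.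
    exact: (esym (Rintegral_derivative (H t0) (qt t0) a y0 (ltW ay) (fun x _ => dH x) (fun x _ => cqt x))).
  have Iq s : e <= s <= S -> leb.-integrable [set` `]a, y0]] (EFin \o q s).
    by move=> sI; apply: continuous_integrable_segment => x _; exact: cq.
  have Iqt : leb.-integrable [set` `]a, y0]] (EFin \o (fun x => (t - t0) * qt t0 x)).
    apply: continuous_integrable_segment => x _.
    by apply: cvgM; [exact: cvg_cst|exact: cqt].
  have mI : measurable ([set` `]a, y0]] : set (measurableTypeR R)) by exact: measurable_itv.
  have I0 : leb.-integrable [set` `]a, y0]] (EFin \o qt t0).
    by apply: continuous_integrable_segment => x _; exact: cqt.
  have I2 : leb.-integrable [set` `]a, y0]] (EFin \o (fun x => q t x - q t0 x)).
    by have := integrableB mI (Iq t tI) (Iq t0 t0I); exact: eq_integrable.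
  rewrite IH /Q -(RintegralZl (t - t0) mI I0) -(RintegralB mI (Iq t tI) (Iq t0 t0I)) -(RintegralB mI I2 Iqt).
  apply: Rintegral_segment_bound; first exact: ltW.
  - by rewrite mulr_ge0// exprn_ge0.
  - move=> x; apply: cvgB; first by apply: cvgB; exact: cq.
    by apply: cvgM; [exact: cvg_cst|exact: cqt].
  - move=> x; apply: (taylor1_is_derive (fun s => q s x) (fun s => qt s x)).
      by move=> s sI; apply: dq; exact: (between_itv _ _ _ _ _ t0I tI sI).
    move=> s sI; have {}sI := between_itv _ _ _ _ _ t0I tI sI.
    by have [_] := HN t0 s x x t0I sI; rewrite subrr normr0 addr0.
have dG : is_derive t0 (1 : R) G (H t0 y0 - H t0 a).
  apply: (is_derive_of_remainder G t0 _ (M * (K + 1) * K + N * (y0 - a)) d d0) => t td.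
  rewrite (_ : G t - G t0 - _ = (Q t (y t) - Q t y0 - (y t - y0) * q0) +
    (Q t y0 - Q t0 y0 - (t - t0) * (H t0 y0 - H t0 a))); last by rewrite /G -/y0; ring.
  apply: le_trans (ler_normD _ _) _; rewrite [leRHS]mulrDl; apply: lerD; first exact: partA.
  by rewrite -mulrA [(y0 - a) * _]mulrC mulrA; exact: partB.
rewrite (_ : (fun t => _) = (fun t => G t + q0 * y t)); last first.
  by apply/funext => t; rewrite /G /Q; ring.
apply: (is_derive_eq (is_derive_add _ _ _ _ _ dG (is_derive_scale q0 _ _ _ dy))).
by rewrite addrC mulrC.
Qed.

End moving_endpoint.

Section derivative_of_limit.
Context {R : realType}.
Notation leb := (@lebesgue_measure R).

(** Integrating the derivatives, bounded convergence passes to the limit without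
any uniformity, and the fundamental theorem of calculus differentiates back. *)
Lemma is_derive_bounded_limit (F_ D_ : nat -> R -> R) (F r : R -> R) (a b K t : R) :
  a < t < b ->
  (forall n s, a <= s <= b -> is_derive s (1 : R) (F_ n) (D_ n s)) ->
  (forall n s, a <= s <= b -> {for s, continuous (D_ n)}) ->
  (forall n s, a <= s <= b -> `|D_ n s| <= K) ->
  (forall s, a <= s <= b -> D_ n s @[n --> \oo] --> r s) ->
  (forall s, a <= s <= b -> F_ n s @[n --> \oo] --> F s) ->
  (forall s, a <= s <= b -> {for s, continuous r}) ->
  is_derive t (1 : R) F (r t).
Proof.
move=> /andP[at_ tb] dF cD bD Dr FF cr.
have ab : a < b by exact: lt_trans tb.
have FE s : a <= s <= b -> F s = F a + \int[leb]_(x in [set` `]a, s]]) r x.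
  move=> /andP[as_ sb].
  have mI : measurable ([set` `]a, s]] : set (measurableTypeR R)) by exact: measurable_itv.
  have sub x : a <= x <= s -> a <= x <= b by move=> /andP[-> /le_trans ->].
  have ID n : leb.-integrable [set` `]a, s]] (EFin \o D_ n).
    by apply: continuous_integrable_segment => x /sub; exact: cD.
  have mD n : measurable_fun ([set` `]a, s]] : set (measurableTypeR R)) (D_ n).
    by apply/measurable_EFinP; exact: measurable_int (ID n).
  have fin : (leb [set` `]a, s]] < +oo)%E.
    by rewrite lebesgue_measure_itv /=; case: ifP => _; rewrite -?EFinB ltry.
  have subI x : [set` `]a, s]] x -> a <= x <= b.
    by rewrite /= in_itv /= => /andP[/ltW ax xs]; apply: sub; rewrite ax.
  have [_ cI] := bounded_cvg_Rintegral _ _ leb [set` `]a, s]] D_ r K mI fin mD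
    (fun x xI => Dr x (subI x xI)) (fun n x xI => bD n x (subI x xI)).
  have E n : \int[leb]_(x in [set` `]a, s]]) D_ n x = F_ n s - F_ n a.
    by apply: Rintegral_derivative => // x /sub; [exact: dF|exact: cD].
  have cE : F_ n s - F_ n a @[n --> \oo] --> \int[leb]_(x in [set` `]a, s]]) r x.
    by move: cI; under eq_fun do rewrite E.
  have sI : a <= s <= b by rewrite as_.
  have aI : a <= a <= b by rewrite lexx ltW.
  have -> : \int[leb]_(x in [set` `]a, s]]) r x = F s - F a; last by ring.
  rewrite -(cvg_lim (@Rhausdorff R) cE).
  by apply: (cvg_lim (@Rhausdorff R)); exact: cvgB (FF s sI) (FF a aI).
have d0 := is_derive_primitive r a t b at_ tb cr.
have d1 := is_derive_add _ _ _ _ _ (is_derive_cst (F a) t 1) d0.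
apply: (is_derive_eq _ (add0r _)).
have near_eq : \forall s \near t, F a + \int[leb]_(x in [set` `]a, s]]) r x = F s.
  near=> s; rewrite (FE s)//.
  have : `|t - s| < Num.min (t - a) (b - t).
    near: s; apply: cvgr_dist_lt; first exact: cvg_id.
    by rewrite lt_min !subr_gt0 at_.
  rewrite lt_min !ltr_norml => /andP[/andP[? ?] /andP[? ?]].
  by apply/andP; split; lra.
exact: near_eq_is_derive near_eq d1.
Unshelve. all: by end_near.
Qed.

End derivative_of_limit.

(** * Density of the last exit *)

Section gradient.
Context {R : realType}.
Implicit Types (T t u x y : R) (mu : @functional R).

Lemma kern1N (s y : R) : kern 1 1 s y = - kern 1 (-1) s y.
Proof.
rewrite /kern !expr1 dN1 mulN1r !mulNr mul1r normal_pdf1N; ring.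
Qed.

Lemma kern1_normal_pdf s x : 0 < s -> kern 1 1 s x = normal_pdf 0 (Num.sqrt s) x :> R.
Proof.
by move=> s0; rewrite normal_pdfE1 ?sqrtr_gt0// /kern expr1 dN1 mul1r.
Qed.

Lemma kern1_derive1 s x : kern 1 1 s x = (Num.sqrt s)^-1 * derive1 normal_cdf (x / Num.sqrt s).
Proof.
by rewrite /kern expr1 dN1 derive1_normal_cdf mul1r [_^-1 * x]mulrC.
Qed.

(** The kernels of the two potentials have opposite space derivatives, which is
why the gradient of their sum is the potential of the difference of the
derivatives. *)
Lemma U_gradient T u t mu0 mu1 :
  schwartz_distribution mu0 -> compact (dist_support mu0) ->
  schwartz_distribution mu1 -> compact (dist_support mu1) -> 0 <= t < T ->
  U T u t (dist_sub (dist_deriv mu0) (dist_deriv mu1)) = - potential T mu0 mu1 1 t u.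
Proof.
move=> s0 c0 s1 c1 tT; rewrite /U tT.
pose phi v := kern 0 (-1) (T - t) (v - u).
have sphi : smooth phi by exact: smooth_shift (smooth_kern 0 (-1) (T - t)).
rewrite (_ : (fun v => _) = phi); last first.
  by apply/funext => v; rewrite /phi /kern expr0 mul1r derive1n0; congr normal_cdf; ring.
rewrite pairing_dist_sub_deriv//.
have dphi : derive1 phi = (fun v => kern 1 (-1) (T - t) (v - u)).
  have := derive1n_shift 1 _ u (smooth_kern 0 (-1) (T - t)).
  by rewrite derive1n_kern.
rewrite dphi /potential /heat_pot /pairing_shift opprD; congr (_ + _).
have E : (fun v => kern 1 1 (T - t) (v - u)) = (fun v => (-1) * kern 1 (-1) (T - t) (v - u)).
  by apply/funext => v; rewrite kern1N mulN1r.
have sk : smooth (fun v => kern 1 (-1) (T - t) (v - u)) by exact: smooth_shift (smooth_kern 1 (-1) (T - t)).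
have Y := eq_trans (congr1 (pairing mu1) E) (pairing_scale mu1 (-1) _ s1.1 c1 sk).
have alg (a b : R) : a = -1 * b -> b = - a by move=> ->; ring.
exact: alg Y.
Qed.

End gradient.

Section strip_mass_derivative.
Context {R : realType} (T : R) (mu0 mu1 : @functional R).
Hypotheses (smu0 : schwartz_distribution mu0) (smu1 : schwartz_distribution mu1).
Hypotheses (cmu0 : compact (dist_support mu0)) (cmu1 : compact (dist_support mu1)).
Variables (e S : R).
Hypotheses (e0 : 0 < e) (ST : S < T).
Implicit Types (t x : R).

Local Notation pot j t x := (potential T mu0 mu1 j t x).

Definition strip_density t x : R := (1 + (-1) * pot 0%N t x) * kern 1 1 t x.

Definition strip_density_dt t x : R :=
  2^-1 * (pot 2 t x * kern 1 1 t x) + 2^-1 * ((1 + (-1) * pot 0%N t x) * kern 3 1 t x).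

(** The potential solves the backward and the Gaussian density the forward heat
equation, so the second derivatives of the product telescope into the space
derivative of this Wronskian. *)
Definition strip_flux t x : R :=
  2^-1 * ((1 + (-1) * pot 0%N t x) * kern 2 1 t x) + (- 2^-1) * (pot 1 t x * kern 1 1 t x).

Let P1 : `|1 : R| = 1. Proof. exact: normr1. Qed.
Let P2 : (1 : R) ^+ 2 = 1. Proof. exact: expr1n. Qed.

Lemma bounded_lipschitz_potential j : bounded_lipschitz e S (fun t x => pot j t x).
Proof.
have [M M0 HM] := potential_bound T mu0 mu1 smu0 smu1 cmu0 cmu1 j S ST.
have [B B0 HB] := potential_lip T mu0 mu1 smu0 smu1 cmu0 cmu1 j S ST.
exists (M + B); first exact: addr_ge0.
move=> t t' x x' /andP[_ tS] /andP[_ tS']; split.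
  by apply: le_trans (HM t x tS) _; rewrite lerDl.
apply: le_trans (HB t t' x x' tS tS') _; apply: ler_wpM2r; first exact: addr_ge0.
by rewrite lerDr.
Qed.

Let LV : bounded_lipschitz e S (fun t x => 1 + (-1) * pot 0%N t x).
Proof.
apply: bounded_lipschitz_add; first exact: bounded_lipschitz_cst.
apply: bounded_lipschitz_scale; exact: bounded_lipschitz_potential.
Qed.

Let Lk j : bounded_lipschitz e S (fun t x => kern j 1 t x).
Proof. exact: bounded_lipschitz_kern. Qed.

Lemma bounded_lipschitz_density : bounded_lipschitz e S strip_density.
Proof. exact: (bounded_lipschitz_mul _ _ _ _ LV (Lk 1)). Qed.

Lemma bounded_lipschitz_density_dt : bounded_lipschitz e S strip_density_dt.
Proof.
apply: bounded_lipschitz_add; apply: bounded_lipschitz_scale.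
  exact: (bounded_lipschitz_mul _ _ _ _ (bounded_lipschitz_potential 2) (Lk 1)).
exact: (bounded_lipschitz_mul _ _ _ _ LV (Lk 3)).
Qed.

Lemma bounded_lipschitz_flux : bounded_lipschitz e S strip_flux.
Proof.
apply: bounded_lipschitz_add; apply: bounded_lipschitz_scale.
  exact: (bounded_lipschitz_mul _ _ _ _ LV (Lk 2)).
exact: (bounded_lipschitz_mul _ _ _ _ (bounded_lipschitz_potential 1) (Lk 1)).
Qed.

Lemma is_derive_density t x : e <= t <= S ->
  is_derive t (1 : R) (fun s => strip_density s x) (strip_density_dt t x).
Proof.
move=> /andP[et tS]; have t0 := lt_le_trans e0 et; have tT := le_lt_trans tS ST.
have d0 := is_derive_potential_time T mu0 mu1 smu0 smu1 cmu0 cmu1 0 t x tT.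
have d1 := is_derive_add _ _ _ _ _ (is_derive_cst (1 : R) t 1) (is_derive_scale (-1) _ _ _ d0).
have d2 := is_derive_kern_time 1 1 t x P2 t0.
apply: (is_derive_eq (is_derive_mul _ _ _ _ _ d1 d2)).
rewrite /strip_density_dt /cst.
generalize (pot 0%N t x) (pot 2 t x) (kern 1 1 t x) (kern 3 1 t x) => V V2 p k; ring.
Qed.

Lemma is_derive_flux t x : e <= t <= S ->
  is_derive x (1 : R) (strip_flux t) (strip_density_dt t x).
Proof.
move=> /andP[et tS]; have tT := le_lt_trans tS ST.
have d0 := is_derive_potential T mu0 mu1 smu0 smu1 cmu0 cmu1 0 t x tT.
have d1 := is_derive_potential T mu0 mu1 smu0 smu1 cmu0 cmu1 1 t x tT.
have dV := is_derive_add _ _ _ _ _ (is_derive_cst (1 : R) x 1) (is_derive_scale (-1) _ _ _ d0).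
have a1 := is_derive_scale 2^-1 _ _ _ (is_derive_mul _ _ _ _ _ dV (is_derive_kern 2 1 t x)).
have a2 := is_derive_scale (- 2^-1) _ _ _ (is_derive_mul _ _ _ _ _ d1 (is_derive_kern 1 1 t x)).
apply: (is_derive_eq (is_derive_add _ _ _ _ _ a1 a2)).
rewrite /strip_density_dt /cst.
generalize (pot 0%N t x) (pot 1 t x) (pot 2 t x) (kern 1 1 t x) (kern 2 1 t x) (kern 3 1 t x).
move=> V V1 V2 p k2 k3; ring.
Qed.

(** The base point [a] lies below the barriers, so its contribution cancels
between the upper and the lower barrier. *)
Lemma is_derive_strip_mass (y : R -> R) (a t y' : R) : e < t < S ->
  is_derive t (1 : R) y y' -> a < y t ->
  is_derive t (1 : R)
    (fun s => \int[@lebesgue_measure R]_(x in [set` `]a, y s]]) strip_density s x)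
    (y' * strip_density t (y t) + (strip_flux t (y t) - strip_flux t a)).
Proof.
move=> etS dy ay; have /andP[et tS] := etS.
have tI : e <= t <= S by rewrite !ltW.
exact: (is_derive_moving_endpoint strip_density strip_density_dt strip_flux y e S a t y' etS
  bounded_lipschitz_density bounded_lipschitz_density_dt is_derive_density
  (fun x => is_derive_flux t x tI) dy ay).
Qed.

Lemma strip_mass t a y1 y0 : e <= t <= S -> a < y1 -> y1 <= y0 ->
  \int[normal_prob 0 (Num.sqrt t)]_(x in [set` `]y1, y0]]) (1 - pot 0%N t x) =
  \int[@lebesgue_measure R]_(x in [set` `]a, y0]]) strip_density t x -
  \int[@lebesgue_measure R]_(x in [set` `]a, y1]]) strip_density t x.
Proof.
move=> tI ay1 y10; have /andP[et tS] := tI; have t0 := lt_le_trans e0 et.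
have st : 0 < Num.sqrt t by rewrite sqrtr_gt0.
have [M M0 HM] := potential_bound T mu0 mu1 smu0 smu1 cmu0 cmu1 0 S ST.
have mI : measurable ([set` `]y1, y0]] : set (measurableTypeR R)) by exact: measurable_itv.
have mV : measurable_fun setT ((fun x => 1 - pot 0%N t x) : measurableTypeR R -> R).
  apply: measurable_realfun.continuous_measurable_fun => x.
  apply: cvgB; first exact: cvg_cst.
  exact: (continuous_potential T mu0 mu1 smu0 smu1 cmu0 cmu1 0 t (le_lt_trans tS ST)).
have bV x : [set` `]y1, y0]] x -> `|1 - pot 0%N t x| <= 1 + M.
  by move=> _; apply: le_trans (ler_normB _ _) _; rewrite normr1 lerD2l; exact: HM.
rewrite (integral_normal_prob 0 _ _ _ _ st mI mV bV).
have c := bounded_lipschitz_continuous e S _ t bounded_lipschitz_density tI.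
have I := continuous_integrable_segment (strip_density t) a y0 (fun x _ => c x).
rewrite (Rintegral_itvB I); last 2 first.
- by rewrite bnd_simp ltW.
- by rewrite bnd_simp.
apply: eq_Rintegral => x _; rewrite /strip_density kern1_normal_pdf//; congr (_ * _).
by rewrite mulN1r.
Qed.

End strip_mass_derivative.

Section last_exit_density.
Context {R : realType} (T : R) (g : 'I_2 -> R -> R).
Variable mu : 'I_2 -> nat -> @functional R.
Hypotheses (smu : forall i n, schwartz_distribution (mu i n))
  (cmu : forall i n, compact (dist_support (mu i n))).
Variables (I : set R) (F : R -> R) (A c C : R) (h : 'I_2 -> R -> R).
Hypotheses (oI : open I) (IT : I `<=` `[0, T]).
Local Notation pot n j t x := (potential T (mu ord0 n) (mu ord_max n) j t x).
Hypotheses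
  (dg : forall i t, I t -> derivable (g i) t 1 /\ {for t, continuous (derive1 (g i))})
  (g_lt : forall t, I t -> g ord_max t < g ord0 t)
  (g_gt : forall i t, I t -> A < g i t)
  (boundary1 : forall i t, I t -> pot n 0%N t (g i t) @[n --> \oo] --> (1 : R))
  (boundary_bound : forall i n t, I t -> `|pot n 0%N t (g i t)| <= c)
  (gradient_bound : forall i n t, I t -> `|pot n 1%N t (g i t)| <= C)
  (gradient_limit : forall i t, I t -> - pot n 1%N t (g i t) @[n --> \oo] --> h i t)
  (h_cont : forall i t, I t -> {for t, continuous (h i)})
  (mass_limit : forall t, I t ->
    \int[normal_prob 0 (Num.sqrt t)]_(x in [set` `]g ord_max t, g ord0 t]]) (1 - pot n 0%N t x)
      @[n --> \oo] --> F t).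

(** On the barriers 1 - f_n and with it the density tend to 0, so only the part
of the flux with the gradient of the potential survives. *)
Lemma is_derive_last_exit t : I t ->
  is_derive t (1 : R) F
    (2^-1 * (h ord0 t * kern 1 1 t (g ord0 t)) - 2^-1 * (h ord_max t * kern 1 1 t (g ord_max t))).
Proof.
move=> It; have /nbhs_ballP[r /= r0 Hr] : nbhs t I by exact: open_nbhs_nbhs.
have ballI s : t - r < s < t + r -> I s.
  by move=> /andP[? ?]; apply: Hr; rewrite -ball_normE /= ltr_norml; apply/andP; split; lra.
(* [a, b] lies inside ]e, S[; the radius 7 / 8 shows that e and S are interior
   to [0, T] *)
pose a := t - r / 2; pose b := t + r / 2.
pose e := t - (3 / 4) * r; pose S := t + (3 / 4) * r.
have e0 : 0 < e.
  have /ballI/IT : t - r < t - (7 / 8) * r < t + r by apply/andP; split; lra.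
  by rewrite /= in_itv /= /e => /andP[? _]; lra.
have ST : S < T.
  have /ballI/IT : t - r < t + (7 / 8) * r < t + r by apply/andP; split; lra.
  by rewrite /= in_itv /= /S => /andP[_ ?]; lra.
have abI s : a <= s <= b -> I s.
  by rewrite /a /b => /andP[? ?]; apply: ballI; apply/andP; split; lra.
have abe s : a <= s <= b -> e < s < S.
  by rewrite /a /b /e /S => /andP[? ?]; apply/andP; split; lra.
have ab : a < b by rewrite /a /b; lra.
have abc s : a <= s <= b -> e <= s <= S by move=> /abe/andP[? ?]; rewrite !ltW.
pose Q n i s := \int[@lebesgue_measure R]_(x in [set` `]A, g i s]])
  strip_density T (mu ord0 n) (mu ord_max n) s x.
pose D_ n i s := derive1 (g i) s * strip_density T (mu ord0 n) (mu ord_max n) s (g i s) +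
  strip_flux T (mu ord0 n) (mu ord_max n) s (g i s).
have dgi i s : I s -> is_derive s (1 : R) (g i) (derive1 (g i) s).
  by move=> /(dg i)[d _]; exact: derivable_is_derive1.
have cgi i s : I s -> {for s, continuous (g i)}.
  by move=> Is; exact: is_derive_continuous (dgi i s Is).
have [M1 M10 HM1] := kern_bounded 1 1 e (normr1 R) e0.
have [M2 M20 HM2] := kern_bounded 2 1 e (normr1 R) e0.
have [G G0 HG] : exists2 G : R, 0 <= G & forall i s, a <= s <= b -> `|derive1 (g i) s| <= G.
  have bnd i : exists2 G : R, 0 <= G & forall s, a <= s <= b -> `|derive1 (g i) s| <= G.
    have cn : {within `[a, b], continuous (fun s => `|derive1 (g i) s|)}.
      apply: continuous_in_subspaceT => s; rewrite inE /= in_itv /= => sab.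
      by apply: cvg_norm; have [_] := dg i s (abI s sab).
    have [m] := EVT_max (ltW ab) cn; rewrite in_itv /= => mab Hm.
    by exists `|derive1 (g i) m| => // s sab; apply: Hm; rewrite in_itv.
  have [G0 G00 H0] := bnd ord0; have [G1 G10 H1] := bnd ord_max.
  exists (G0 + G1); first exact: addr_ge0.
  move=> i s sab; case: (eqVneq i ord0) => [->|ni].
    by apply: le_trans (H0 s sab) _; rewrite lerDl.
  have -> : i = ord_max.
    by apply: val_inj; case: i ni => [[|[|m]] lt] //=.
  by apply: le_trans (H1 s sab) _; rewrite lerDr.
pose K := G * ((1 + c) * M1) + (2^-1 * ((1 + c) * M2) + 2^-1 * (C * M1)).
have key := is_derive_bounded_limit
  (fun n s => Q n ord0 s - Q n ord_max s)
  (fun n s => D_ n ord0 s - D_ n ord_max s) F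
  (fun s => 2^-1 * (h ord0 s * kern 1 1 s (g ord0 s)) - 2^-1 * (h ord_max s * kern 1 1 s (g ord_max s)))
  a b (K + K) t.
apply: key.
- by rewrite /a /b; apply/andP; split; lra.
- move=> n s sab; have Is := abI s sab.
  have d0 := is_derive_strip_mass T _ _ (smu ord0 n) (smu ord_max n) (cmu ord0 n) (cmu ord_max n)
    e S e0 ST (g ord0) A s _ (abe s sab) (dgi ord0 s Is) (g_gt ord0 s Is).
  have d1 := is_derive_strip_mass T _ _ (smu ord0 n) (smu ord_max n) (cmu ord0 n) (cmu ord_max n)
    e S e0 ST (g ord_max) A s _ (abe s sab) (dgi ord_max s Is) (g_gt ord_max s Is).
  have d2 := is_derive_scale (-1) _ _ _ d1.
  have d3 := is_derive_add _ _ _ _ _ d0 d2.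
  rewrite (_ : (fun s => _) = (fun s => Q n ord0 s + (-1) * Q n ord_max s)).
    apply: (is_derive_eq d3).
    have alg (u0 u1 v0 v1 w : R) :
      (u0 + (v0 - w)) + (-1) * (u1 + (v1 - w)) = (u0 + v0) - (u1 + v1) by ring.
    exact: alg.
  by apply/funext => s'; rewrite mulN1r.
- move=> n s sab; have Is := abI s sab.
  have cD i : {for s, continuous (D_ n i)}.
    apply: cvgD.
      apply: cvgM; first by have [_] := dg i s Is.
      apply: (bounded_lipschitz_curve e S _ (g i) s _ (abe s sab) (cgi i s Is)).
      exact: (bounded_lipschitz_density T _ _ (smu ord0 n) (smu ord_max n) (cmu ord0 n) (cmu ord_max n) e S e0 ST).
    apply: (bounded_lipschitz_curve e S _ (g i) s _ (abe s sab) (cgi i s Is)).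
    exact: (bounded_lipschitz_flux T _ _ (smu ord0 n) (smu ord_max n) (cmu ord0 n) (cmu ord_max n) e S e0 ST).
  by apply: cvgB; exact: cD.
- move=> n s sab; have Is := abI s sab.
  have es : e <= s by have /andP[] := abc s sab.
  have bD i : `|D_ n i s| <= K.
    have bV : `|1 + (-1) * pot n 0%N s (g i s)| <= 1 + c.
      rewrite mulN1r; apply: le_trans (ler_normB _ _) _.
      by rewrite normr1 lerD2l; exact: boundary_bound.
    have b1 := HM1 s (g i s) es; have b2 := HM2 s (g i s) es.
    have bg := gradient_bound i n s Is.
    have nM (u v U V : R) : `|u| <= U -> `|v| <= V -> `|u * v| <= U * V.
      by move=> uU vV; rewrite normrM; exact: ler_pM.
    have half : `|2^-1 : R| <= 2^-1 by rewrite ger0_norm.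
    apply: le_trans (ler_normD _ _) _; apply: lerD.
      exact: (nM _ _ _ _ (HG i s sab) (nM _ _ _ _ bV b1)).
    apply: le_trans (ler_normD _ _) _; apply: lerD.
      exact: (nM _ _ _ _ half (nM _ _ _ _ bV b2)).
    rewrite mulNr normrN; exact: (nM _ _ _ _ half (nM _ _ _ _ bg b1)).
  by apply: le_trans (ler_normB _ _) _; exact: lerD.
- move=> s sab; have Is := abI s sab.
  have cD i : D_ n i s @[n --> \oo] --> 2^-1 * (h i s * kern 1 1 s (g i s)).
    have cV : 1 + (-1) * pot n 0%N s (g i s) @[n --> \oo] --> (0 : R).
      rewrite -(subrr (1 : R)).
      under eq_fun do rewrite mulN1r.
      by apply: cvgB; [exact: cvg_cst|exact: boundary1].
    have -> : 2^-1 * (h i s * kern 1 1 s (g i s)) =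
       derive1 (g i) s * (0 * kern 1 1 s (g i s)) +
       (2^-1 * (0 * kern 2 1 s (g i s)) + 2^-1 * (h i s * kern 1 1 s (g i s))) by ring.
    apply: cvgD; first by apply: cvgM; [exact: cvg_cst|apply: cvgM => //; exact: cvg_cst].
    rewrite /strip_flux; apply: cvgD.
      by apply: cvgM; [exact: cvg_cst|apply: cvgM => //; exact: cvg_cst].
    under eq_fun do rewrite mulNr -mulrN -mulNr.
    by apply: cvgM; [exact: cvg_cst|apply: cvgM; [exact: gradient_limit|exact: cvg_cst]].
  by apply: cvgB; exact: cD.
- move=> s sab; have Is := abI s sab.
  have := mass_limit s Is.
  under eq_fun => n do rewrite (strip_mass T _ _ (smu ord0 n) (smu ord_max n) (cmu ord0 n) (cmu ord_max n)
    e S e0 ST s A _ _ (abc s sab) (g_gt ord_max s Is) (ltW (g_lt s Is))).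
  by [].
- move=> s sab; have Is := abI s sab.
  have cr i : {for s, continuous (fun s => 2^-1 * (h i s * kern 1 1 s (g i s)))}.
    apply: cvgM; first exact: cvg_cst.
    apply: cvgM; first exact: h_cont.
    apply: (bounded_lipschitz_curve e S (fun t x => kern 1 1 t x) (g i) s _ (abe s sab) (cgi i s Is)).
    exact: (bounded_lipschitz_kern e S 1 1 e0 (normr1 R) (expr1n R 2)).
  by apply: cvgB; exact: cr.
Qed.

End last_exit_density.

Theorem theorem5p1 (R : realType) (d : measure_display)
  (Omega : measurableType d) (P : probability Omega R)
  (W : R -> {RV P >-> R}) (T : R) (g : 'I_2 -> R -> R)
  (mu : 'I_2 -> nat -> @functional R) :
  0 < T ->
  (forall i, {within `[0, T], continuous (g i)}) ->
  (forall t, 0 <= t <= T -> g ord_max t < g ord0 t) ->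
  standard_brownian_motion W ->
  (forall i n, schwartz_distribution (mu i n)) ->
  (forall i n, compact (dist_support (mu i n))) ->
  (forall n, dist_support (mu ord0 n) `<=` `[g ord0 T, +oo[) ->
  (forall n, dist_support (mu ord_max n) `<=` `]-oo, g ord_max T]) ->
  (forall t w, 0 <= t < T -> w = g ord0 t \/ w = g ord_max t ->
     (\sum_(i < 2) U_ T i w t (mu i n)) @[n --> \oo] --> (1 : R)) ->
  (exists c' : R, forall n i t w,
     0 <= t < T -> g ord_max t <= w <= g ord0 t ->
     `|U_ T i w t (mu i n)| <= c') ->
  [/\ forall u, g ord_max 0 <= u <= g ord0 0 ->
        (\sum_(i < 2) U_ T i u 0 (mu i n)) @[n --> \oo] -->
        fine (P [set w | tau T g W u w < T]),
      forall t, 0 < t < T ->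
        (\sum_(i < 2) (-1) ^+ i *
           (normal_cdf (g i t / Num.sqrt t)
            - pairing (mu ord0 n)
                (fun v => binormal_cdf (g i t / Num.sqrt t)
                            (- v / Num.sqrt T) (- Num.sqrt (t / T)))
            - pairing (mu ord_max n)
                (fun v => binormal_cdf (g i t / Num.sqrt t)
                            (v / Num.sqrt T) (Num.sqrt (t / T)))))
          @[n --> \oo] -->
        fine (P [set w | sigma T g W w <= t])
    & forall I : set R, open I -> I `<=` `[0, T] ->
        (forall i t, I t ->
           derivable (g i) t 1 /\ {for t, continuous (derive1 (g i))}) ->
        (exists C : R, forall i n t, I t ->
           `|U T (g i t) t (dist_sub (dist_deriv (mu ord0 n))
                                     (dist_deriv (mu ord_max n)))| <= C) ->
        (forall i, exists2 h : R -> R,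
           (forall t, I t -> {for t, continuous h}) &
           (forall t, I t ->
              U T (g i t) t (dist_sub (dist_deriv (mu ord0 n))
                                      (dist_deriv (mu ord_max n)))
                @[n --> \oo] --> h t)) ->
        forall t, I t ->
          is_derive t (1 : R) (fun s => fine (P [set w | sigma T g W w <= s]))
            (\sum_(i < 2) (-1) ^+ i / (2 * Num.sqrt t)
               * derive1 normal_cdf (g i t / Num.sqrt t)
               * lim (U T (g i t) t (dist_sub (dist_deriv (mu ord0 n))
                                              (dist_deriv (mu ord_max n)))
                        @[n --> \oo]))].

Proof.
move=> T0 g_cont g_lt BM smu cmu supp0 supp1 boundary [c' bounded].
pose F t := fine (P [set w | sigma T g W w <= t]).
have limit t : 0 < t < T ->
    \int[normal_prob 0 (Num.sqrt t)]_(x in [set` `]g ord_max t, g ord0 t]])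
      (1 - potential T (mu ord0 n) (mu ord_max n) 0 t x) @[n --> \oo] --> F t.
  exact: (@last_exit_limit R d Omega P W T g BM T0 g_cont mu smu cmu supp0 supp1 c' boundary bounded).
split.
- move=> u; exact: (@exit_probability R d Omega P W T g BM T0 g_cont mu smu cmu supp0 supp1 c' boundary bounded).
- move=> t tT; have /andP[t0 tT'] := tT.
  have tI : 0 <= t <= T by rewrite !ltW.
  have := limit t tT.
  under eq_fun => n do rewrite (Rintegral_potential_strip (fun i => mu i n) (fun i => g i t) t T
    (fun i => smu i n) (fun i => cmu i n) t0 tT' (ltW (g_lt t tI))).
  by [].
- move=> I oI IT dg [C gradC] hlim t It.
  have I0T s : I s -> 0 < s < T.
    move=> Is; have /nbhs_ballP[r /= r0 Hr] : nbhs s I by exact: open_nbhs_nbhs.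
    have /IT : I (s - r / 2) by apply: Hr; rewrite -ball_normE /= ltr_norml; apply/andP; split; lra.
    have /IT : I (s + r / 2) by apply: Hr; rewrite -ball_normE /= ltr_norml; apply/andP; split; lra.
    by rewrite /= !in_itv /= => /andP[? ?] /andP[? ?]; apply/andP; split; lra.
  have I0T' s : I s -> 0 <= s < T by move=> /I0T/andP[/ltW -> ->].
  have I0T'' s : I s -> 0 <= s <= T by move=> /I0T/andP[/ltW -> /ltW ->].
  have [h h_cont h_lim] : exists2 h : 'I_2 -> R -> R,
      forall i s, I s -> {for s, continuous (h i)} &
      forall i s, I s -> U T (g i s) s (dist_sub (dist_deriv (mu ord0 n))
        (dist_deriv (mu ord_max n))) @[n --> \oo] --> h i s.
    have [h0 c0 l0] := hlim ord0; have [h1 c1 l1] := hlim ord_max.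
    have ord2 (i : 'I_2) : i != ord0 -> i = ord_max.
      by move=> ni; apply: val_inj; case: i ni => [[|[|m]] lt] //=.
    exists (fun i => if i == ord0 then h0 else h1).
      by move=> i s Is; case: eqP => [_|/eqP/ord2 _]; [exact: c0|exact: c1].
    by move=> i s Is; case: eqP => [->|/eqP/ord2 ->]; [exact: l0|exact: l1].
  have grad i n s : I s -> U T (g i s) s (dist_sub (dist_deriv (mu ord0 n)) (dist_deriv (mu ord_max n))) =
      - potential T (mu ord0 n) (mu ord_max n) 1 s (g i s).
    by move=> Is; apply: U_gradient => //; exact: I0T'.
  have bar i s : I s -> g i s = g ord0 s \/ g i s = g ord_max s.
    move=> _; case: (eqVneq i ord0) => [->|ni]; [by left|right].
    by congr (g _ s); apply: val_inj; case: i ni => [[|[|m]] lt] //=.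
  have [A HA] : exists A, forall i s, I s -> A < g i s.
    have [m] := EVT_min (ltW T0) (g_cont ord_max); rewrite in_itv /= => m0T Hm.
    exists (g ord_max m - 1) => i s Is.
    have h1 : g ord_max m <= g ord_max s by apply: Hm; rewrite in_itv /=; exact: I0T''.
    by have h2 := g_lt s (I0T'' s Is); case: (bar i s Is) => ->; lra.
  have key := is_derive_last_exit T g mu smu cmu I F A (c' + c') C h oI IT dg
    (fun s Is => g_lt s (I0T'' s Is)) HA.
  have {}key := key _ _ _ _ h_cont (fun s Is => limit s (I0T s Is)) t It.
  apply: (is_derive_eq (key _ _ _ _)).
  + move=> i s Is.
    exact: (@boundary_potential R T g mu boundary s (g i s) (I0T' s Is) (bar i s Is)).
  + move=> i n s Is; rewrite -U_potential; last exact: I0T'.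
    apply: le_trans (ler_normD _ _) _.
    have strip : g ord_max s <= g i s <= g ord0 s.
      by have := ltW (g_lt s (I0T'' s Is)); case: (bar i s Is) => -> ->; rewrite lexx.
    by apply: lerD; apply: bounded => //; exact: I0T'.
  + by move=> i n s Is; have := gradC i n s Is; rewrite grad// normrN.
  + move=> i s Is; have := h_lim i s Is.
    by under eq_fun => n do rewrite (grad i n s Is).
  rewrite big_ord2; have st : 0 < Num.sqrt t by rewrite sqrtr_gt0; have /andP[] := I0T t It.
  have term i : 2^-1 * (h i t * kern 1 1 t (g i t)) =
     1 / (2 * Num.sqrt t) * derive1 normal_cdf (g i t / Num.sqrt t) *
     lim (U T (g i t) t (dist_sub (dist_deriv (mu ord0 n)) (dist_deriv (mu ord_max n))) @[n --> \oo]).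
    rewrite (cvg_lim (@Rhausdorff R) (h_lim i t It)) kern1_derive1.
    generalize (derive1 normal_cdf (g i t / Num.sqrt t)) => N'; field; rewrite gt_eqF//.
  rewrite (term ord0) (term ord_max).
  have signs (a x y x' y' : R) : 1 / a * x * y - 1 / a * x' * y' =
      (-1) ^+ 0 / a * x * y + (-1) ^+ 1 / a * x' * y' by rewrite expr0 expr1 !mulNr.
  exact: signs.
Qed.
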